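(* Let $H$ and $H'$ be separable infinite-dimensional complex Hilbert spaces. Let $v\colon\mathcal R(H,H')\to\mathcal U(H)$ be a map which is both Riesz-to-norm and graph-to-strong continuous and such that the map $\Phi\colon\mathcal R(H,H')\to\mathcal R(H,H')$, $\Phi(A)=A\cdot v(A)$, is graph-to-Riesz continuous. Then the restriction of $\Phi$ to operators with compact resolvents, considered as a map ${}^g\mathcal R_K(H,H')\to{}^r\mathcal R_K(H,H')$, is homotopy inverse to the identity map ${}^r\mathcal R_K(H,H')\to{}^g\mathcal R_K(H,H')$. Similarly, the restriction of $\Phi$ to Fredholm operators, considered as a map ${}^g\mathcal R_F(H,H')\to{}^r\mathcal R_F(H,H')$, is homotopy inverse to the identity map ${}^r\mathcal R_F(H,H')\to{}^g\mathcal R_F(H,H')$.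
   Context: A regular operator from $H$ to $H'$ is a closed densely defined (possibly unbounded) linear operator from $H$ to $H'$; $\mathcal R(H,H')$ is the set of all of them. $\mathcal U(H)$ is the group of unitary operators on $H$; $A\cdot v$ denotes composition. The Riesz topology on $\mathcal R(H,H')$ is induced from the norm topology on bounded operators $\mathcal B(H,H')$ by the injective map $\chi(A)=A(1+A^*A)^{-1/2}$. The graph topology is induced from the norm topology on orthogonal projections in $H\oplus H'$ by the injective map taking $A$ to the orthogonal projection onto its graph. The Riesz topology is finer than the graph topology. A left superscript $r$, resp. $g$, indicates that a subset of $\mathcal R(H,H')$ is equipped with the Riesz, resp. graph topology. ''Riesz-to-norm continuous'' means continuous from the Riesz topology to the norm topology on $\mathcal U(H)$; ''graph-to-strong continuous'' means continuous from the graph topology to the strong operator topology on $\mathcal U(H)$; ''graph-to-Riesz continuous'' means continuous from the graph topology on the source to the Riesz topology on the target. A regular operator $A$ has compact resolvents if both $(1+A^*A)^{-1}$ and $(1+AA^* )^{-1}$ are compact operators; $\mathcal R_K(H,H')$ is the set of such operators. A regular operator is Fredholm if its range is closed and its kernel and cokernel are finite-dimensional; $\mathcal R_F(H,H')$ is the set of such operators. Both subsets are invariant under multiplication by unitary operators, so $\Phi$ maps each of them into itself. *)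

(* Defs.v *)
From HB Require Import structures.
From mathcomp Require Import all_boot all_order all_algebra sesquilinear.
From mathcomp Require Import complex ring.
From mathcomp Require Import all_classical all_reals topology normedtype.

Set Implicit Arguments.
Unset Strict Implicit.
Unset Printing Implicit Defensive.

Import Order.TTheory GRing.Theory Num.Theory.
Import numFieldNormedType.Exports.

Local Open Scope classical_set_scope.
Local Open Scope ring_scope.
Local Open Scope complex_scope.

(** * Complex Hilbert spaces *)

(* The inner product is linear in its first argument. *)
HB.mixin Record CompleteNormedModule_isHilbert (R : realType) (H : Type)
    & CompleteNormedModule R[i] H := {
  dot : {dot H for (@Num.conj R[i])};
  dotE : forall x : H, dot x x = `|x| ^+ 2
}.

#[short(type="hilbertType")]
HB.structure Definition Hilbert (R : realType) :=
  {H of CompleteNormedModule R[i] H & CompleteNormedModule_isHilbert R H}.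

Notation "''[' x , y ]" := (dot x%R y%R) (format "''[' x ,  y ]") : ring_scope.

Definition separable (T : topologicalType) :=
  exists D : set T, countable D /\ dense D.

Section dimension.
Context {K : numFieldType} {V : lmodType K}.

Definition finite_dim (W : set V) :=
  exists n (e : 'I_n -> V), (forall i, W (e i)) /\
    forall x, W x -> exists c : 'I_n -> K, x = \sum_(i < n) c i *: e i.

(* the quotient of V by W is spanned by finitely many classes *)
Definition finite_codim (W : set V) :=
  exists n (e : 'I_n -> V),
    forall x, exists c : 'I_n -> K, W (x - \sum_(i < n) c i *: e i).

End dimension.

Definition infinite_dim {K : numFieldType} (V : lmodType K) :=
  ~ finite_dim [set: V].

(** * Hilbert direct sum *)

(* The library norm on [H * H'] is the max norm, hence the separate type. *)
Definition hsum (R : realType) (H H' : hilbertType R) : Type := (H * H')%type.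

Section hsum.
Context {R : realType} {H H' : hilbertType R}.
Local Notation C := R[i].
Local Notation T := (hsum H H').

HB.instance Definition _ := GRing.Lmodule.copy T (H * H')%type.

Definition hsum_norm (p : T) : C := sqrtC (`|p.1| ^+ 2 + `|p.2| ^+ 2).

Lemma hsum_norm_sqr (p : T) : hsum_norm p ^+ 2 = `|p.1| ^+ 2 + `|p.2| ^+ 2.
Proof. exact: sqrtCK. Qed.

Lemma hsum_norm_ge0 (p : T) : 0 <= hsum_norm p.
Proof. by rewrite sqrtC_ge0 addr_ge0// exprn_ge0. Qed.

Lemma hsum_normD (p q : T) : hsum_norm (p + q) <= hsum_norm p + hsum_norm q.
Proof.
have P0 := hsum_norm_ge0 p; have Q0 := hsum_norm_ge0 q.
rewrite -(@ler_pXn2r _ 2%N)// ?nnegrE ?hsum_norm_ge0 ?addr_ge0//.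
rewrite sqrrD !hsum_norm_sqr /=.
set a := `|p.1|; set b := `|p.2|; set c := `|q.1|; set d := `|q.2|.
have [a0 b0 c0 d0] : [/\ 0 <= a, 0 <= b, 0 <= c & 0 <= d] by rewrite !normr_ge0.
have key : a * c + b * d <= hsum_norm p * hsum_norm q.
  rewrite -(@ler_pXn2r _ 2%N)// ?nnegrE ?addr_ge0 ?mulr_ge0//.
  rewrite exprMn !hsum_norm_sqr -/a -/b -/c -/d -subr_ge0.
  have -> : (a ^+ 2 + b ^+ 2) * (c ^+ 2 + d ^+ 2) - (a * c + b * d) ^+ 2 =
      (a * d - b * c) ^+ 2.
    by ring.
  rewrite real_exprn_even_ge0// realB// realM// ger0_real//.
apply: le_trans (_ : (a + c) ^+ 2 + (b + d) ^+ 2 <= _).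
  by apply: lerD; rewrite ler_pXn2r ?nnegrE ?addr_ge0// ler_normD.
rewrite !sqrrD.
have -> : a ^+ 2 + (a * c) *+ 2 + c ^+ 2 + (b ^+ 2 + (b * d) *+ 2 + d ^+ 2) =
  a ^+ 2 + b ^+ 2 + (a * c + b * d) *+ 2 + (c ^+ 2 + d ^+ 2).
  by ring.
by rewrite lerD2r lerD2l lerMn2r key orbT.
Qed.

Lemma hsum_normZ (l : C) (p : T) : hsum_norm (l *: p) = `|l| * hsum_norm p.
Proof.
apply/eqP; rewrite -(@eqrXn2 _ 2)// ?mulr_ge0 ?hsum_norm_ge0//.
by rewrite exprMn !hsum_norm_sqr /= !normrZ !exprMn -mulrDr.
Qed.

Lemma hsum_norm0_eq0 (p : T) : hsum_norm p = 0 -> p = 0.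
Proof.
move=> /eqP; rewrite sqrtC_eq0 paddr_eq0 ?exprn_ge0// !expf_eq0/= !normr_eq0.
by case: p => x y /= /andP[/eqP -> /eqP ->].
Qed.

HB.instance Definition _ := @Lmodule_isNormed.Build C T
  hsum_norm hsum_normD hsum_normZ hsum_norm0_eq0.

Lemma hsum_normE (p : T) : `|p| = hsum_norm p. Proof. by []. Qed.

Lemma hsum_norm_fst (p : T) : `|p.1| <= `|p|.
Proof.
rewrite -(@ler_pXn2r _ 2%N)// ?nnegrE// [X in _ <= X]hsum_norm_sqr.
by rewrite lerDl exprn_ge0.
Qed.

Lemma hsum_norm_snd (p : T) : `|p.2| <= `|p|.
Proof.
rewrite -(@ler_pXn2r _ 2%N)// ?nnegrE// [X in _ <= X]hsum_norm_sqr.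
by rewrite lerDr exprn_ge0.
Qed.

Lemma hsum_norm_le (p : T) : `|p| <= `|p.1| + `|p.2|.
Proof.
rewrite -(@ler_pXn2r _ 2%N)// ?nnegrE ?addr_ge0// [X in X <= _]hsum_norm_sqr.
by rewrite sqrrD addrAC lerDl mulrn_wge0// mulr_ge0.
Qed.

Lemma hsum_complete (F : set_system T) : ProperFilter F -> cauchy F -> cvg F.
Proof.
move=> FF /cauchyP Fc.
have F1 : cvg ((fun p : T => p.1) @ F).
  apply: cauchy_cvg; apply/cauchyP => e e0.
  have [p Fp] := Fc e e0; exists p.1; apply: (@filterS _ F) Fp => q /=.
  rewrite -!ball_normE /ball_ /=; apply: le_lt_trans.
  exact: (hsum_norm_fst (p - q)).
have F2 : cvg ((fun p : T => p.2) @ F).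
  apply: cauchy_cvg; apply/cauchyP => e e0.
  have [p Fp] := Fc e e0; exists p.2; apply: (@filterS _ F) Fp => q /=.
  rewrite -!ball_normE /ball_ /=; apply: le_lt_trans.
  exact: (hsum_norm_snd (p - q)).
apply/cvg_ex; exists (lim ((fun p : T => p.1) @ F), lim ((fun p : T => p.2) @ F)).
apply/cvgrPdist_lt => e e0.
have e20 : 0 < e / 2 by rewrite divr_gt0.
move/cvgrPdist_lt : F1 => /(_ _ e20) F1.
move/cvgrPdist_lt : F2 => /(_ _ e20) F2.
near=> p.
rewrite (le_lt_trans (hsum_norm_le _))//= [e](splitr e) ltrD//; near: p.
  exact: F1.
exact: F2.
Unshelve. all: by end_near. Qed.

HB.instance Definition _ := Uniform_isComplete.Build T hsum_complete.

Definition hsum_dot (p q : T) : C := '[p.1, q.1] + '[p.2, q.2].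


Lemma hsum_dot_bilinear :
  bilinear_for ( *%R) (Num.conj \; *%R) (hsum_dot : T -> T -> C).
Proof.
split=> p a q r; rewrite /hsum_dot /=.
  by rewrite !linearDl !linearZl_LR /= mulrDr addrACA.
by rewrite !linearDr !linearZr_LR /= mulrDr addrACA.
Qed.

HB.instance Definition _ := bilinear_isBilinear.Build C T T C
  ( *%R) (Num.conj \; *%R) hsum_dot hsum_dot_bilinear.

Lemma hsum_dot_hermitian (p q : T) :
  hsum_dot p q = (-1) ^+ false * (hsum_dot q p)^*%R.
Proof.
by rewrite /hsum_dot expr0 mul1r rmorphD (hermC dot p.1) (hermC dot p.2)
  !expr0 !mul1r.
Qed.

HB.instance Definition _ := isHermitianSesquilinear.Build C T false Num.conj
  hsum_dot hsum_dot_hermitian.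

Lemma hsum_dotE (p : T) : hsum_dot p p = `|p| ^+ 2.
Proof. by rewrite hsum_normE hsum_norm_sqr /hsum_dot !dotE. Qed.

Lemma hsum_dot_gt0 (p : T) : p != 0 -> 0 < hsum_dot p p.
Proof. by move=> p0; rewrite hsum_dotE exprn_gt0// normr_gt0. Qed.

HB.instance Definition _ := isDotProduct.Build C T hsum_dot hsum_dot_gt0.

HB.instance Definition _ := @CompleteNormedModule_isHilbert.Build R T
  hsum_dot hsum_dotE.

End hsum.

(** * Bounded operators *)

Section bounded_op.
Context {R : realType} {H H' : hilbertType R}.
Local Notation C := R[i].

Definition bounded_linear : {pred H -> H'} := [pred f : H -> H' |
  `[< linear f /\ exists M : C, forall x, `|f x| <= M * `|x| >]].

Record bounded_op := BoundedOp {
  bop_fun :> H -> H';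
  bop_funP : bop_fun \in bounded_linear
}.

HB.instance Definition _ := [isSub for bop_fun].
HB.instance Definition _ := [Choice of bounded_op by <:].

Lemma bounded_linearP (f : H -> H') : reflect
  (linear f /\ exists M : C, forall x, `|f x| <= M * `|x|)
  (f \in bounded_linear).
Proof. exact: asboolP. Qed.

Lemma bounded_linear_submod : submod_closed bounded_linear.
Proof.
split=> [|a f g /bounded_linearP[lf [M fM]] /bounded_linearP[lg [N gN]]].
  apply/bounded_linearP; split=> [a x y|].
    by rewrite /= scaler0 addr0.
  by exists 0 => x; rewrite normr0 mul0r.
apply/bounded_linearP; split=> [b x y|].
  by rewrite !fctE lf lg !scalerDr !scalerA [a * b]mulrC addrACA.
exists (`|a| * M + N) => x; rewrite !fctE (le_trans (ler_normD _ _))//.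
by rewrite mulrDl lerD// normrZ -mulrA ler_wpM2l.
Qed.

HB.instance Definition _ :=
  GRing.isSubmodClosed.Build C (H -> H') bounded_linear bounded_linear_submod.
HB.instance Definition _ := [SubChoice_isSubLmodule of bounded_op by <:].

(* |T| = sup { |T x| : |x| <= 1 }; a norm in a normed module over R[i] takes
   its values in R[i]. *)
Definition opnorm (T : bounded_op) : C :=
  (sup [set complex.Re `|T x| | x in [set x | `|x| <= 1]])%:C.


Lemma bop_linear (T : bounded_op) : linear T.
Proof. by have /bounded_linearP[] := bop_funP T. Qed.

Lemma bop0 (T : bounded_op) : T 0 = 0.
Proof. by have := bop_linear T (-1) 0 0; rewrite scaler0 addr0 scaleN1r addNr. Qed.

Lemma bopZ (T : bounded_op) a x : T (a *: x) = a *: T x.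
Proof. by have := bop_linear T a x 0; rewrite bop0 !addr0. Qed.

Lemma bopD (T : bounded_op) x y : T (x + y) = T x + T y.
Proof. by have := bop_linear T 1 x y; rewrite !scale1r. Qed.

Lemma bopB (T : bounded_op) x y : T (x - y) = T x - T y.
Proof. by rewrite bopD -scaleN1r bopZ scaleN1r. Qed.

Lemma bop_inj (S T : bounded_op) : S =1 T -> S = T.
Proof. by move=> ST; apply/val_inj/funext. Qed.

Lemma Re_norm (V : normedModType C) (x : V) : (complex.Re `|x|)%:C = `|x|.
Proof. by rewrite RRe_real// normr_real. Qed.

Let opset (T : bounded_op) := [set complex.Re `|T x| | x in [set x | `|x| <= 1]].

Let opset_has_sup T : has_sup (opset T).
Proof.
split; first by exists (complex.Re `|T 0|); exists 0 => //=; rewrite normr0 ler01.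
have /bounded_linearP[_ [M TM]] := bop_funP T.
exists (complex.Re `|M|) => _ [x /= x1 <-].
have : `|T x| <= `|M|.
  apply: le_trans (TM x) _; apply: le_trans (_ : `|M| * `|x| <= _).
    have [->|x0] := eqVneq `|x| 0; first by rewrite !mulr0.
    rewrite ler_wpM2r// real_ler_norm//.
    have := le_trans (normr_ge0 _) (TM x).
    by rewrite pmulr_lge0 ?lt_neqAle ?normr_ge0 ?[0 == _]eq_sym ?x0//; exact: ger0_real.
  by rewrite ler_piMr.
by rewrite -2!Re_norm lecR.
Qed.

Lemma opnorm_ge0 T : 0 <= opnorm T.
Proof.
rewrite /opnorm -[0]/(0%:C) lecR; apply: le_trans (_ : complex.Re `|T 0| <= _).
  by rewrite bop0 normr0.
by apply: ub_le_sup; [case: (opset_has_sup T)|exists 0 => //=; rewrite normr0].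
Qed.

Lemma le_opnorm1 (T : bounded_op) x : `|x| <= 1 -> `|T x| <= opnorm T.
Proof.
move=> x1; rewrite -Re_norm lecR.
by apply: ub_le_sup; [case: (opset_has_sup T)|exists x].
Qed.

Lemma le_opnorm (T : bounded_op) x : `|T x| <= opnorm T * `|x|.
Proof.
have [->|x0] := eqVneq x 0; first by rewrite bop0 !normr0 mulr0.
rewrite -ler_pdivrMr ?normr_gt0//.
have : `|T (`|x|^-1 *: x)| <= opnorm T.
  by apply: le_opnorm1; rewrite normrZ normfV normr_id mulVf ?normr_eq0.
by rewrite bopZ normrZ normfV normr_id mulrC.
Qed.

Lemma opnorm_le (T : bounded_op) (M : C) :
  (forall x, `|x| <= 1 -> `|T x| <= M) -> opnorm T <= M.
Proof.
move=> TM; have M0 : 0 <= M by apply: le_trans (TM 0 _); rewrite ?normr0 ?ler01.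
have ME : M = (complex.Re M)%:C by rewrite RRe_real// ger0_real.
rewrite ME lecR; apply: ge_sup; first by case: (opset_has_sup T).
by move=> _ [x /= x1 <-]; have := TM x x1; rewrite -Re_norm ME lecR.
Qed.

Lemma opnormD S T : opnorm (S + T) <= opnorm S + opnorm T.
Proof.
apply: opnorm_le => x x1; apply: le_trans (ler_normD _ _) _.
by rewrite lerD// le_opnorm1.
Qed.

Lemma opnormZ_le (l : C) T : opnorm (l *: T) <= `|l| * opnorm T.
Proof.
apply: opnorm_le => x x1; rewrite [X in `|X| <= _]/(l *: T x) normrZ.
by rewrite ler_wpM2l// le_opnorm1.
Qed.

Lemma opnorm0_eq0 T : opnorm T = 0 -> T = 0.
Proof.
move=> T0; apply: bop_inj => x; apply/eqP; rewrite -normr_le0.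
by have := le_opnorm T x; rewrite T0 mul0r.
Qed.

Lemma opnormZ (l : C) T : opnorm (l *: T) = `|l| * opnorm T.
Proof.
apply/le_anti; rewrite opnormZ_le/=.
have [->|l0] := eqVneq l 0; first by rewrite normr0 mul0r opnorm_ge0.
rewrite -ler_pdivlMl ?normr_gt0// -normfV.
by apply: le_trans (opnormZ_le _ _); rewrite scalerA mulVf// scale1r.
Qed.

HB.instance Definition _ := @Lmodule_isNormed.Build C bounded_op
  opnorm opnormD opnormZ opnorm0_eq0.

End bounded_op.
Arguments bounded_op {R} H H'.

(** * Operators as graphs *)

Section graphs.
Context {R : realType}.
Implicit Types H : hilbertType R.

Definition op_graph H H' (T : H -> H') : set (hsum H H') :=
  [set p | T p.1 = p.2].

(* first A, then B *)
Definition graph_comp H1 H2 H3 (B : set (hsum H2 H3)) (A : set (hsum H1 H2)) :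
  set (hsum H1 H3) := [set p | exists y, A (p.1, y) /\ B (y, p.2)].

Definition graph_adj H H' (A : set (hsum H H')) : set (hsum H' H) :=
  [set p | forall q, A q -> '[q.2, p.1] = '[q.1, p.2]].

Definition graph_addr1 H (A : set (hsum H H)) : set (hsum H H) :=
  [set p | A (p.1, p.2 - p.1)].

Definition graph_inv H H' (A : set (hsum H H')) : set (hsum H' H) :=
  [set p | A (p.2, p.1)].

Definition graph_dom H H' (A : set (hsum H H')) : set H :=
  [set x | exists y, A (x, y)].

Definition graph_ran H H' (A : set (hsum H H')) : set H' :=
  [set y | exists x, A (x, y)].

Definition graph_ker H H' (A : set (hsum H H')) : set H := [set x | A (x, 0)].

(* The everywhere defined bounded operator with graph A. The default value 0 of
   get is irrelevant: by von Neumann's theorem on A^* A the operator exists in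
   all the uses below. *)
Definition bop_of H H' (A : set (hsum H H')) : bounded_op H H' :=
  get [set T : bounded_op H H' | op_graph T = A].

(* the positive square root, for a positive T *)
Definition bop_sqrt H (T : bounded_op H H) : bounded_op H H :=
  get [set S : bounded_op H H |
    (forall x, 0 <= '[S x, x]) /\ forall x, S (S x) = T x].

(* the orthogonal projection onto W, for a closed subspace W *)
Definition orthoproj H (W : set H) : bounded_op H H :=
  get [set P : bounded_op H H |
    forall x, W (P x) /\ forall w, W w -> '[x - P x, w] = 0].

Definition compact_op H H' (T : bounded_op H H') :=
  precompact (T @` [set x | `|x| <= 1]).

End graphs.

(** * Regular operators *)

(* A regular operator is identified with its graph. *)
Record regular (R : realType) (H H' : hilbertType R) := Regular {
  rgraph : set (hsum H H');
  rgraph0 : rgraph 0;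
  rgraphD : forall (a : R[i]) p q, rgraph p -> rgraph q -> rgraph (a *: p + q);
  rgraph_fun : forall x y y', rgraph (x, y) -> rgraph (x, y') -> y = y';
  rgraph_closed : closed rgraph;
  rgraph_dense : dense (graph_dom rgraph)
}.
Arguments regular {R} H H'.

HB.instance Definition _ (R : realType) (H H' : hilbertType R) :=
  gen_eqMixin (regular H H').
HB.instance Definition _ (R : realType) (H H' : hilbertType R) :=
  gen_choiceMixin (regular H H').

Section regular.
Context {R : realType} {H H' : hilbertType R}.
Implicit Type A : regular H H'.

(* (1 + A^* A)^-1 *)
Definition resolvent A : bounded_op H H :=
  bop_of (graph_inv (graph_addr1 (graph_comp (graph_adj (rgraph A)) (rgraph A)))).

(* (1 + A A^* )^-1 *)
Definition coresolvent A : bounded_op H' H' :=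
  bop_of (graph_inv (graph_addr1 (graph_comp (rgraph A) (graph_adj (rgraph A))))).

(* A (1 + A^* A)^-1/2 *)
Definition riesz_map A : bounded_op H H' :=
  bop_of (graph_comp (rgraph A) (op_graph (bop_sqrt (resolvent A)))).

Definition graph_proj A : bounded_op (hsum H H') (hsum H H') :=
  orthoproj (rgraph A).

Definition compact_resolvents : set (regular H H') :=
  [set A | compact_op (resolvent A) /\ compact_op (coresolvent A)].

Definition fredholm : set (regular H H') :=
  [set A | [/\ closed (graph_ran (rgraph A)), finite_dim (graph_ker (rgraph A))
    & finite_codim (graph_ran (rgraph A))]].

End regular.

Definition riesz_top (R : realType) (H H' : hilbertType R) : Type :=
  initial_topology (@riesz_map R H H').
Definition graph_top (R : realType) (H H' : hilbertType R) : Type :=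
  initial_topology (@graph_proj R H H').
Arguments riesz_top {R} H H'.
Arguments graph_top {R} H H'.

HB.instance Definition _ (R : realType) (H H' : hilbertType R) :=
  Topological.copy (riesz_top H H') (initial_topology (@riesz_map R H H')).
HB.instance Definition _ (R : realType) (H H' : hilbertType R) :=
  Topological.copy (graph_top H H') (initial_topology (@graph_proj R H H')).

(** * Unitary operators *)

Record unitary (R : realType) (H : hilbertType R) := Unitary {
  unitary_op :> bounded_op H H;
  unitary_dot : forall x y, '[unitary_op x, unitary_op y] = '[x, y];
  unitary_surj : forall y, exists x, unitary_op x = y
}.

HB.instance Definition _ (R : realType) (H : hilbertType R) :=
  gen_eqMixin (unitary H).
HB.instance Definition _ (R : realType) (H : hilbertType R) :=
  gen_choiceMixin (unitary H).

Definition unitary_norm_top (R : realType) (H : hilbertType R) : Type :=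
  initial_topology (@unitary_op R H).
Definition unitary_strong_top (R : realType) (H : hilbertType R) : Type :=
  initial_topology (fun u : unitary H => (u : H -> H) : {ptws H -> H}).

HB.instance Definition _ (R : realType) (H : hilbertType R) :=
  Topological.copy (unitary_norm_top H) (initial_topology (@unitary_op R H)).
HB.instance Definition _ (R : realType) (H : hilbertType R) :=
  Topological.copy (unitary_strong_top H)
    (initial_topology (fun u : unitary H => (u : H -> H) : {ptws H -> H})).

(** * Composition with a unitary operator *)

Section unitary_theory.
Context {R : realType} {H : hilbertType R} (u : unitary H).

Lemma unitary_normE x : `|u x| = `|x|.
Proof.
by apply/eqP; rewrite -(@eqrXn2 _ 2)// -!dotE unitary_dot.
Qed.

Lemma unitary_inj x y : u x = u y -> x = y.
Proof.
by move/eqP; rewrite -subr_eq0 -bopB -normr_eq0 unitary_normE normr_eq0 subr_eq0 => /eqP.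
Qed.

Definition unitary_inv_fun (y : H) : H := get [set x | u x = y].

Lemma unitary_invK y : u (unitary_inv_fun y) = y.
Proof. by have /getPex := unitary_surj u y. Qed.

Lemma unitaryK x : unitary_inv_fun (u x) = x.
Proof. by apply: unitary_inj; rewrite unitary_invK. Qed.

Lemma unitary_inv_norm y : `|unitary_inv_fun y| = `|y|.
Proof. by rewrite -{2}(unitary_invK y) unitary_normE. Qed.

Lemma unitary_inv_linear : linear unitary_inv_fun.
Proof.
by move=> a x y; apply: unitary_inj; rewrite bop_linear !unitary_invK.
Qed.

Lemma unitary_inv_bounded : unitary_inv_fun \in bounded_linear.
Proof.
apply/bounded_linearP; split; first exact: unitary_inv_linear.
by exists 1 => x; rewrite unitary_inv_norm mul1r.
Qed.

Definition unitary_inv_op : bounded_op H H := BoundedOp unitary_inv_bounded.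

End unitary_theory.

Section bounded_op_theory.
Context {R : realType}.
Implicit Types H : hilbertType R.

Lemma bop_continuous H H' (T : bounded_op H H') : continuous T.
Proof.
move=> x; apply/cvgrPdist_lt => e e0.
have M0 : 0 < opnorm T + 1 by rewrite ltr_wpDl// opnorm_ge0.
near=> y.
rewrite -bopB (le_lt_trans (le_opnorm _ _))//.
apply: le_lt_trans (_ : (opnorm T + 1) * `|x - y| < e).
  by rewrite ler_wpM2r// lerDl.
rewrite -ltr_pdivlMl//; near: y.
by apply: cvgr_dist_lt => //; rewrite mulr_gt0// invr_gt0.
Unshelve. all: by end_near. Qed.

Lemma bop_comp_bounded H1 H2 H3 (S : bounded_op H2 H3) (T : bounded_op H1 H2) :
  (S \o T) \in bounded_linear.
Proof.
apply/bounded_linearP; split=> [a x y|]; first by rewrite /= !bop_linear.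
exists (opnorm S * opnorm T) => x /=; rewrite (le_trans (le_opnorm _ _))//.
by rewrite -mulrA ler_wpM2l ?opnorm_ge0// le_opnorm.
Qed.

Definition bop_comp H1 H2 H3 (S : bounded_op H2 H3) (T : bounded_op H1 H2) :
  bounded_op H1 H3 := BoundedOp (bop_comp_bounded S T).

End bounded_op_theory.

Section mulu.
Context {R : realType} {H H' : hilbertType R}.
Variables (A : regular H H') (u : unitary H).

Let G : set (hsum H H') := graph_comp (rgraph A) (op_graph u).

Let GE x y : G (x, y) = rgraph A (u x, y).
Proof.
apply/propext; split=> [[z [uz Az]]|Axy]; last by exists (u x).
by rewrite (uz : u x = z).
Qed.

Let G0 : G 0. Proof. by rewrite [0]surjective_pairing GE bop0; exact: rgraph0. Qed.

Let GD (a : R[i]) p q : G p -> G q -> G (a *: p + q).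
Proof.
case: p q => x y [x' y']; rewrite (GE x) (GE x') => /(rgraphD a) /[apply].
by rewrite GE bop_linear.
Qed.

Let G_fun x y y' : G (x, y) -> G (x, y') -> y = y'.
Proof. by rewrite !GE; exact: rgraph_fun. Qed.

Let G_closed : closed G.
Proof.
pose f (p : hsum H H') : hsum H H' := (u p.1, p.2).
have fb : f \in bounded_linear.
  apply/bounded_linearP; split=> [a [x y] [x' y']|].
    by rewrite /f/= bop_linear.
  by exists 1 => p; rewrite mul1r !hsum_normE /hsum_norm /f/= unitary_normE.
have cf : continuous f by exact: (@bop_continuous R _ _ (BoundedOp fb)).
have -> : G = f @^-1` rgraph A by apply/seteqP; split=> -[x y]; rewrite GE.
by apply: closed_comp => //; exact: rgraph_closed.
Qed.

Let G_dense : dense (graph_dom G).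
Proof.
move=> O [x Ox] Oo.
have [||y [Oy [z Ayz]]] := @rgraph_dense R H H' A (unitary_inv_op u @^-1` O).
- by exists (u x); rewrite /preimage/= unitaryK.
- by apply: open_comp => // y _; exact: bop_continuous.
- exists (unitary_inv_fun u y); split=> //; exists z.
  by rewrite GE unitary_invK.
Qed.

Definition mulu : regular H H' := Regular G0 GD G_fun G_closed G_dense.

Lemma muluE x y : rgraph mulu (x, y) = rgraph A (u x, y).
Proof. exact: GE. Qed.

End mulu.

Notation "A \*u v" := (mulu A v) (at level 40, left associativity) : ring_scope.

Section mulu_invariance.
Context {R : realType}.

Lemma op_graph_inj (H H' : hilbertType R) (S T : bounded_op H H') :
  op_graph S = op_graph T -> S = T.
Proof.
move=> ST; apply: bop_inj => x.
have : op_graph S (x, S x) by [].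
by rewrite ST /op_graph/=.
Qed.

Lemma bop_ofE (H H' : hilbertType R) (A : set (hsum H H')) (T : bounded_op H H') :
  op_graph T = A -> bop_of A = T.
Proof.
by move=> TA; apply: op_graph_inj; rewrite TA; exact: (getPex (ex_intro [set S : bounded_op H H' | op_graph S = A] T TA)).
Qed.

Context {H H' : hilbertType R} (A : regular H H') (u : unitary H).

Let conj_graph (W : set (hsum H H)) : set (hsum H H) :=
  [set p | W (u p.1, u p.2)].

Lemma compact_op_conj (W : set (hsum H H)) :
  compact_op (bop_of W) -> compact_op (bop_of (conj_graph W)).
Proof.
move=> cW.
have [[T' T'W]|nT'] := pselect (exists T : bounded_op H H, op_graph T = conj_graph W).
  have TW : op_graph (bop_comp u (bop_comp T' (unitary_inv_op u))) = W.
    apply/seteqP; split=> -[x y]; rewrite /op_graph /=.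
      have : op_graph T' (unitary_inv_fun u x, T' (unitary_inv_fun u x)) by [].
      by rewrite T'W /conj_graph /= unitary_invK => ? <-.
    move=> Wxy.
    have : conj_graph W (unitary_inv_fun u x, unitary_inv_fun u y).
      by rewrite /conj_graph /= !unitary_invK.
    by rewrite -T'W /op_graph/= => ->; rewrite unitary_invK.
  move: cW; rewrite (bop_ofE T'W) (bop_ofE TW) => -[C TC [cC _]].
  exists (unitary_inv_op u @` C).
    move=> _ [x x1 <-]; exists (u (T' x)); last by rewrite /= unitaryK.
    apply: TC; exists (u x); first by rewrite /= unitary_normE.
    by rewrite /= unitaryK.
  have cuC : compact (unitary_inv_op u @` C).
    apply: continuous_compact => //; apply: continuous_subspaceT => x.
    exact: bop_continuous.
  by split=> //; apply: compact_closed => //; exact: norm_hausdorff.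
have -> : bop_of (conj_graph W) = 0.
  by apply: xgetPN => T TW; apply: nT'; exists T.
exists [set 0]; first by move=> _ [x _ <-].
have c0 : compact [set (0 : H)] by exact: compact_set1.
by split=> //; apply: compact_closed => //; exact: norm_hausdorff.
Qed.

Let adj_mulu y w : graph_adj (rgraph (A \*u u)) (y, w) =
  graph_adj (rgraph A) (y, u w).
Proof.
apply/propext; split=> h [a b].
  rewrite -(unitary_invK u a) -muluE => /h /= ->; by rewrite unitary_dot.
by rewrite muluE => /h /= ->; rewrite unitary_dot.
Qed.

Lemma compact_resolvents_mulu :
  compact_resolvents A -> compact_resolvents (A \*u u).
Proof.
move=> [cA cA']; split.
  rewrite /resolvent.
  suff -> : graph_inv (graph_addr1 (graph_comp
      (graph_adj (rgraph (A \*u u))) (rgraph (A \*u u)))) =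
    conj_graph (graph_inv (graph_addr1 (graph_comp
      (graph_adj (rgraph A)) (rgraph A)))) by exact: compact_op_conj.
  rewrite /graph_inv /graph_addr1 /graph_comp /conj_graph.
  apply/seteqP; split=> -[z x] /= [y [xy yz]]; exists y; split.
  - by rewrite -muluE.
  - by rewrite -bopB -adj_mulu.
  - by have : rgraph (A \*u u) (x, y) by rewrite muluE.
  - by have : graph_adj (rgraph (A \*u u)) (y, z - x) by rewrite adj_mulu bopB.
rewrite /coresolvent.
suff -> : graph_comp (rgraph (A \*u u)) (graph_adj (rgraph (A \*u u))) =
  graph_comp (rgraph A) (graph_adj (rgraph A)) by [].
rewrite /graph_comp; apply/seteqP; split=> -[z y] /= [x [zx xy]].
  by exists (u x); rewrite -adj_mulu -muluE.
exists (unitary_inv_fun u x); split.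
  have : graph_adj (rgraph (A \*u u)) (z, unitary_inv_fun u x) by
    rewrite adj_mulu unitary_invK.
  by [].
by have : rgraph (A \*u u) (unitary_inv_fun u x, y) by rewrite muluE unitary_invK.
Qed.

Lemma fredholm_mulu : fredholm A -> fredholm (A \*u u).
Proof.
have -> : fredholm (A \*u u) = [/\ closed (graph_ran (rgraph A)),
    finite_dim (graph_ker (rgraph (A \*u u)))
    & finite_codim (graph_ran (rgraph A))].
  rewrite /fredholm/=.
  suff -> : graph_ran (rgraph (A \*u u)) = graph_ran (rgraph A) by [].
  apply/seteqP; split=> y [x]; first by rewrite muluE; exists (u x).
  by move=> Axy; exists (unitary_inv_fun u x); rewrite muluE unitary_invK.
move=> [cA [n [e [Ae eA]]] fA]; split=> //.
exists n, (unitary_inv_fun u \o e); split=> [i|x].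
  by rewrite /graph_ker/mkset muluE unitary_invK; exact: Ae.
rewrite /graph_ker/mkset muluE => /eA [c uxE]; exists c.
apply: (@unitary_inj _ _ u); rewrite uxE.
elim/big_ind2 : _ => [|x1 x2 y1 y2 -> ->|i _].
- by rewrite bop0.
- by rewrite bopD.
- by rewrite bopZ unitary_invK.
Qed.

End mulu_invariance.

(** * Subspaces of regular operators *)

Section subspaces.
Context {R : realType} {H H' : hilbertType R}.
Implicit Type P : set (regular H H').

Definition riesz_sub P : Type := set_type (P : set (riesz_top H H')).
Definition graph_sub P : Type := set_type (P : set (graph_top H H')).

HB.instance Definition _ P :=
  Topological.copy (riesz_sub P) (set_type (P : set (riesz_top H H'))).
HB.instance Definition _ P :=
  Topological.copy (graph_sub P) (set_type (P : set (graph_top H H'))).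

(* the identity map *)
Definition riesz_to_graph P : riesz_sub P -> graph_sub P := fun A => A.

Definition graph_to_riesz P (f : regular H H' -> regular H H')
    (fP : forall A, P A -> P (f A)) : graph_sub P -> riesz_sub P :=
  fun A => SigSub (mem_set (fP (set_val A) (set_valP A))).

Variable v : regular H H' -> unitary H.

Definition Phi (A : regular H H') : regular H H' := A \*u v A.

Lemma Phi_compact_resolvents A : compact_resolvents A -> compact_resolvents (Phi A).
Proof. exact: compact_resolvents_mulu. Qed.

Lemma Phi_fredholm A : fredholm A -> fredholm (Phi A).
Proof. exact: fredholm_mulu. Qed.

End subspaces.

(** * Homotopies *)

Definition homotopic (R : realType) (X Y : topologicalType) (f g : X -> Y) :=
  exists h : X * R -> Y,
    [/\ {within [set: X] `*` `[0, 1], continuous h},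
        forall x, h (x, 0) = f x & forall x, h (x, 1) = g x].

(* f and g are continuous and mutually inverse up to homotopy *)
Definition homotopy_inverse (R : realType) (X Y : topologicalType)
    (f : X -> Y) (g : Y -> X) :=
  [/\ continuous f, continuous g, homotopic R (g \o f) idfun
    & homotopic R (f \o g) idfun].

(* Main.v *)
Require Import Defs.
From mathcomp Require Import all_boot all_order all_algebra.
From mathcomp Require Import complex.
From mathcomp Require Import all_classical all_reals topology normedtype.
From mathcomp Require Import sesquilinear ring lra finmap.
(* imported again so that [rgraph] denotes the graph of a regular operator *)
Require Import Defs.

(** Let $\chi(A) = A(1+A^*A)^{-1/2}$.  Both composites in each statement are the map
   $A\mapsto Av(A)$, once in the Riesz and once in the graph topology; so this map has
   to be joined to the identity in either topology, among operators with compact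
   resolvents and among Fredholm operators.

   Riesz topology ([riesz_homotopy]).  The image of $\chi$ is stable under
   multiplication by $t\in[0,1]$ ([scaled_exists]), so one can let the argument of $v$
   alone move from $A$ to $0$, along $\chi^{-1}(t\chi(A))$.  This joins $Av(A)$ to
   $Av(0)$, and $v(0)$ is joined to $1$ in the unitary group ([unitary_connected]): a
   unitary is a product of two unitaries with nonnegative real part, and each of these
   is joined to $1$ by shrinking its inverse Cayley transform.  All stages are
   multiples of $A$ by unitaries, so both classes of operators are preserved.

   Graph topology, compact resolvents ([compact_homotopy]).  The graph of $Av(A)$ is
   the image of the graph of $A$ under $v(A)^{-1}\oplus 1$.  More generally, a bounded
   injective $T$ with dense range moves $A$ to the operator [push T A] with graph
   $(T\oplus 1)(\mathrm{graph}\,A)$, as soon as $T\oplus 1$ is bounded below on the graph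
   of $A$ ([push_exists]).  If $A$ has compact resolvents, the unit ball of its domain,
   for the graph norm, is totally bounded in $H$.  This has two consequences: every
   injective $T$ is admissible ([compact_bounded_below]), and the result depends
   continuously on $T$ for the strong topology ([strong_uniform], [push_continuous]).
   So $v(A)^{-1}$ has to be joined to $1$ strongly continuously through injective
   operators with injective adjoint, depending continuously on $v(A)$.  Two positive
   injective operators $K$ and $Y$ whose ranges meet only in $0$ ([disjoint_ranges])
   allow this: shrink $u=v(A)^{-1}$ to $KuK$, move from $KuK$ to $Y$ by convex
   combinations, where no cancellation can occur, and expand $Y$ to $1$.

   Graph topology, Fredholm operators.  A Fredholm operator is bounded below modulo its
   kernel ([closed_ran_bounded_below], through uniform boundedness), so $(1-b)+bK$ with
   $K$ compact is admissible for it.  This joins the identity to a map $L$ whose values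
   have compact resolvents ([fredholm_homotopy]).  If $G$ is the map $A\mapsto Av(A)$,
   then $G$ is homotopic to $G\circ L$, which is homotopic to $L$ by the previous case,
   hence to the identity.

   The identity map from the Riesz to the graph topology is continuous because
   $z\mapsto((1+A^*A)^{-1/2}z,\chi(A)z)$ is an isometry onto the graph ([polar]) and the
   square root is norm continuous ([sqrt1m_close], [riesz_graph_close]). *)

Set Implicit Arguments.
Unset Strict Implicit.
Unset Printing Implicit Defensive.

Import Order.TTheory GRing.Theory Num.Theory.
Import numFieldNormedType.Exports.

Local Open Scope classical_set_scope.
Local Open Scope ring_scope.
Local Open Scope complex_scope.

(** * Real norms *)

(** Norms take their values in $R[i]$, which is only partially ordered; the real
   part makes estimates accessible to linear arithmetic. *)
Definition nm (R : realType) (V : normedModType R[i]) (x : V) : R :=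
  complex.Re `|x|.

Section real_norm.
Context {R : realType}.
Implicit Types V : normedModType R[i].

Lemma nmE V (x : V) : `|x| = (nm x)%:C.
Proof. by rewrite /nm RRe_real// normr_real. Qed.

Lemma nm_ge0 V (x : V) : 0 <= nm x.
Proof. by have := normr_ge0 x; rewrite nmE -[0]/(0%:C) lecR. Qed.

Lemma nm0 V : nm (0 : V) = 0.
Proof. by rewrite /nm normr0. Qed.

Lemma nm_eq0 V (x : V) : nm x = 0 -> x = 0.
Proof. by move=> h; apply/eqP; rewrite -normr_eq0 nmE h. Qed.

Lemma nm_le0 V (x : V) : nm x <= 0 -> x = 0.
Proof. by move=> h; apply: nm_eq0; apply/eqP; rewrite eq_le h nm_ge0. Qed.

Lemma nmD V (x y : V) : nm (x + y) <= nm x + nm y.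
Proof. by rewrite -lecR rmorphD/= -!nmE ler_normD. Qed.

Lemma nmN V (x : V) : nm (- x) = nm x.
Proof. by rewrite /nm normrN. Qed.

Lemma nm_sub V (x y : V) : nm (x - y) = nm (y - x).
Proof. by rewrite -nmN opprB. Qed.

Lemma nmB V (x y : V) : nm (x - y) <= nm x + nm y.
Proof. by rewrite -[nm y]nmN nmD. Qed.

Lemma nm_tri V (z x y : V) : nm (x - y) <= nm (x - z) + nm (z - y).
Proof. by have := nmD (x - z) (z - y); rewrite addrA subrK. Qed.

Lemma nm_small V (x : V) : (forall e, 0 < e -> nm x <= e) -> x = 0.
Proof. by move=> h; apply/nm_le0/ler_addgt0Pr => e; rewrite add0r; exact: h. Qed.

Lemma nm_close V (x y : V) : (forall e, 0 < e -> nm (x - y) <= e) -> x = y.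
Proof. by move=> /nm_small/subr0_eq. Qed.

Lemma nm_ge V (x y : V) : nm x <= nm y + nm (x - y).
Proof. by have := nmD y (x - y); rewrite addrCA subrr addr0. Qed.

Definition cm (a : R[i]) : R := complex.Re `|a|.

Lemma cmE (a : R[i]) : `|a| = (cm a)%:C.
Proof. by rewrite /cm RRe_real// normr_real. Qed.

Lemma cm_ge0 a : 0 <= cm a.
Proof. by have := normr_ge0 a; rewrite cmE -[0]/(0%:C) lecR. Qed.

Lemma cm_real (a : R) : cm a%:C = `|a|.
Proof. by rewrite /cm normc_def /= expr0n /= addr0 sqrtr_sqr. Qed.

Lemma nmZ V (a : R[i]) (x : V) : nm (a *: x) = cm a * nm x.
Proof.
have : (nm (a *: x))%:C = (cm a * nm x)%:C by rewrite rmorphM/= -!nmE -cmE normrZ.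
by case.
Qed.

Lemma nmZr V (a : R) (x : V) : nm (a%:C *: x) = `|a| * nm x.
Proof. by rewrite nmZ cm_real. Qed.

Lemma cmM a b : cm (a * b) = cm a * cm b.
Proof.
have : (cm (a * b))%:C = (cm a * cm b)%:C by rewrite rmorphM/= -!cmE normrM.
by case.
Qed.

Lemma cmD a b : cm (a + b) <= cm a + cm b.
Proof. by rewrite -lecR rmorphD/= -!cmE ler_normD. Qed.

Lemma cmN a : cm (- a) = cm a.
Proof. by rewrite /cm normrN. Qed.

Lemma cm_eq0 a : cm a = 0 -> a = 0.
Proof. by move=> h; apply/eqP; rewrite -normr_eq0 cmE h. Qed.

Lemma cm_small a : (forall e, 0 < e -> cm a <= e) -> a = 0.
Proof.
move=> h; apply: cm_eq0; apply/eqP; rewrite eq_le cm_ge0 andbT.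
by apply/ler_addgt0Pr => e; rewrite add0r; exact: h.
Qed.

Lemma Re_le_cm a : `|complex.Re a| <= cm a.
Proof. by rewrite -lecR -cmE normc_ge_Re. Qed.

Lemma Im_le_cm a : `|complex.Im a| <= cm a.
Proof.
case: a => x y; rewrite /cm normc_def/= -sqrtr_sqr ler_sqrt ?lerDr ?sqr_ge0//.
by rewrite addr_ge0 ?sqr_ge0.
Qed.

End real_norm.

(** * The inner product *)

Section inner_product.
Context {R : realType} {H : hilbertType R}.
Implicit Types (x y z : H) (a b : R[i]) (r : R).

Lemma dotDl x y z : '[x + y, z] = '[x, z] + '[y, z].
Proof. exact: linearDl. Qed.
Lemma dotDr x y z : '[z, x + y] = '[z, x] + '[z, y].
Proof. exact: linearDr. Qed.
Lemma dotNl x z : '[- x, z] = - '[x, z].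
Proof. exact: linearNl. Qed.
Lemma dotNr x z : '[z, - x] = - '[z, x].
Proof. exact: linearNr. Qed.
Lemma dotBl x y z : '[x - y, z] = '[x, z] - '[y, z].
Proof. exact: linearBl. Qed.
Lemma dotBr x y z : '[z, x - y] = '[z, x] - '[z, y].
Proof. exact: linearBr. Qed.
Lemma dotZl a x z : '[a *: x, z] = a * '[x, z].
Proof. by rewrite linearZl_LR. Qed.
Lemma dotZr a x z : '[z, a *: x] = (a^*)%R * '[z, x].
Proof. by rewrite linearZr_LR. Qed.
Lemma dot0l z : '[0, z] = 0 :> R[i]. Proof. exact: linear0l. Qed.
Lemma dot0r z : '[z, 0] = 0 :> R[i]. Proof. exact: linear0r. Qed.
Lemma dotC x y : '[x, y] = ('[y, x]^*)%R.
Proof. by rewrite hermC expr0 mul1r. Qed.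

Lemma conjC_real r : ((r%:C)^*)%R = r%:C.
Proof. by apply: CrealP; rewrite complex_real. Qed.

Lemma dotZrR r x z : '[z, r%:C *: x] = r%:C * '[z, x].
Proof. by rewrite dotZr conjC_real. Qed.

Definition dot_expand := (dotDl, dotDr, dotBl, dotBr, dotNl, dotNr, dotZl, dotZrR,
  dotZr, dot0l, dot0r).

(** This turns an identity of vectors into one of scalars, where [ring] applies. *)
Lemma dot_inj x y : (forall z, '[x, z] = '[y, z]) -> x = y.
Proof.
move=> xy; apply/eqP; rewrite -subr_eq0 -normr_eq0 -sqrf_eq0 -dotE.
by rewrite [X in X == 0](dotBl x y) xy subrr.
Qed.

Definition rdot x y : R := complex.Re '[x, y].

Lemma rdotDl x y z : rdot (x + y) z = rdot x z + rdot y z.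
Proof. by rewrite /rdot dotDl raddfD. Qed.
Lemma rdotDr x y z : rdot z (x + y) = rdot z x + rdot z y.
Proof. by rewrite /rdot dotDr raddfD. Qed.
Lemma rdotNl x z : rdot (- x) z = - rdot x z.
Proof. by rewrite /rdot dotNl raddfN. Qed.
Lemma rdotNr x z : rdot z (- x) = - rdot z x.
Proof. by rewrite /rdot dotNr raddfN. Qed.
Lemma rdotBl x y z : rdot (x - y) z = rdot x z - rdot y z.
Proof. by rewrite rdotDl rdotNl. Qed.
Lemma rdotBr x y z : rdot z (x - y) = rdot z x - rdot z y.
Proof. by rewrite rdotDr rdotNr. Qed.
Lemma Re_mulr r a : complex.Re (r%:C * a) = r * complex.Re a.
Proof. by case: a => u w /=; rewrite mul0r subr0. Qed.
Lemma rdotZl r x z : rdot (r%:C *: x) z = r * rdot x z.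
Proof. by rewrite /rdot dotZl Re_mulr. Qed.
Lemma rdotZr r x z : rdot z (r%:C *: x) = r * rdot z x.
Proof. by rewrite /rdot dotZrR Re_mulr. Qed.
Lemma rdot0l z : rdot 0 z = 0. Proof. by rewrite /rdot dot0l. Qed.
Lemma rdot0r z : rdot z 0 = 0. Proof. by rewrite /rdot dot0r. Qed.
Lemma rdotC x y : rdot x y = rdot y x.
Proof. by rewrite /rdot dotC; case: ('[y, x]). Qed.

Definition rdotE := (rdotDl, rdotDr, rdotBl, rdotBr, rdotNl, rdotNr, rdotZl,
  rdotZr, rdot0l, rdot0r).

Lemma dot_nm x : '[x, x] = (nm x ^+ 2)%:C.
Proof. by rewrite dotE nmE rmorphXn. Qed.

Lemma rdot_nm x : rdot x x = nm x ^+ 2.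
Proof. by rewrite /rdot dot_nm. Qed.

Lemma nm_sqrD x y : nm (x + y) ^+ 2 = nm x ^+ 2 + 2 * rdot x y + nm y ^+ 2.
Proof. by rewrite -!rdot_nm !rdotE (rdotC y x); ring. Qed.

Lemma nm_sqrB x y : nm (x - y) ^+ 2 = nm x ^+ 2 - 2 * rdot x y + nm y ^+ 2.
Proof. by rewrite -!rdot_nm !rdotE (rdotC y x); ring. Qed.

Lemma parallelogram x y :
  nm (x + y) ^+ 2 + nm (x - y) ^+ 2 = 2 * (nm x ^+ 2 + nm y ^+ 2).
Proof. by rewrite nm_sqrD nm_sqrB; ring. Qed.

Lemma rdot_le x y : rdot x y <= nm x * nm y.
Proof.
have [y0|y0] := eqVneq (nm y) 0.
  by rewrite y0 mulr0 (nm_eq0 y0) rdot0r.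
have yp : 0 < nm y by rewrite lt_neqAle eq_sym y0 nm_ge0.
have := nm_ge0 (x - (nm x / nm y)%:C *: y).
have := nm_sqrB x ((nm x / nm y)%:C *: y).
rewrite rdotZr nmZr ger0_norm ?divr_ge0 ?nm_ge0// divfK// => h _.
have [x0|x0] := eqVneq (nm x) 0.
  by rewrite x0 mul0r (nm_eq0 x0) rdot0l.
have xp : 0 < nm x by rewrite lt_neqAle eq_sym x0 nm_ge0.
have : 0 <= nm x ^+ 2 - 2 * (nm x / nm y * rdot x y) + nm x ^+ 2.
  by rewrite -h sqr_ge0.
have -> : nm x ^+ 2 - 2 * (nm x / nm y * rdot x y) + nm x ^+ 2 =
  (nm x / nm y * 2) * (nm x * nm y - rdot x y) by field.
by rewrite pmulr_rge0 ?subr_ge0// mulr_gt0 ?divr_gt0.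
Qed.

Lemma rdot_ge x y : - (nm x * nm y) <= rdot x y.
Proof. by rewrite lerNl -rdotNl -(nmN x) rdot_le. Qed.

(** The phase of the inner product reduces complex statements to real parts. *)
Lemma rdot_phase x y : rdot x ('[x, y] *: y) = cm '[x, y] ^+ 2.
Proof. by rewrite /rdot dotZr mulrC -normCK cmE -rmorphXn. Qed.

Lemma dot_eq0 x y : (forall a, rdot x (a *: y) = 0) -> '[x, y] = 0.
Proof.
move=> h; apply: cm_eq0; apply/eqP; rewrite -sqrf_eq0 -rdot_phase.
by apply/eqP; exact: h.
Qed.

Lemma cm_dot x y : cm '[x, y] <= nm x * nm y.
Proof.
have [->|a0] := eqVneq ('[x, y]) 0; first by rewrite /cm normr0/= mulr_ge0 ?nm_ge0.
have ap : 0 < cm '[x, y].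
  rewrite lt_neqAle cm_ge0 andbT eq_sym; apply: contra_neq a0 => /cm_eq0 //.
have := rdot_le x ('[x, y] *: y); rewrite nmZ rdot_phase.
by rewrite mulrCA expr2 ler_pM2l.
Qed.

Lemma dot_approx0 x y : (forall e, 0 < e -> exists2 x', nm (x - x') <= e & '[x', y] = 0) ->
  '[x, y] = 0.
Proof.
move=> h; apply: cm_small => e e0.
have yp : 0 < nm y + 1 by rewrite ltr_wpDl ?nm_ge0.
have [x' xx' x'y] := h (e / (nm y + 1)) (divr_gt0 e0 yp).
have -> : '[x, y] = '[x - x', y] by rewrite dotBl x'y subr0.
apply: le_trans (cm_dot _ _) _.
apply: le_trans (_ : e / (nm y + 1) * nm y <= _).
  by rewrite ler_wpM2r ?nm_ge0.
by rewrite -mulrA ler_piMr ?(ltW e0)// mulrC ler_pdivrMr// mul1r lerDl.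
Qed.

End inner_product.

(** * Completeness and topology in terms of real norms *)

Section real_topology.
Context {R : realType}.
Implicit Types V : normedModType R[i].

Lemma ltC_real (e : R[i]) : 0 < e -> exists2 r : R, 0 < r & e = r%:C.
Proof.
by case: e => a b; rewrite ltcE/= => /andP[/eqP b0 a0]; exists a => //; rewrite b0.
Qed.

Lemma nm_ltC V (x : V) (e : R) : (`|x| < e%:C) = (nm x < e).
Proof. by rewrite nmE ltcR. Qed.

Lemma nbhs_nmP V (x : V) (A : set V) :
  nbhs x A <-> exists2 e : R, 0 < e & forall y, nm (x - y) < e -> A y.
Proof.
split=> [/nbhs_ballP[e /ltC_real[r r0 ->] eA]|[e e0 eA]].
  by exists r => // y xy; apply: eA; rewrite -ball_normE /ball_/= nm_ltC.
apply/nbhs_ballP; exists e%:C; first by rewrite /= -[0]/(0%:C) ltcR.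
by move=> y; rewrite -ball_normE /ball_/= nm_ltC => /eA.
Qed.

Lemma cvg_nmP V (F : set_system V) (FF : Filter F) (x : V) :
  F --> x <-> forall e : R, 0 < e -> \forall y \near F, nm (x - y) < e.
Proof.
split=> [Fx e e0|h A /nbhs_nmP[e e0 eA]].
  by apply: Fx; apply/nbhs_nmP; exists e.
by apply: filterS (h e e0).
Qed.

Lemma closed_nm V (W : set V) (p : V) : closed W ->
  (forall e : R, 0 < e -> exists2 q, W q & nm (p - q) < e) -> W p.
Proof.
move=> cW h; apply: cW => A /nbhs_nmP[e e0 eA].
by have [q Wq pq] := h e e0; exists q; split=> //; exact: eA.
Qed.

Lemma nm_closed V (W : set V) :
  (forall p, (forall e : R, 0 < e -> exists2 q, W q & nm (p - q) < e) -> W p) ->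
  closed W.
Proof.
move=> h p cp; apply: h => e e0.
have [|q [Wq pq]] := cp [set q | nm (p - q) < e].
  by apply/nbhs_nmP; exists e.
by exists q.
Qed.

Lemma dense_nm V (W : set V) : dense W <->
  forall (x : V) (e : R), 0 < e -> exists2 w, W w & nm (x - w) < e.
Proof.
split=> [dW x e e0|h O [x Ox] oO].
  have [||w [Ow Ww]] := dW (interior [set w | nm (x - w) < e]).
  - exists x; rewrite /interior; apply/nbhs_nmP; exists e => //.
  - exact: open_interior.
  - by exists w => //; exact: interior_subset Ow.
have /nbhs_nmP[e e0 eO] : nbhs x O by exact: open_nbhs_nbhs.
by have [w Ww xw] := h x e e0; exists w; split=> //; exact: eO.
Qed.

Lemma cauchy_seq_lim (V : completeNormedModType R[i]) (u : nat -> V) :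
  (forall e : R, 0 < e -> exists N : nat, forall m n, (N <= m)%N -> (N <= n)%N ->
    nm (u m - u n) < e) ->
  exists l, forall e : R, 0 < e -> exists N : nat, forall n, (N <= n)%N ->
    nm (l - u n) < e.
Proof.
move=> uc.
have : cvg (u @ \oo).
  apply: cauchy_cvg; apply/cauchy_exP => e /ltC_real[r r0 ->].
  have [N hN] := uc r r0; exists (u N); exists N => // n /= Nn.
  by rewrite -ball_normE /ball_/= nm_ltC; exact: hN.
move=> /cvg_ex[l /(cvg_nmP _ _) ul]; exists l => e e0.
by have [N _ hN] := ul e e0; exists N => n Nn; exact: hN.
Qed.

Lemma inv_nat_lt (e : R) : 0 < e -> exists N : nat, forall n, (N <= n)%N ->
  (n.+1%:R)^-1 < e.
Proof.
move=> e0; exists (Num.bound e^-1) => n Nn.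
rewrite invf_plt ?posrE//.
apply: lt_le_trans (archi_boundP _) _; first by rewrite invr_ge0 ltW.
by rewrite ler_nat (leq_trans Nn).
Qed.

Lemma cauchy_seq_lim_le (V : completeNormedModType R[i]) (u : nat -> V)
    (d : nat -> R) :
  (forall e : R, 0 < e -> exists N, forall n, (N <= n)%N -> d n < e) ->
  (forall m n, (n <= m)%N -> nm (u m - u n) <= d n) ->
  exists l, forall n, nm (l - u n) <= d n.
Proof.
move=> d0 ud; have [|l ul] := @cauchy_seq_lim V u.
  move=> e e0; have [N hN] := d0 (e / 2) (divr_gt0 e0 (ltr0Sn _ _)).
  exists N => m n Nm Nn; apply: le_lt_trans (nm_tri (u N) _ _) _.
  rewrite [e]splitr ltrD//.
    by apply: le_lt_trans (ud _ _ Nm) (hN _ _).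
  by rewrite nm_sub; apply: le_lt_trans (ud _ _ Nn) (hN _ _).
exists l => n; apply/ler_addgt0Pr => e e0.
have [N hN] := ul e e0.
apply: le_trans (nm_tri (u (maxn N n)) _ _) _; rewrite addrC.
apply: lerD; first by apply: ud; exact: leq_maxr.
by apply/ltW/hN; exact: leq_maxl.
Qed.

End real_topology.

(** * Bounded operators in terms of real norms *)

Section operators.
Context {R : realType}.
Implicit Types H : hilbertType R.

Lemma nm_op H H' (T : bounded_op H H') x : nm (T x) <= nm T * nm x.
Proof. by rewrite -lecR rmorphM/= -!nmE le_opnorm. Qed.

Lemma nm_op_le H H' (T : bounded_op H H') (M : R) : 0 <= M ->
  (forall x, nm (T x) <= M * nm x) -> nm T <= M.
Proof.
move=> M0 h; rewrite -lecR -nmE; apply: opnorm_le => x; rewrite nmE -[1]/(1%:C) lecR.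
rewrite nmE lecR => x1; apply: le_trans (h x) _.
by rewrite -[leRHS]mulr1 ler_wpM2l.
Qed.

Lemma opDE H H' (S T : bounded_op H H') x : (S + T) x = S x + T x.
Proof. by []. Qed.
Lemma opBE H H' (S T : bounded_op H H') x : (S - T) x = S x - T x.
Proof. by []. Qed.
Lemma op0E H H' x : (0 : bounded_op H H') x = 0.
Proof. by []. Qed.
Lemma bopN H H' (T : bounded_op H H') x : T (- x) = - T x.
Proof. by rewrite -scaleN1r bopZ scaleN1r. Qed.

Lemma nm_op1 H H' (T : bounded_op H H') (M : R) x : nm T <= M ->
  nm (T x) <= M * nm x.
Proof. by move=> TM; apply: le_trans (nm_op _ _) _; rewrite ler_wpM2r ?nm_ge0. Qed.

Lemma op_exists H H' (f : H -> H') (M : R) : linear f ->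
  (forall x, nm (f x) <= M * nm x) -> exists T : bounded_op H H', T =1 f.
Proof.
move=> lf fM; suff fb : f \in bounded_linear by exists (BoundedOp fb).
apply/bounded_linearP; split=> //; exists M%:C => x.
by rewrite !nmE -rmorphM lecR.
Qed.

Lemma id_bounded H : (@idfun H) \in bounded_linear.
Proof.
apply/bounded_linearP; split=> //; exists 1 => x; by rewrite mul1r.
Qed.
Definition op1 H : bounded_op H H := BoundedOp (id_bounded H).

Lemma op1E H (x : H) : op1 H x = x. Proof. by []. Qed.

Lemma nm_comp H1 H2 H3 (S : bounded_op H2 H3) (T : bounded_op H1 H2) :
  nm (bop_comp S T) <= nm S * nm T.
Proof.
apply: nm_op_le; first by rewrite mulr_ge0 ?nm_ge0.
move=> x; apply: le_trans (nm_op S _) _; rewrite -mulrA ler_wpM2l ?nm_ge0//.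
exact: nm_op.
Qed.

(** The pointwise limits are attained uniformly on the unit ball because the errors
   [d n] do not depend on the vector. *)
Lemma op_seq_lim H H' (Y : nat -> bounded_op H H') (d : nat -> R) :
  (forall e : R, 0 < e -> exists N, forall n, (N <= n)%N -> d n < e) ->
  (forall m n, (n <= m)%N -> nm (Y m - Y n) <= d n) ->
  exists T, forall n, nm (T - Y n) <= d n.
Proof.
move=> d0 Yd.
have d_ge0 n : 0 <= d n by apply: le_trans (nm_ge0 _) (Yd n n (leqnn _)).
have /choice[f hf] : forall x, exists l, forall n, nm (l - Y n x) <= d n * nm x.
  move=> x; apply: cauchy_seq_lim_le => [e e0|m n nm_].
    have xp : 0 < nm x + 1 by rewrite ltr_wpDl ?nm_ge0.
    have [N hN] := d0 (e / (nm x + 1)) (divr_gt0 e0 xp).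
    exists N => n /hN; rewrite ltr_pdivlMr//; apply: le_lt_trans.
    by rewrite ler_wpM2l// lerDl.
  by rewrite -opBE; apply: nm_op1; exact: Yd.
have lf : linear f.
  move=> a x y; apply/eqP; rewrite -subr_eq0; apply/eqP/nm_le0.
  apply/ler_addgt0Pr => e e0; rewrite add0r.
  set M := nm (a *: x + y) + cm a * nm x + nm y.
  have M0 : 0 <= M by rewrite !addr_ge0 ?mulr_ge0 ?nm_ge0 ?cm_ge0.
  have Mp : 0 < M + 1 by rewrite ltr_wpDl.
  have [N /(_ N (leqnn N)) hN] := d0 (e / (M + 1)) (divr_gt0 e0 Mp).
  apply: le_trans (_ : d N * M <= _); last first.
    move: hN; rewrite ltr_pdivlMr// => /ltW; apply: le_trans.
    by rewrite ler_wpM2l// lerDl.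
  have -> : f (a *: x + y) - (a *: f x + f y) =
     (f (a *: x + y) - Y N (a *: x + y)) - a *: (f x - Y N x) - (f y - Y N y).
    by rewrite bop_linear; apply: dot_inj => z; rewrite !dot_expand; ring.
  apply: le_trans (nmB _ _) _; rewrite /M !mulrDr lerD//.
  apply: le_trans (nmB _ _) _; rewrite lerD// nmZ mulrCA.
  by rewrite ler_wpM2l ?cm_ge0.
have [|T Tf] := @op_exists _ _ f (d 0 + nm (Y 0)) lf.
  move=> x; apply: le_trans (nm_ge _ (Y 0 x)) _; rewrite addrC mulrDl.
  by rewrite lerD ?nm_op.
exists T => n; apply: nm_op_le => // x; rewrite opBE Tf; exact: hf.
Qed.

Lemma op_continuous_eq0 H H' (T : bounded_op H H') x :
  (forall e : R, 0 < e -> exists2 x', nm (x - x') < e & T x' = 0) -> T x = 0.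
Proof.
move=> h; apply: nm_small => e e0.
have Tp : 0 < nm T + 1 by rewrite ltr_wpDl ?nm_ge0.
have [x' xx' Tx'] := h (e / (nm T + 1)) (divr_gt0 e0 Tp).
have -> : T x = T (x - x') by rewrite bopB Tx' subr0.
move: xx'; rewrite ltr_pdivlMr// => /ltW; apply: le_trans.
by apply: le_trans (nm_op _ _) _; rewrite mulrC ler_wpM2l ?nm_ge0 ?lerDl.
Qed.

End operators.

(** * Orthogonal projections *)

Definition subspace_set (K : pzRingType) (V : lmodType K) (W : set V) :=
  W 0 /\ forall (a : K) x y, W x -> W y -> W (a *: x + y).

Section projections.
Context {R : realType}.
Implicit Types H : hilbertType R.

Lemma subspaceD (K : pzRingType) (V : lmodType K) (W : set V) x y :
  subspace_set W -> W x -> W y -> W (x + y).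
Proof. by move=> [_ h] Wx Wy; rewrite -[x]scale1r; exact: h. Qed.

Lemma subspaceZ (K : pzRingType) (V : lmodType K) (W : set V) a x :
  subspace_set W -> W x -> W (a *: x).
Proof. by move=> [W0 h] Wx; rewrite -[_ *: _]addr0; exact: h. Qed.

Lemma subspaceB (K : pzRingType) (V : lmodType K) (W : set V) x y :
  subspace_set W -> W x -> W y -> W (x - y).
Proof. by move=> sW Wx Wy; rewrite -scaleN1r; apply: subspaceD => //; exact: subspaceZ. Qed.

Lemma sqr_le (a b : R) : 0 <= b -> a ^+ 2 <= b ^+ 2 -> a <= b.
Proof.
move=> b0 h; apply: le_trans (ler_norm a) _.
by rewrite -(@ler_pXn2r _ 2%N) ?nnegrE// real_normK ?num_real.
Qed.

(** For small $t$ of the sign opposite to $p$ the linear term would dominate, and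
   $t = -p/(q+1)$ is small enough. *)
Lemma linear_coef_eq0 (p q : R) : 0 <= q -> (forall t : R, 0 <= 2 * t * p + t ^+ 2 * q) -> p = 0.
Proof.
move=> q0 h.
have q1 : 0 < q + 1 by rewrite ltr_wpDl.
have := h (- p / (q + 1)).
have -> : 2 * (- p / (q + 1)) * p + (- p / (q + 1)) ^+ 2 * q =
   - (p ^+ 2 * ((q + 2) / (q + 1) ^+ 2)) by field; rewrite gt_eqF.
rewrite oppr_ge0 pmulr_lle0; last first.
  by rewrite divr_gt0// ?exprn_gt0// ltr_wpDl.
by move=> p2; apply/eqP; rewrite -sqrf_eq0 eq_le p2 sqr_ge0.
Qed.

Lemma subspaceT (K : pzRingType) (V : lmodType K) : subspace_set [set: V].
Proof. by []. Qed.

Lemma subspace_image H H' (T : bounded_op H H') (W : set H) :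
  subspace_set W -> subspace_set (T @` W).
Proof.
move=> sW; split; first by exists 0; [exact: sW.1|rewrite bop0].
by move=> a _ _ [x Wx <-] [y Wy <-]; exists (a *: x + y); [exact: sW.2|rewrite bop_linear].
Qed.

(** A lower bound turns convergence of the values into convergence of the
   arguments. *)
Lemma closed_image H H' (T : bounded_op H H') (W : set H) (c : R) :
  subspace_set W -> closed W -> 0 <= c -> (forall x, W x -> nm x <= c * nm (T x)) ->
  closed (T @` W).
Proof.
move=> sW cW c0 hc; apply: nm_closed => y hy.
have /choice[x hx] : forall n : nat, exists x, W x /\ nm (y - T x) < (n.+1%:R)^-1.
  move=> n; have [|_ [x Wx <-] yx] := hy (n.+1%:R)^-1; first by rewrite invr_gt0.
  by exists x.
have c1 : 0 < c + 1 by rewrite ltr_wpDl.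
have [|l hl] := @cauchy_seq_lim _ _ x.
  move=> e e0; have [N hN] := inv_nat_lt (divr_gt0 (divr_gt0 e0 c1) (ltr0Sn R 1)).
  exists N => m n Nm Nn; have [Wm ym] := hx m; have [Wn yn] := hx n.
  apply: le_lt_trans (hc _ (subspaceB sW Wm Wn)) _; rewrite bopB.
  apply: (@le_lt_trans _ _ ((c + 1) * nm (T (x m) - T (x n)))).
    by rewrite ler_wpM2r ?nm_ge0// lerDl.
  rewrite mulrC -ltr_pdivlMr//; apply: le_lt_trans (nm_tri y _ _) _.
  rewrite [e / _]splitr ltrD//; last exact: lt_trans yn (hN n Nn).
  by rewrite nm_sub; exact: lt_trans ym (hN m Nm).
exists l.
  apply: closed_nm cW _ => e e0; have [N hN] := hl e e0.
  by exists (x N); [exact: (hx N).1|exact: hN].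
apply/esym/nm_close => e e0; have e20 : 0 < e / 2 by rewrite divr_gt0.
have T1 : 0 < nm T + 1 by rewrite ltr_wpDl ?nm_ge0.
have [N hN] := inv_nat_lt e20; have [M hM] := hl _ (divr_gt0 e20 T1).
apply: le_trans (nm_tri (T (x (maxn N M))) _ _) _; rewrite [e]splitr; apply: lerD.
  exact/ltW/(lt_trans (hx _).2)/hN/leq_maxl.
have := hM _ (leq_maxr N M); rewrite -bopB nm_sub ltr_pdivlMr// => /ltW; apply: le_trans.
by apply: le_trans (nm_op _ _) _; rewrite mulrC ler_wpM2l ?nm_ge0// lerDl.
Qed.

(** A minimizing sequence is Cauchy by the parallelogram identity, and its limit
   satisfies the first order condition.  [W] need not be closed: the projection
   lies in the closure. *)
Lemma projection H (W : set H) (x : H) : subspace_set W ->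
  exists p, (forall e : R, 0 < e -> exists2 w, W w & nm (p - w) < e) /\
    forall w, W w -> '[x - p, w] = 0.
Proof.
move=> sW; have [W0 _] := sW.
pose D := [set nm (x - w) | w in W].
have D_lb : has_inf D.
  by split; [exists (nm (x - 0)), 0 | exists 0 => _ [w _ <-]; exact: nm_ge0].
pose d := inf D.
have d_le w : W w -> d <= nm (x - w) by move=> Ww; apply: ge_inf; [case: D_lb|exists w].
have d0 : 0 <= d by apply: lb_le_inf; [case: D_lb|move=> _ [w _ <-]; exact: nm_ge0].
have /choice[u hu] : forall n : nat, exists w, W w /\ nm (x - w) ^+ 2 <= d ^+ 2 + (n.+1%:R)^-1.
  move=> n; have n0 : 0 < (n.+1%:R : R)^-1 by rewrite invr_gt0.
  have ds : 0 <= d ^+ 2 + (n.+1%:R)^-1 by rewrite addr_ge0 ?sqr_ge0 ?ltW.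
  have : d < Num.sqrt (d ^+ 2 + (n.+1%:R)^-1).
    by rewrite -[d in ltLHS]ger0_norm// -sqrtr_sqr ltr_sqrt ?ltrDl// ltr_wpDl ?sqr_ge0.
  move=> /(inf_lt D_lb.1)[_ [w Ww <-] /ltW h]; exists w; split=> //.
  by rewrite -[leRHS]sqr_sqrtr// ler_pXn2r// nnegrE ?nm_ge0 ?sqrtr_ge0.
clearbody d.
have half w w' : W w -> W w' -> d ^+ 2 * 4 <= nm ((x - w) + (x - w')) ^+ 2.
  move=> Ww Ww'; have -> : (x - w) + (x - w') = (2 : R)%:C *: (x - (2^-1 : R)%:C *: (w + w')).
    rewrite scalerBr scalerA -rmorphM/= divff ?pnatr_eq0// scale1r.
    by rewrite rmorphD/= rmorph1 scalerDl !scale1r opprD addrACA.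
  rewrite nmZr ger0_norm// exprMn mulrC; have -> : (2 : R) ^+ 2 = 4 by ring.
  rewrite ler_pM2l// ler_pXn2r ?nnegrE ?nm_ge0//; apply: d_le.
  by apply: subspaceZ => //; exact: subspaceD.
have uB m n : nm (u m - u n) ^+ 2 <= 2 * ((m.+1%:R)^-1 + (n.+1%:R)^-1).
  have [Wm hm] := hu m; have [Wn hn] := hu n.
  have := parallelogram (x - u m) (x - u n).
  have -> : (x - u m) - (x - u n) = u n - u m.
    by rewrite opprB addrC addrA subrK addrC.
  rewrite (nm_sub (u n)); have := half _ _ Wm Wn; move: hm hn.
  move: (nm (x - u m) ^+ 2) (nm (x - u n) ^+ 2) (nm (x - u m + _) ^+ 2) (d ^+ 2).
  move: (nm _ ^+ 2) (m.+1%:R^-1) (n.+1%:R^-1) => *; lra.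
have [|p hp] := @cauchy_seq_lim _ _ u.
  move=> e e0; have [N hN] := @inv_nat_lt R (e ^+ 2 / 4) (divr_gt0 (exprn_gt0 2 e0) (ltr0Sn _ _)).
  exists N => m n Nm Nn; rewrite -(@ltr_pXn2r _ 2%N) ?nnegrE ?nm_ge0 ?ltW//.
  have := uB m n; have := hN m Nm; have := hN n Nn.
  by move: (m.+1%:R^-1) (n.+1%:R^-1) (e ^+ 2) (nm _ ^+ 2) => *; lra.
exists p; split=> [e e0|w Ww].
  have [N hN] := hp e e0; exists (u N); first by have [] := hu N.
  exact: hN.
have d_p w' : W w' -> d <= nm (x - p - w').
  move=> Ww'; apply/ler_addgt0Pr => e e0; have [N hN] := hp e e0.
  have [WN _] := hu N.
  apply: le_trans (d_le (u N + w') _) _; first exact: subspaceD.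
  apply: le_trans (nm_ge _ (x - p - w')) _; rewrite lerD2l.
  have -> : x - (u N + w') - (x - p - w') = p - u N.
    by apply: dot_inj => z; rewrite !dot_expand; ring.
  exact/ltW/hN.
have p_d : nm (x - p) <= d.
  apply/ler_addgt0Pr => e e0.
  have e20 : 0 < e / 2 by rewrite divr_gt0.
  have [N hN] := hp _ e20; have [M hM] := @inv_nat_lt R ((e / 2) ^+ 2) (exprn_gt0 2 e20).
  have [_ uM] := hu (maxn M N).
  have xu : nm (x - u (maxn M N)) <= d + e / 2.
    apply: sqr_le; first by rewrite addr_ge0// ltW.
    apply: le_trans uM _; have := hM _ (leq_maxl M N); have := mulr_ge0 d0 (ltW e20).
    by rewrite sqrrD; move: ((maxn M N).+1%:R^-1) ((e / 2) ^+ 2) => *; lra.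
  have := hN _ (leq_maxr M N); rewrite nm_sub; have := nm_tri (u (maxn M N)) x p; lra.
have r0 v : W v -> rdot (x - p) v = 0.
  move=> Wv; apply: (@linear_coef_eq0 _ (nm v ^+ 2)); first exact: sqr_ge0.
  move=> t; have := d_p ((- t)%:C *: v) (subspaceZ _ sW Wv).
  rewrite -(@ler_pXn2r _ 2%N) ?nnegrE ?nm_ge0// nm_sqrB rdotZr nmZr exprMn.
  rewrite real_normK ?num_real// sqrrN.
  have : nm (x - p) ^+ 2 <= d ^+ 2 by rewrite ler_pXn2r ?nnegrE ?nm_ge0.
  by move: (rdot _ _) (nm v ^+ 2) => a b; lra.
by apply: dot_eq0 => a; apply: r0; exact: subspaceZ.
Qed.

Lemma ortho_dense H (W : set H) : subspace_set W ->
  (forall x, (forall w, W w -> '[x, w] = 0) -> x = 0) -> dense W.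
Proof.
move=> sW h; apply/dense_nm => x e e0.
have [p [pW xp]] := projection x sW.
have [w Ww pw] := pW e e0; exists w => //.
by move: (h _ xp) => /subr0_eq ->.
Qed.

Lemma dense_ortho H (W : set H) x : dense W ->
  (forall w, W w -> '[x, w] = 0) -> x = 0.
Proof.
move=> /dense_nm dW h; apply: dot_inj => z; rewrite dot0l dotC.
rewrite (@dot_approx0 _ _ z x) ?rmorph0// => e e0.
by have [w Ww zw] := dW z e e0; exists w; [exact: ltW|rewrite dotC h// rmorph0].
Qed.

Lemma projection_closed H (W : set H) (x : H) : subspace_set W -> closed W ->
  exists2 p, W p & forall w, W w -> '[x - p, w] = 0.
Proof.
move=> sW cW; have [p [pW xp]] := projection x sW; exists p => //.
exact: closed_nm cW pW.
Qed.

Lemma projection_unique H (W : set H) (x p q : H) : subspace_set W ->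
  W p -> W q -> (forall w, W w -> '[x - p, w] = 0) ->
  (forall w, W w -> '[x - q, w] = 0) -> p = q.
Proof.
move=> sW Wp Wq hp hq; apply/eqP; rewrite -subr_eq0; apply/eqP/nm_eq0/eqP.
rewrite -sqrf_eq0 -rdot_nm; apply/eqP; rewrite /rdot.
have pq : p - q = (x - q) - (x - p) by apply: dot_inj => z; rewrite !dot_expand; ring.
rewrite {1}pq dotBl.
by rewrite hp ?hq ?subrr//; exact: subspaceB.
Qed.

Lemma ortho_nm H (x p : H) : '[x - p, p] = 0 ->
  nm x ^+ 2 = nm p ^+ 2 + nm (x - p) ^+ 2.
Proof.
move=> xp; have : rdot (x - p) p = 0 by rewrite /rdot xp.
by rewrite rdotBl rdot_nm nm_sqrB => h; lra.
Qed.

Lemma orthoprojP H (W : set H) : subspace_set W -> closed W ->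
  forall x, W (orthoproj W x) /\ forall w, W w -> '[x - orthoproj W x, w] = 0.
Proof.
move=> sW cW.
have /choice[f hf] : forall x, exists p, W p /\ forall w, W w -> '[x - p, w] = 0.
  by move=> x; have [p] := projection_closed x sW cW; exists p.
have lf : linear f.
  move=> a x y; apply: (projection_unique (x := a *: x + y) sW).
  - by have [] := hf (a *: x + y).
  - by apply: sW.2; [have [] := hf x|have [] := hf y].
  - by have [] := hf (a *: x + y).
  move=> w Ww; have -> : a *: x + y - (a *: f x + f y) = a *: (x - f x) + (y - f y).
    by apply: dot_inj => z; rewrite !dot_expand; ring.
  by rewrite dotDl dotZl (hf x).2// (hf y).2// mulr0 addr0.
have [|P Pf] := @op_exists _ _ _ f 1 lf.
  move=> x; rewrite mul1r; apply: sqr_le; first exact: nm_ge0.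
  by rewrite (ortho_nm ((hf x).2 _ (hf x).1)) lerDl sqr_ge0.
have := getPex (ex_intro [set P : bounded_op H H |
    forall x, W (P x) /\ forall w, W w -> '[x - P x, w] = 0] P _).
by apply => x; rewrite Pf; exact: hf.
Qed.

Section orthoproj_theory.
Context {H : hilbertType R} (W : set H) (sW : subspace_set W) (cW : closed W).
Local Notation P := (orthoproj W).

Lemma orthoproj_in x : W (P x).
Proof. exact: (orthoprojP sW cW x).1. Qed.

Lemma orthoproj_dot x w : W w -> '[x - P x, w] = 0.
Proof. exact: (orthoprojP sW cW x).2. Qed.

Lemma orthoproj_eq x p : W p -> (forall w, W w -> '[x - p, w] = 0) -> P x = p.
Proof.
move=> Wp hp; apply: (projection_unique (x := x) sW) => // [|w Ww].
  exact: orthoproj_in.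
exact: orthoproj_dot.
Qed.

Lemma orthoproj_id x : W x -> P x = x.
Proof. by move=> Wx; apply: orthoproj_eq => // w _; rewrite subrr dot0l. Qed.

Lemma orthoproj_nm x : nm x ^+ 2 = nm (P x) ^+ 2 + nm (x - P x) ^+ 2.
Proof. by apply: ortho_nm; apply: orthoproj_dot; exact: orthoproj_in. Qed.

Lemma orthoproj_le x : nm (P x) <= nm x.
Proof. by apply: sqr_le; rewrite ?nm_ge0// (orthoproj_nm x) lerDl sqr_ge0. Qed.

Lemma orthoproj_le_dist x w : W w -> nm (x - P x) <= nm (x - w).
Proof.
move=> Ww; apply: sqr_le; first exact: nm_ge0.
have : rdot (x - P x) (P x - w) = 0.
  by rewrite /rdot orthoproj_dot//; apply: subspaceB => //; exact: orthoproj_in.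
have -> : x - w = (x - P x) + (P x - w) by rewrite addrA subrK.
by rewrite (nm_sqrD (x - P x)) => ->; rewrite mulr0 addr0 lerDl sqr_ge0.
Qed.

Lemma orthoproj_sym x y : '[P x, y] = '[x, P y].
Proof.
have h1 := orthoproj_dot y (orthoproj_in x).
have h2 := orthoproj_dot x (orthoproj_in y).
move: h1 h2; rewrite !dotBl => /subr0_eq h1 /subr0_eq ->.
by rewrite dotC h1 -dotC.
Qed.

Lemma orthoproj_nm_dot x : nm (P x) ^+ 2 = rdot (P x) x.
Proof.
rewrite -rdot_nm /rdot; congr complex.Re.
by rewrite -orthoproj_sym orthoproj_id//; exact: orthoproj_in.
Qed.

End orthoproj_theory.

(** The norm distance of two projections is controlled by the gap of their
   ranges, because $P - P' = (1 - P')P - ((1 - P)P')^*$. *)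
Lemma gap H (W W' : set H) (d : R) : subspace_set W -> closed W ->
  subspace_set W' -> closed W' -> 0 <= d ->
  (forall w, W w -> exists2 w', W' w' & nm (w - w') <= d * nm w) ->
  (forall w, W' w -> exists2 w', W w' & nm (w - w') <= d * nm w) ->
  nm (orthoproj W - orthoproj W') <= 2 * d.
Proof.
move=> sW cW sW' cW' d0 WW' W'W.
set P := orthoproj W; set P' := orthoproj W'.
apply: nm_op_le => [|x]; first by rewrite mulr_ge0.
have h1 : nm (P x - P' (P x)) <= d * nm x.
  have [w' Ww' h] := WW' _ (orthoproj_in sW cW x).
  apply: le_trans (orthoproj_le_dist sW' cW' _ Ww') (le_trans h _).
  by rewrite ler_wpM2l// orthoproj_le.
have h2 : nm (P' (x - P x)) <= d * nm x.
  set q := P' (x - P x).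
  have Wq : W' q by exact: orthoproj_in.
  have qP : nm (q - P q) <= d * nm q.
    by have [w' Ww' h] := W'W _ Wq; apply: le_trans (orthoproj_le_dist sW cW _ Ww') h.
  have E : nm q ^+ 2 = rdot (q - P q) x.
    rewrite orthoproj_nm_dot// -/P' -/q /rdot; congr complex.Re.
    by rewrite dotBr dotBl -orthoproj_sym.
  have [->|q0] := eqVneq (nm q) 0; first by rewrite mulr_ge0 ?nm_ge0.
  have qp : 0 < nm q by rewrite lt_neqAle eq_sym q0 nm_ge0.
  rewrite -(ler_pM2l qp) -expr2 E; apply: le_trans (rdot_le _ _) _.
  by rewrite mulrCA mulrA ler_wpM2r ?nm_ge0.
have -> : (P - P') x = (P x - P' (P x)) - P' (x - P x).
  by rewrite opBE bopB; apply: dot_inj => z; rewrite !dot_expand; ring.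
by apply: le_trans (nmB _ _) _; lra.
Qed.

End projections.

(** * Total boundedness and compactness *)

Definition tbounded (R : realType) (V : normedModType R[i]) (S : set V) :=
  forall e : R, 0 < e -> exists s : seq V, forall x, S x ->
    exists2 y, y \in s & nm (x - y) < e.

Section total_boundedness.
Context {R : realType}.
Implicit Types V : normedModType R[i].

Lemma tb_sub V (S S' : set V) : S `<=` S' -> tbounded S' -> tbounded S.
Proof. by move=> SS' h e e0; have [s hs] := h e e0; exists s => x /SS' /hs. Qed.

(** A center that is close to some point of [S] is replaced by such a point, at the
   price of doubling the radius. *)
Lemma tb_net V (X : eqType) (S : set X) (f : X -> V) (e : R) : 0 < e ->
  tbounded (f @` S) -> exists2 s : seq X, (forall y, y \in s -> S y) &
    forall x, S x -> exists2 y, y \in s & nm (f x - f y) < e.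
Proof.
move=> e0 h; have e20 : 0 < e / 2 by rewrite divr_gt0.
have [s hs] := h _ e20.
suff [s' s'S hs'] : exists2 s' : seq X, (forall y, y \in s' -> S y) &
    forall x c, S x -> c \in s -> nm (f x - c) < e / 2 ->
      exists2 y, y \in s' & nm (f y - c) < e / 2.
  exists s' => // x Sx; have [|c cs xc] := hs (f x); first by exists x.
  have [y ys' yc] := hs' x c Sx cs xc; exists y => //.
  apply: le_lt_trans (nm_tri c _ _) _; rewrite [e]splitr ltrD//.
  by rewrite nm_sub.
elim: {hs} s => [|c s [s' s'S hs']]; first by exists [::].
have [[y [Sy yc]]|n] := pselect (exists y, S y /\ nm (f y - c) < e / 2).
  exists (y :: s') => [z|x c' Sx].
    by rewrite inE => /orP[/eqP->//|/s'S].
  rewrite inE => /orP[/eqP->|cs] xc.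
    by exists y => //; exact: mem_head.
  by have [z zs zc] := hs' x c' Sx cs xc; exists z => //; rewrite inE zs orbT.
exists s' => // x c' Sx; rewrite inE => /orP[/eqP->|cs] xc; last exact: hs' xc.
by exfalso; apply: n; exists x.
Qed.

Lemma tb_of_net V (X : eqType) (S : set X) (f : X -> V) :
  (forall e : R, 0 < e -> exists s : seq X, 
    forall x, S x -> exists2 y, y \in s & nm (f x - f y) < e) ->
  tbounded (f @` S).
Proof.
move=> h e e0; have [s hs] := h e e0; exists [seq f x | x <- s] => _ [x Sx <-].
by have [y ys xy] := hs x Sx; exists (f y) => //; exact: map_f.
Qed.

Lemma tb_uniform V V' (X : eqType) (S : set X) (f : X -> V) (g : X -> V') :
  (forall e : R, 0 < e -> exists2 d : R, 0 < d & forall x y, S x -> S y ->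
    nm (f x - f y) < d -> nm (g x - g y) < e) ->
  tbounded (f @` S) -> tbounded (g @` S).
Proof.
move=> fg h; apply: tb_of_net => e e0; have [d d0 hd] := fg e e0.
have [s sS hs] := tb_net d0 h; exists s => x Sx.
by have [y ys xy] := hs x Sx; exists y => //; apply: hd => //; exact: sS.
Qed.

(** The square on the left admits a Hoelder exponent $1/2$, as for the off-diagonal
   blocks of a projection in terms of the diagonal ones. *)
Lemma tb_control V V' (X : eqType) (S : set X) (f : X -> V) (g : X -> V') (M : R) :
  0 < M -> (forall x y, S x -> S y -> nm (g x - g y) ^+ 2 <= M * nm (f x - f y)) ->
  tbounded (f @` S) -> tbounded (g @` S).
Proof.
move=> M0 fg; apply: tb_uniform => e e0; exists (e ^+ 2 / M).
  by rewrite divr_gt0// exprn_gt0.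
move=> x y Sx Sy; rewrite ltr_pdivlMr// mulrC => /(le_lt_trans (fg _ _ Sx Sy)).
by rewrite ltr_pXn2r// nnegrE ?nm_ge0 ?(ltW e0).
Qed.

Lemma tb_lip V V' (X : eqType) (S : set X) (f : X -> V) (g : X -> V') (M : R) :
  (forall x y, S x -> S y -> nm (g x - g y) <= M * nm (f x - f y)) ->
  tbounded (f @` S) -> tbounded (g @` S).
Proof.
move=> fg; apply: tb_uniform => e e0; have M1 : 0 < `|M| + 1 by rewrite ltr_wpDl.
exists (e / (`|M| + 1)) => [|x y Sx Sy]; first exact: divr_gt0.
rewrite ltr_pdivlMr// mulrC; apply: le_lt_trans; apply: le_trans (fg _ _ Sx Sy) _.
by rewrite ler_wpM2r ?nm_ge0//; apply: le_trans (ler_norm _) _; rewrite lerDl.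
Qed.

Lemma tb_minkowski V (S1 S2 : set V) : tbounded S1 -> tbounded S2 ->
  tbounded [set x | exists a b, [/\ S1 a, S2 b & x = a + b]].
Proof.
move=> hf hg e e0; have e20 : 0 < e / 2 by rewrite divr_gt0.
have [s hs] := hf _ e20; have [t ht] := hg _ e20.
exists [seq x + y | x <- s, y <- t] => _ [x [y [Sx Sy ->]]].
have [a ha xa] := hs _ Sx; have [b hb xb] := ht _ Sy.
exists (a + b); first exact: allpairs_f.
have -> : x + y - (a + b) = (x - a) + (y - b) by rewrite opprD addrACA.
by apply: le_lt_trans (nmD _ _) _; rewrite [e]splitr ltrD.
Qed.

Lemma tb_approx V (S : set V) :
  (forall e : R, 0 < e -> exists2 S' : set V, tbounded S' &
     forall x, S x -> exists2 y, S' y & nm (x - y) < e) ->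
  tbounded S.
Proof.
move=> h e e0; have e20 : 0 < e / 2 by rewrite divr_gt0.
have [S' tS' SS'] := h _ e20; have [s hs] := tS' _ e20.
exists s => x Sx; have [y Sy xy] := SS' x Sx; have [z zs yz] := hs y Sy.
exists z => //; apply: le_lt_trans (nm_tri y _ _) _.
by rewrite [e]splitr ltrD.
Qed.

Lemma precompact_tb V (S : set V) : precompact S -> tbounded S.
Proof.
move=> [B SB [+ _]] e e0; rewrite compact_cover.
move=> /(_ V B (fun x => interior [set y | nm (x - y) < e])).
case=> [x _|x Bx|D _ BD].
- exact: open_interior.
- exists x => //; rewrite /interior; apply/nbhs_nmP; exists e => //.
- exists (enum_fset D) => x /SB /BD[y yD /interior_subset /= yx].
  by exists y => //; rewrite nm_sub.
Qed.

Lemma ultra_seq (T : Type) (X : eqType) (F : set_system T) (UF : UltraFilter F)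
    (s : seq X) (B : X -> set T) :
  F [set t | exists2 y, y \in s & B y t] -> exists2 y, y \in s & F (B y).
Proof.
elim: s => [|c s IH] h.
  exfalso; apply: (@filter_not_empty _ F _); apply: filterS h => t [y].
  by rewrite in_nil.
have [FB|FB] := in_ultra_setVsetC (B c) UF; first by exists c => //; exact: mem_head.
case: IH => [|y ys FBy]; last by exists y => //; rewrite inE ys orbT.
apply: filterS (filterI h FB) => t [[y + By] nB].
rewrite inE => /orP[/eqP yc|ys]; last by exists y.
by exfalso; apply: nB; rewrite -yc.
Qed.

(** An ultrafilter on a totally bounded set is Cauchy, since it contains one ball of
   each finite covering. *)
Lemma tb_precompact (V : completeNormedModType R[i]) (S : set V) :
  tbounded S -> precompact S.
Proof.
move=> tS; rewrite precompactE compact_ultra => F UF FS.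
have Fc : cvg F.
  apply: cauchy_cvg; apply/cauchy_exP => e /ltC_real[r r0 ->].
  have r20 : 0 < r / 2 by rewrite divr_gt0.
  have [s hs] := tS _ r20.
  have [|y ys Fy] := @ultra_seq _ _ F UF s (fun y => [set x | nm (y - x) < r]).
    apply: filterS FS => x cx.
    have [|z [Sz /= xz]] := cx [set z | nm (x - z) < r / 2].
      by apply/nbhs_nmP; exists (r / 2).
    have [y ys zy] := hs z Sz; exists y => //=; rewrite nm_sub.
    by apply: le_lt_trans (nm_tri z _ _) _; rewrite [r]splitr ltrD.
  exists y; apply: filterS Fy => x /=.
  by rewrite -ball_normE /ball_/= nm_ltC.
exists (lim F); split; last exact: Fc.
suff cc : closure (closure S) (lim F) by exact: (closed_closure cc).
move=> B /Fc FB.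
exact: (@filter_ex _ F _ _ (filterI FS FB)).
Qed.

Lemma tb_cluster (V : completeNormedModType R[i]) (S : set V) (u : nat -> V) :
  tbounded S -> (forall n, S (u n)) ->
  exists x, forall (e : R) (N : nat), 0 < e ->
    exists2 n, (N <= n)%N & nm (x - u n) < e.
Proof.
move=> /tb_precompact[B SB [cB _]] Su.
have [|x [_ cx]] := cB (u @ \oo) _.
  by exists 0%N => // n _; exact: (SB _ (Su n)).
exists x => e N e0.
have [||y [/= [n Nn uny] xy]] := cx [set u n | n in [set n | (N <= n)%N]] [set y | nm (x - y) < e].
- by exists N => // n Nn /=; exists n.
- by apply/nbhs_nmP; exists e.
- by exists n => //; rewrite uny.
Qed.

Lemma compact_opP (H H' : hilbertType R) (T : bounded_op H H') :
  compact_op T <-> tbounded (T @` [set x | nm x <= 1]).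
Proof.
have E : [set x : H | `|x| <= 1] = [set x | nm x <= 1].
  by apply/funext => x /=; rewrite nmE -[1]/(1%:C) lecR.
rewrite /compact_op E; split; first exact: precompact_tb.
exact: tb_precompact.
Qed.

(** A disc lies in the sum of a real and an imaginary segment. *)
Lemma tb_disc V (v : V) : tbounded [set a *: v | a in [set a : R[i] | cm a <= 1]].
Proof.
have seg (w : V) : tbounded [set (r%:C : R[i]) *: w | r in `[(-1 : R), 1]].
  apply: tb_of_net => e e0.
  have w1 : 0 < nm w + 1 by rewrite ltr_wpDl ?nm_ge0.
  have : compact `[(-1 : R), 1] by exact: segment_compact.
  rewrite compact_cover.
  move=> /(_ _ [set` `[(-1 : R), 1]] (fun x => ball x (e / (nm w + 1)))).
  case=> [x _|x Bx|D _ BD].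
  - exact: ball_open.
  - exists x => //; apply: ballxx; exact: divr_gt0.
  - exists (enum_fset D) => x /BD[y yD yx]; exists y => //.
    rewrite -scalerBl -rmorphB/= nmZr.
    move: yx; rewrite /cover/= -ball_normE /ball_/= distrC ltr_pdivlMr//.
    by apply: le_lt_trans; rewrite ler_wpM2l// lerDl.
apply: tb_sub (tb_minkowski (seg v) (seg ('i%C *: v))) => _ [a /= a1 <-].
exists ((complex.Re a)%:C *: v), ((complex.Im a)%:C *: ('i%C *: v)); split.
- exists (complex.Re a) => //=; rewrite in_itv/= -ler_norml.
  exact: le_trans (Re_le_cm a) a1.
- exists (complex.Im a) => //=; rewrite in_itv/= -ler_norml.
  exact: le_trans (Im_le_cm a) a1.
- by rewrite scalerA -scalerDl [_ * 'i%C]mulrC -complexE.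
Qed.

Lemma tb_lincomb V (I : Type) (s : seq I) (v : I -> V) :
  tbounded [set \sum_(i <- s) c i *: v i | c in [set c : I -> R[i] | forall i, cm (c i) <= 1]].
Proof.
elim: s => [|i s IH].
  by move=> e e0; exists [:: 0] => _ [c _ <-]; exists 0; rewrite ?inE// big_nil subrr nm0.
apply: tb_sub (tb_minkowski (tb_disc (v i)) IH) => _ [c c1 <-]; rewrite big_cons.
exists (c i *: v i), (\sum_(j <- s) c j *: v j); split=> //; last by exists c.
by exists (c i) => //=; exact: c1.
Qed.

End total_boundedness.

(** * Graphs, their projections and the resolvents *)

Section graph_projections.
Context {R : realType} {H H' : hilbertType R}.
Implicit Types (A : regular H H') (p q : hsum H H').

Lemma hsum_dotP p q : '[p, q] = '[p.1, q.1] + '[p.2, q.2].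
Proof. by []. Qed.

Lemma nm_hsum p : nm p ^+ 2 = nm p.1 ^+ 2 + nm p.2 ^+ 2.
Proof. by rewrite -!rdot_nm /rdot hsum_dotP raddfD. Qed.

Lemma nm_fst p : nm p.1 <= nm p.
Proof. by apply: sqr_le; rewrite ?nm_ge0// nm_hsum lerDl sqr_ge0. Qed.

Lemma nm_snd p : nm p.2 <= nm p.
Proof. by apply: sqr_le; rewrite ?nm_ge0// nm_hsum lerDr sqr_ge0. Qed.

Lemma nm_hsum_le p : nm p <= nm p.1 + nm p.2.
Proof.
apply: sqr_le; first by rewrite addr_ge0 ?nm_ge0.
rewrite nm_hsum sqrrD addrAC lerDl mulrn_wge0// mulr_ge0 ?nm_ge0 //.
Qed.

Lemma nm_pair_le (x : H) (y : H') (r s : R) : nm x <= r -> nm y <= s ->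
  nm ((x, y) : hsum H H') <= r + s.
Proof. by move=> xr ys; apply: le_trans (nm_hsum_le _) _; exact: lerD. Qed.

Lemma rgraph_sub A : subspace_set (rgraph A).
Proof. by split; [exact: rgraph0|move=> a p q; exact: rgraphD]. Qed.

Lemma rgraphB A p q : rgraph A p -> rgraph A q -> rgraph A (p - q).
Proof. exact: (subspaceB (rgraph_sub A)). Qed.

Lemma regular_exists (G : set (hsum H H')) : subspace_set G -> closed G ->
  (forall y, G (0, y) -> y = 0) -> dense (graph_dom G) -> exists B, rgraph B = G.
Proof.
move=> sG cG G0 dG; have Gf x y y' : G (x, y) -> G (x, y') -> y = y'.
  move=> Gy Gy'; apply/subr0_eq/G0; have := subspaceB sG Gy Gy'; congr (G _).
  by congr pair; rewrite /= subrr.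
by exists (Regular sG.1 (fun a p q => sG.2 a p q) Gf cG dG).
Qed.

Lemma rgraph_snd_eq0 A y : rgraph A (0, y) -> y = 0.
Proof. by move=> Ay; apply: (rgraph_fun Ay); exact: (rgraph0 A). Qed.

Lemma dom_ortho A (x : H) : (forall q, rgraph A q -> '[x, q.1] = 0) -> x = 0.
Proof.
move=> h; apply: (@dense_ortho _ _ (graph_dom (rgraph A))) => [|w [y Awy]].
  exact: rgraph_dense.
exact: (h _ Awy).
Qed.

Lemma adjP A (y : H') (x : H) : graph_adj (rgraph A) (y, x) <->
  forall q, rgraph A q -> '[(- x, y) : hsum H H', q] = 0.
Proof.
split=> h q Aq.
  rewrite hsum_dotP/= dotNl; have /= := h q Aq.
  by rewrite (dotC q.2) (dotC q.1) => /(can_inj conjCK) ->; rewrite addNr.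
have := h q Aq; rewrite hsum_dotP/= dotNl addrC => /subr0_eq E.
by rewrite /= (dotC q.2) (dotC q.1) E.
Qed.

Section projection_of_graph.
Variable A : regular H H'.
Local Notation P := (graph_proj A).

Lemma gproj_in p : rgraph A (P p).
Proof. exact: (orthoproj_in (rgraph_sub A) (@rgraph_closed _ _ _ A)). Qed.

Lemma gproj_dot p q : rgraph A q -> '[p - P p, q] = 0.
Proof. exact: (orthoproj_dot (rgraph_sub A) (@rgraph_closed _ _ _ A)). Qed.

Lemma gproj_id p : rgraph A p -> P p = p.
Proof. exact: (orthoproj_id (rgraph_sub A) (@rgraph_closed _ _ _ A)). Qed.

Lemma gproj_eq p q : rgraph A q ->
  (forall r, rgraph A r -> '[p - q, r] = 0) -> P p = q.
Proof. exact: (orthoproj_eq (rgraph_sub A) (@rgraph_closed _ _ _ A)). Qed.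

Lemma gproj_le p : nm (P p) <= nm p.
Proof. exact: (orthoproj_le (rgraph_sub A) (@rgraph_closed _ _ _ A)). Qed.

Lemma gproj_nm p : nm p ^+ 2 = nm (P p) ^+ 2 + nm (p - P p) ^+ 2.
Proof. exact: (orthoproj_nm (rgraph_sub A) (@rgraph_closed _ _ _ A)). Qed.

Lemma gproj_nm_dot p : nm (P p) ^+ 2 = rdot (P p) p.
Proof. exact: (orthoproj_nm_dot (rgraph_sub A) (@rgraph_closed _ _ _ A)). Qed.

Lemma gproj_fst_linear : linear (fun x : H => (P (x, 0)).1).
Proof.
move=> a x y; rewrite -[RHS]/((a *: P (x, 0) + P (y, 0)).1) -bop_linear.
by congr (P _).1; congr pair; rewrite /= scaler0 addr0.
Qed.

Lemma gproj_snd_linear : linear (fun y : H' => y - (P (0, y)).2).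
Proof.
move=> a x y; rewrite scalerBr addrACA -opprD.
rewrite -[a *: _ + (P (0, y)).2]/((a *: P (0, x) + P (0, y)).2) -bop_linear.
by congr (_ - (P _).2); congr pair; rewrite /= scaler0 addr0.
Qed.

Lemma gproj_adj p : graph_adj (rgraph A) ((p - P p).2, - (p - P p).1).
Proof.
by apply/adjP => q Aq; rewrite opprK -(gproj_dot p Aq); case: (p - P p).
Qed.

(** $(x,0)-(z,Az)$ is orthogonal to the graph of $A$ exactly when $(Az,x-z)$ lies in
   the graph of $A^*$, that is, when $(1+A^*A)z = x$. *)
Lemma resolventE x : resolvent A x = (P (x, 0)).1.
Proof.
have [|T TE] := op_exists (M := 1) gproj_fst_linear.
  move=> y; rewrite mul1r; apply: le_trans (nm_fst _) (le_trans (gproj_le _) _).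
  by apply: le_trans (nm_hsum_le _) _; rewrite /= nm0 addr0.
rewrite /resolvent (@bop_ofE _ _ _ _ T) ?TE//.
apply/seteqP; split=> -[y z] /=; rewrite /op_graph/= TE.
  move=> <-; exists (P (y, 0)).2; split=> /=.
    by rewrite -surjective_pairing; exact: gproj_in.
  have := gproj_adj (y, 0); rewrite /= sub0r.
  move=> h q Aq; have /= := h q Aq; rewrite dotNr dotNr => /oppr_inj ->.
  by [].
move=> [w [/= Azw adj]]; rewrite (gproj_eq (q := (z, w))) ?surjective_pairing// => q Aq.
have /= := adj q Aq; rewrite hsum_dotP/= sub0r dotNl => E.
by rewrite (dotC _ q.1) (dotC w) E subrr.
Qed.

Lemma coresolventE y : coresolvent A y = y - (P (0, y)).2.
Proof.
have [|T TE] := op_exists (M := 2) gproj_snd_linear.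
  move=> z; apply: le_trans (nmB _ _) _; rewrite mulr_natl mulr2n lerD2l.
  apply: le_trans (nm_snd _) (le_trans (gproj_le _) _).
  by apply: le_trans (nm_hsum_le _) _; rewrite /= nm0 add0r.
rewrite /coresolvent (@bop_ofE _ _ _ _ T) ?TE//.
apply/seteqP; split=> -[z w] /=; rewrite /op_graph/= TE.
  move=> <-; exists (P (0, z)).1; split=> /=.
    have := gproj_adj (0, z); rewrite /= sub0r opprK; exact.
  by rewrite opprB addrC subrK -surjective_pairing; exact: gproj_in.
move=> [x [/= adj Ax]]; rewrite (gproj_eq (q := (x, z - w))) /= ?subKr// => q Aq.
have /= := adj q Aq; rewrite hsum_dotP/= sub0r dotNl subKr => E.
by rewrite (dotC x) (dotC _ q.2) E addNr.
Qed.

End projection_of_graph.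
End graph_projections.

(** * Compactness of the resolvents *)

Section compact_resolvents.
Context {R : realType} {H H' : hilbertType R}.

(** The unit ball of the domain for a norm equivalent to the graph norm; its total
   boundedness says that the domain embeds compactly. *)
Definition dom_ball (K K' : hilbertType R) (W : set (hsum K K')) : set K :=
  [set x | exists2 y, W (x, y) & nm x <= 1 /\ nm y <= 1].

Variable A : regular H H'.
Local Notation P := (graph_proj A).

Lemma nm_inl (x : H) : nm ((x, 0) : hsum H H') = nm x.
Proof.
apply/eqP; rewrite -(@eqrXn2 _ 2%N) ?nm_ge0//.
by rewrite nm_hsum/= nm0 expr0n addr0.
Qed.

Lemma nm_inr (y : H') : nm ((0, y) : hsum H H') = nm y.
Proof.
apply/eqP; rewrite -(@eqrXn2 _ 2%N) ?nm_ge0//.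
by rewrite nm_hsum/= nm0 expr0n add0r.
Qed.

(** A projection satisfies $\|Pp\|^2=\langle Pp,p\rangle$, and for $p=(x,0)$ the right
   side only involves the diagonal block. *)
Lemma gproj_offdiag1 x : nm (P (x, 0)).2 ^+ 2 <= nm x * nm (resolvent A x).
Proof.
apply: le_trans (_ : nm (P (x, 0)) ^+ 2 <= _).
  by rewrite nm_hsum lerDr sqr_ge0.
rewrite gproj_nm_dot resolventE mulrC /rdot hsum_dotP/= dot0r addr0.
exact: rdot_le.
Qed.

Lemma gproj_offdiag2 y : nm (P (0, y)).1 ^+ 2 <= nm y * nm (coresolvent A y).
Proof.
set p : hsum H H' := (0, y).
have -> : nm (P p).1 = nm (p - P p).1 by rewrite /= sub0r nmN.
apply: le_trans (_ : nm (p - P p) ^+ 2 <= _).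
  by rewrite [leRHS]nm_hsum lerDl sqr_ge0.
have -> : nm (p - P p) ^+ 2 = rdot (p - P p) p.
  rewrite rdotBl rdot_nm -gproj_nm_dot (gproj_nm A p); ring.
rewrite coresolventE mulrC /rdot hsum_dotP/= dot0r add0r.
exact: rdot_le.
Qed.

(** For the projection $P$ onto the graph the resolvents are $P_{11}$ and $1-P_{22}$;
   if they are compact, so are $P_{12}$ and $P_{21}$.  As $P$ fixes $(x,y)$ in the graph
   of $A$, and kills $(-z,y)$ for $(y,z)$ in the graph of $A^*$, the components $x$ and
   $y$ are sums of values of these blocks.  Conversely each resolvent maps the unit
   ball into the corresponding [dom_ball]. *)
Lemma compact_resolventsP : compact_resolvents A <->
  tbounded (dom_ball (rgraph A)) /\ tbounded (dom_ball (graph_adj (rgraph A))).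
Proof.
split=> [[/compact_opP cA /compact_opP cA']|[tA tA']].
  have t1 : tbounded ((fun y => (P (0, y)).1) @` [set y | nm y <= 1]).
    apply: (tb_control (M := 2) _ _ cA') => // y z /= y1 z1.
    rewrite -bopB.
    have -> : (P (0, y)).1 - (P (0, z)).1 = (P (0, y - z)).1.
      rewrite -[LHS]/((P (0, y) - P (0, z)).1) -bopB.
      by congr (P _).1; congr pair; rewrite /= subrr.
    apply: le_trans (gproj_offdiag2 _) _; rewrite ler_wpM2r ?nm_ge0//.
    by apply: le_trans (nmB _ _) _; lra.
  have t2 : tbounded ((fun x => (P (x, 0)).2) @` [set x | nm x <= 1]).
    apply: (tb_control (M := 2) _ _ cA) => // x z /= x1 z1.
    rewrite -bopB.
    have -> : (P (x, 0)).2 - (P (z, 0)).2 = (P (x - z, 0)).2.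
      rewrite -[LHS]/((P (x, 0) - P (z, 0)).2) -bopB.
      by congr (P _).2; congr pair; rewrite /= subrr.
    apply: le_trans (gproj_offdiag1 _) _; rewrite ler_wpM2r ?nm_ge0//.
    by apply: le_trans (nmB _ _) _; lra.
  split.
    apply: tb_sub (tb_minkowski cA t1) => x [y Axy [x1 y1]].
    exists (resolvent A x), (P (0, y)).1; split; [by exists x|by exists y|].
    rewrite resolventE -[RHS]/((P (x, 0) + P (0, y)).1) -bopD.
    have -> : (x, 0) + (0, y) = (x, y) :> hsum H H' by congr pair; rewrite /= ?addr0 ?add0r.
    by rewrite gproj_id.
  apply: tb_sub (tb_minkowski cA' t2) => y [z Ayz [y1 z1]].
  exists (coresolvent A y), (P (z, 0)).2; split; [by exists y|by exists z|].
  have /adjP h := Ayz.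
  have : P (- z, y) = 0.
    by apply: gproj_eq => [|r Ar]; [exact: rgraph0|rewrite subr0; exact: h].
  have -> : (- z, y) = (0, y) - (z, 0) :> hsum H H' by congr pair; rewrite /= ?subr0 ?sub0r.
  by rewrite bopB => /subr0_eq <-; rewrite coresolventE subrK.
split; apply/compact_opP.
  apply: tb_sub tA => _ [x /= x1 <-]; rewrite resolventE.
  have := gproj_le A (x, 0); rewrite nm_inl => Px.
  exists (P (x, 0)).2; first by rewrite -surjective_pairing; exact: gproj_in.
  by split; [apply: le_trans (nm_fst _) _|apply: le_trans (nm_snd _) _]; exact: le_trans Px x1.
apply: tb_sub tA' => _ [y /= y1 <-].
have := @gproj_adj _ _ _ A (0, y); set q := ((0, y) : hsum H H') - P (0, y) => h.
have qy : nm q <= 1.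
  apply: le_trans y1; apply: sqr_le; first exact: nm_ge0.
  by rewrite -nm_inr (gproj_nm A (0, y)) lerDr sqr_ge0.
have -> : coresolvent A y = q.2 by rewrite coresolventE.
exists (- q.1) => //; rewrite nmN.
by split; [apply: le_trans (nm_snd _) _|apply: le_trans (nm_fst _) _].
Qed.

End compact_resolvents.

(** * Finite dimensional subspaces *)

Section finite_dimension.
Context {R : realType} {H : hilbertType R}.

(** For an orthonormal [s] this is the span of [s]. *)
Definition frame_span (s : seq H) : set H :=
  [set x | x = \sum_(v <- s) '[x, v] *: v].

Lemma dot_suml (s : seq H) (c : H -> R[i]) y :
  '[\sum_(v <- s) c v *: v, y] = \sum_(v <- s) c v * '[v, y].
Proof.
elim: s => [|v s IH]; first by rewrite !big_nil dot0l.
by rewrite !big_cons dotDl dotZl IH.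
Qed.

Lemma frame_span_sub s : subspace_set (frame_span s).
Proof.
split=> [|a x y hx hy].
  by rewrite /frame_span/=; rewrite big1// => v _; rewrite dot0l scale0r.
rewrite /frame_span/= [in LHS]hx [in LHS]hy scaler_sumr -big_split/=.
by apply: eq_bigr => v _; rewrite dotDl dotZl scalerDl scalerA.
Qed.

(** A vanishing residue leaves the family unchanged, so that the given vectors may be
   linearly dependent. *)
Lemma gram_schmidt (l : seq H) : exists s : seq H,
  (forall v, v \in s -> nm v <= 1 /\ frame_span s v) /\
  (forall x, x \in l -> frame_span s x).
Proof.
elim: l => [|x l [s [hs hl]]]; first by exists [::]; split.
set f := x - \sum_(v <- s) '[x, v] *: v.
have [f0|f0] := eqVneq f 0.
  exists s; split=> // z; rewrite inE => /orP[/eqP ->|/hl//].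
  by apply/eqP; rewrite -subr_eq0; apply/eqP.
have fp : 0 < nm f.
  by rewrite lt_neqAle nm_ge0 andbT eq_sym; apply: contra_neq f0 => /nm_eq0.
have fv v : v \in s -> '[v, f] = 0.
  move=> /hs[_ vE]; rewrite dotC; apply/eqP; rewrite conjC_eq0 /f dotBl dot_suml; apply/eqP.
  have -> : '[x, v] = \sum_(w <- s) '[x, w] * '[w, v].
    rewrite {1}vE dotC dot_suml rmorph_sum/=; apply: eq_bigr => w _.
    by rewrite rmorphM/= mulrC -!dotC.
  by rewrite subrr.
pose g := (nm f)^-1%:C *: f.
have gv v : v \in s -> '[v, g] = 0 by move=> vs; rewrite dotZrR fv// mulr0.
have yg y : frame_span s y -> '[y, g] = 0.
  move=> ->; rewrite dot_suml big_seq big1// => v vs; by rewrite gv// mulr0.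
have grow y : frame_span s y -> frame_span (g :: s) y.
  by move=> ys; rewrite /frame_span/= big_cons yg// scale0r add0r.
have ng : nm g = 1 by rewrite nmZr ger0_norm ?invr_ge0 ?nm_ge0// mulVf// gt_eqF.
have gg : frame_span (g :: s) g.
  rewrite /frame_span/= big_cons dot_nm ng expr1n scale1r big_seq big1 ?addr0// => v vs.
  by rewrite dotC gv// rmorph0 scale0r.
exists (g :: s); split=> [v|z]; rewrite inE => /orP[/eqP ->|].
- by rewrite ng.
- by move=> /hs[v1 vE]; split=> //; exact: grow.
- have -> : x = (nm f)%:C *: g + \sum_(v <- s) '[x, v] *: v.
    by rewrite /g scalerA -rmorphM/= mulfV ?gt_eqF// scale1r subrK.
  apply: subspaceD (frame_span_sub _) _ _; first exact: subspaceZ (frame_span_sub _) _.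
  apply: grow; rewrite big_seq; elim/big_ind: _ => [|u w hu hw|v /hs[_ hv]].
  + exact: (frame_span_sub s).1.
  + exact: subspaceD (frame_span_sub _) _ _.
  + exact: subspaceZ (frame_span_sub _) _.
- by move=> /hl zs; exact: grow.
Qed.

(** In an orthonormal family the coefficients of a vector are bounded by its norm. *)
Lemma tb_finite_dim (W : set H) : finite_dim W -> tbounded [set x | W x /\ nm x <= 1].
Proof.
move=> [n [e [_ We]]]; have [s [hs hl]] := gram_schmidt [seq e i | i <- enum 'I_n].
apply: tb_sub (tb_lincomb s id) => x [Wx x1].
have xs : frame_span s x.
  have [c ->] := We x Wx; elim/big_ind: _ => [|u w hu hw|i _].
  - exact: (frame_span_sub s).1.
  - exact: subspaceD (frame_span_sub _) _ _.
  - by apply: subspaceZ (frame_span_sub _) _; apply: hl; apply: map_f; rewrite mem_enum.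
exists (fun v => if v \in s then '[x, v] else 0).
  move=> v /=; case: ifP => [/hs[v1 _]|_]; last by rewrite /cm normr0.
  by apply: le_trans (cm_dot _ _) _; rewrite mulr_ile1 ?nm_ge0.
rewrite [RHS]xs big_seq [RHS]big_seq; apply: eq_bigr => v vs.
by rewrite vs.
Qed.

End finite_dimension.

(** * Uniform boundedness and operators with closed range *)

Section geometric.
Context {R : realType}.

(** With ratio $1/4$ the terms after the $n$-th add up to a third of it. *)
Definition geo (n : nat) : R := 4^-1 ^+ n.

Lemma geo_gt0 n : 0 < geo n.
Proof. by rewrite exprn_gt0// invr_gt0. Qed.

Lemma geo_ge0 n : 0 <= geo n. Proof. exact/ltW/geo_gt0. Qed.

Lemma geoS n : geo n.+1 = geo n / 4.
Proof. by rewrite /geo exprSr. Qed.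

Lemma geo_le n : geo n <= (n.+1%:R)^-1.
Proof.
elim: n => [|n IH]; first by rewrite /geo expr0 invr1.
rewrite geoS ler_pdivrMr//; apply: le_trans IH _.
rewrite mulrC ler_pdivlMr// mulrC ler_pdivrMr//.
rewrite -natrM ler_nat; apply: (@leq_trans (2 * n.+1)%N); last by rewrite leq_mul2r.
by rewrite mul2n -addnn -[X in (X <= _)%N]addn1 leq_add2l.
Qed.

Lemma geo_lt (e : R) : 0 < e -> exists N : nat, forall n, (N <= n)%N -> geo n < e.
Proof.
move=> e0; have [N hN] := inv_nat_lt e0; exists N => n Nn.
exact: le_lt_trans (geo_le n) (hN n Nn).
Qed.

End geometric.

Section uniform_boundedness.
Context {R : realType}.
Implicit Types H : hilbertType R.

(** The principle of uniform boundedness for a set of vectors seen as functionals,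
   by a gliding hump: a partial sum either already sees the next functional or
   is made to see it by the next summand, and the tail is too short to undo this. *)
Lemma weakly_bounded H (F : set H) :
  (forall z, exists M : R, forall y, F y -> cm '[z, y] <= M) ->
  exists C : R, forall y, F y -> nm y <= C.
Proof.
move=> wb; apply: contrapT => nb.
have /choice[y hy] : forall n : nat, exists y, F y /\ 3 * n.+1%:R / geo n < nm y.
  move=> n; apply: contrapT => h; apply: nb; exists (3 * n.+1%:R / geo n) => y Fy.
  by rewrite leNgt; apply/negP => hy; apply: h; exists y.
have yp n : 0 < nm (y n).
  apply: lt_trans (hy n).2; by rewrite divr_gt0 ?geo_gt0// mulr_gt0.
pose h n := (geo n / nm (y n))%:C *: y n.
have nh n : nm (h n) = geo n.
  rewrite nmZr ger0_norm ?divr_ge0 ?geo_ge0 ?nm_ge0//.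
  by rewrite mulfVK ?gt_eqF.
have hdot n : cm '[h n, y n] = geo n * nm (y n).
  rewrite dotZl cmM cm_real ger0_norm ?divr_ge0 ?geo_ge0 ?nm_ge0// dot_nm cm_real.
  rewrite ger0_norm ?sqr_ge0// expr2 -mulrA (mulKf _ _) ?gt_eqF//.
have /choice[g hg] : forall p : nat * H, exists x',
    nm (x' - p.2) <= geo p.1 /\ geo p.1 * nm (y p.1) <= cm '[x', y p.1].
  case=> n x /=; have [xb|xb] := leP (geo n * nm (y n)) (cm '[x + h n, y n]).
    by exists (x + h n); rewrite addrAC subrr add0r nh.
  exists (x - h n); rewrite addrAC subrr add0r nmN nh; split=> //.
  have : cm ('[x + h n, y n] - '[x - h n, y n]) = 2 * (geo n * nm (y n)).
    rewrite -hdot -dotBl.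
    have -> : x + h n - (x - h n) = (2 : R)%:C *: h n.
      by apply: dot_inj => z; rewrite !dot_expand rmorphD/= rmorph1; ring.
    by rewrite dotZl cmM cm_real ger0_norm.
  by have := cmD '[x + h n, y n] (- '[x - h n, y n]); rewrite cmN; lra.
pose x := fix x n := if n is m.+1 then g (m, x m) else 0.
have xS n : nm (x n.+1 - x n) <= geo n by have [] := hg (n, x n).
have xd m n : (n <= m)%N -> nm (x m - x n) <= (4 / 3) * (geo n - geo m).
  elim: m => [|m IH]; first by rewrite leqn0 => /eqP ->; rewrite !subrr nm0 mulr0.
  rewrite leq_eqVlt => /orP[/eqP ->|]; first by rewrite !subrr nm0 mulr0.
  rewrite ltnS => /IH {}IH; apply: le_trans (nm_tri (x m) _ _) _.
  by have := xS m; rewrite geoS; lra.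
have [||z hz] := @cauchy_seq_lim_le _ H x (fun n => 4 / 3 * geo n).
- move=> e e0; have [N hN] := @geo_lt R (e * 3 / 4) (divr_gt0 (mulr_gt0 e0 (ltr0Sn _ _)) (ltr0Sn _ _)).
  by exists N => n /hN; lra.
- move=> m n nm_; apply: le_trans (xd m n nm_) _.
  by have := @geo_ge0 R m; move: (geo _) (geo _) => *; lra.
have [M hM] := wb z.
have [N _] : exists2 N : nat, True & M < N%:R.
  by exists (Num.bound `|M|) => //; apply: le_lt_trans (ler_norm _) (archi_boundP _).
move=> MN; have := hM _ (hy N).1; apply/negP; rewrite -ltNge.
have h1 : geo N * nm (y N) <= cm '[x N.+1, y N] by have [] := hg (N, x N).
have h2 : cm '[x N.+1 - z, y N] <= (geo N / 3) * nm (y N).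
  apply: le_trans (cm_dot _ _) _; rewrite ler_wpM2r ?nm_ge0// nm_sub.
  by have := hz N.+1; rewrite geoS; lra.
have h3 : cm '[x N.+1, y N] <= cm '[x N.+1 - z, y N] + cm '[z, y N].
  by have := cmD '[x N.+1 - z, y N] '[z, y N]; rewrite -dotDl subrK.
have h4 : 3 * N.+1%:R < geo N * nm (y N).
  by have := (hy N).2; rewrite ltr_pdivrMr ?geo_gt0// [nm _ * _]mulrC.
have h5 : N.+1%:R = N%:R + 1 :> R by rewrite -natr1.
rewrite h5 in h4; have : 0 <= N%:R :> R by [].
have h2' : geo N / 3 * nm (y N) = geo N * nm (y N) / 3 by rewrite mulrAC.
rewrite h2' in h2; move: MN h1 h2 h3 h4.
move: (geo N * _) (cm '[_ - _, _]) (cm '[z, _]) (cm '[x _, _]) (N%:R) => *; lra.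
Qed.

End uniform_boundedness.

Section closed_range.
Context {R : realType} {H H' : hilbertType R}.
Variable A : regular H H'.
Local Notation P := (graph_proj A).

Lemma graph_ran_sub : subspace_set (graph_ran (rgraph A)).
Proof.
split; first by exists 0; exact: rgraph0.
move=> a y y' [x Ax] [x' Ax']; exists (a *: x + x').
exact: (rgraphD a Ax Ax').
Qed.

Lemma graph_ker_sub : subspace_set (graph_ker (rgraph A)).
Proof.
split; first exact: rgraph0.
move=> a x x' Ax Ax'; have := rgraphD a Ax Ax'; congr (rgraph A _).
by congr pair; rewrite /= scaler0 addr0.
Qed.

Lemma graph_ker_closed : closed (graph_ker (rgraph A)).
Proof.
apply: nm_closed => x h; apply: (closed_nm (@rgraph_closed _ _ _ A)) => e e0.
have [x' Ax' xx'] := h e e0; exists (x', 0) => //.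
apply: le_lt_trans (nm_hsum_le _) _.
by rewrite /= subrr nm0 addr0.
Qed.

Lemma adj_ran_sub : subspace_set (graph_ran (graph_adj (rgraph A))).
Proof.
split; first by exists 0 => q _ /=; rewrite !dot0r.
move=> a x x' [y h] [y' h']; exists (a *: y + y') => q Aq /=.
have /= E := h q Aq; have /= E' := h' q Aq.
by rewrite !dotDr !dotZr E E'.
Qed.

(** The defect $(q,0)-P(q,0)$ is a rotated point of the graph of $A^*$.  Its first
   component lies in the range of $A^*$ and is thus orthogonal to $q$, so that the
   defect vanishes. *)
Lemma adj_ran_ortho q : (forall z, graph_ran (graph_adj (rgraph A)) z -> '[z, q] = 0) ->
  graph_ker (rgraph A) q.
Proof.
move=> h; rewrite /graph_ker/=.
have E : nm (((q, 0) : hsum H H') - P (q, 0)) ^+ 2 = 0.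
  set p : hsum H H' := (q, 0).
  have -> : nm (p - P p) ^+ 2 = rdot (p - P p) p.
    by rewrite rdotBl rdot_nm -gproj_nm_dot (gproj_nm A p); ring.
  rewrite /rdot hsum_dotP/= dot0r addr0 -(opprK (_ - _)) dotNl h ?oppr0//.
  by exists (p - P p).2; exact: (@gproj_adj _ _ _ A p).
have /subr0_eq -> : ((q, 0) : hsum H H') - P (q, 0) = 0.
  by apply: nm_eq0; apply/eqP; rewrite -sqrf_eq0 E.
exact: gproj_in.
Qed.

Hypothesis ran_closed : closed (graph_ran (rgraph A)).

(** The vectors $y$ in the range of $A$ with $\|A^*y\|\le 1$ are weakly bounded, since
   $\langle Ax,y\rangle=\langle x,A^*y\rangle$ and the range is closed. *)
Lemma adj_bounded_below : exists2 C : R, 0 <= C & forall y z,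
  graph_adj (rgraph A) (y, z) -> graph_ran (rgraph A) y -> nm y <= C * nm z.
Proof.
pose F := [set y | graph_ran (rgraph A) y /\
  exists2 z, graph_adj (rgraph A) (y, z) & nm z <= 1].
have [|C hC] := @weakly_bounded _ _ F.
  move=> w; have [r [x Axr] wr] := projection_closed w graph_ran_sub ran_closed.
  exists (nm x) => y [yr [z adj z1]].
  have -> : '[w, y] = '[r, y].
    by apply/eqP; rewrite -subr_eq0 -dotBl; apply/eqP; exact: wr.
  have /= -> := adj _ Axr.
  by apply: le_trans (cm_dot _ _) _; rewrite ler_piMr ?nm_ge0.
exists `|C| => // y z adj yr.
have [z0|z0] := eqVneq (nm z) 0.
  suff -> : y = 0 by rewrite nm0 mulr_ge0 ?nm_ge0.
  have [x Axy] := yr; have /= := adj _ Axy; rewrite (nm_eq0 z0) dot0r dot_nm => E.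
  apply: nm_eq0; apply/eqP; rewrite -sqrf_eq0.
  by have := congr1 (@complex.Re R) E => /= ->.
have zp : 0 < nm z by rewrite lt_neqAle eq_sym z0 nm_ge0.
have : nm ((nm z)^-1%:C *: y) <= C.
  apply: hC; split; first exact: subspaceZ graph_ran_sub yr.
  exists ((nm z)^-1%:C *: z).
    by move=> q Aq /=; have /= E := adj q Aq; rewrite !dotZrR E.
  by rewrite nmZr ger0_norm ?invr_ge0 ?nm_ge0// mulVf.
rewrite nmZr ger0_norm ?invr_ge0 ?nm_ge0// mulrC ler_pdivrMr// => h.
by apply: le_trans h _; rewrite ler_wpM2r ?nm_ge0// ler_norm.
Qed.

(** The solution $x$ orthogonal to the kernel is a limit of values $A^*w$ with $w$ in
   the range, and $\langle x,A^*w\rangle=\langle y,w\rangle\le C\|y\|\|A^*w\|$. *)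
Lemma ran_bounded_below : exists2 C : R, 0 <= C & forall y,
  graph_ran (rgraph A) y -> exists2 x, rgraph A (x, y) & nm x <= C * nm y.
Proof.
have [C C0 hC] := adj_bounded_below; exists C => // y yr; have [x0 Ax0] := yr.
have [k kA x0k] := projection_closed x0 graph_ker_sub graph_ker_closed.
set x := x0 - k in x0k.
have Ax : rgraph A (x, y).
  have := rgraphB Ax0 kA; congr (rgraph A _).
  by congr pair; rewrite /= subr0.
clearbody x; exists x => //.
(* x is orthogonal to the kernel, hence a limit of values of the adjoint *)
have app (e : R) : 0 < e -> exists z w, [/\ graph_adj (rgraph A) (w, z),
    graph_ran (rgraph A) w & nm (x - z) < e].
  move=> e0; have [p [pz xp]] := projection x adj_ran_sub.
  have qk : graph_ker (rgraph A) (x - p).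
    by apply: adj_ran_ortho => z hz; rewrite dotC xp// rmorph0.
  have pq : '[p, x - p] = 0.
    apply: dot_approx0 => e' e'0; have [z hz pz'] := pz e' e'0.
    by exists z; [exact: ltW|rewrite dotC xp// rmorph0].
  have xE : x - p = 0.
    apply: nm_eq0; apply/eqP; rewrite -sqrf_eq0 -rdot_nm /rdot dotBl pq subr0.
    by rewrite x0k.
  have [z [w adj] pz'] := pz e e0.
  have [r rr wr] := projection_closed w graph_ran_sub ran_closed.
  exists z, r; split=> //.
    move=> q Aq /=; have /= <- := adj q Aq.
    apply/eqP; rewrite -subr_eq0 -dotBr -opprB dotNr oppr_eq0 dotC wr ?rmorph0//.
    by exists q.1; rewrite -surjective_pairing.
  by rewrite (subr0_eq xE).
have key : nm x ^+ 2 <= C * nm y * nm x.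
  apply/ler_addgt0Pr => e e0.
  set M := C * nm y + nm x.
  have M0 : 0 <= M by rewrite addr_ge0 ?mulr_ge0 ?nm_ge0.
  have Mp : 0 < M + 1 by rewrite ltr_wpDl.
  have [z [w [adj wr xz]]] := app _ (divr_gt0 e0 Mp).
  have E : rdot x z = rdot y w by rewrite /rdot; have /= -> := adj _ Ax.
  have h1 : rdot y w <= nm y * (C * nm z).
    apply: le_trans (rdot_le _ _) _; rewrite ler_wpM2l ?nm_ge0//.
    exact: hC.
  have h2 : nm z <= nm x + nm (x - z) by rewrite nm_sub; exact: nm_ge.
  have h3 : rdot x (x - z) <= nm x * nm (x - z) by exact: rdot_le.
  have h4 : nm (x - z) * (M + 1) < e by rewrite -ltr_pdivlMr.
  have h5 : nm x ^+ 2 = rdot x z + rdot x (x - z) by rewrite -rdotDr addrCA subrr addr0 rdot_nm.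
  have h6 : nm y * (C * nm z) <= C * nm y * (nm x + nm (x - z)).
    by rewrite mulrCA mulrA ler_wpM2l// mulr_ge0 ?nm_ge0.
  have h7 : nm (x - z) * (M + 1) = C * nm y * nm (x - z) + nm x * nm (x - z) + nm (x - z).
    by rewrite /M; ring.
  have h8 := nm_ge0 (x - z); rewrite mulrDr in h6.
  rewrite h5 E; lra.
have [x00|x00] := eqVneq (nm x) 0; first by rewrite x00 mulr_ge0 ?nm_ge0.
have xp : 0 < nm x by rewrite lt_neqAle eq_sym x00 nm_ge0.
by rewrite -(ler_pM2r xp) -expr2.
Qed.

End closed_range.

(** * Bounded operators that are bounded below on a graph *)

(** That is, $T\oplus 1$ is bounded below on [G]. *)
Definition bounded_below (R : realType) (H H1 H' : hilbertType R) (T : bounded_op H H1)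
    (G : set (hsum H H')) :=
  exists2 c : R, 0 < c & forall x y, G (x, y) -> c * nm x <= nm (T x) + nm y.

Section bounded_below.
Context {R : realType} {H H1 H' : hilbertType R}.

Lemma bounded_below_pair (T : bounded_op H H1) (G : set (hsum H H')) : bounded_below T G ->
  exists2 k : R, 0 < k & forall x y, G (x, y) ->
    nm ((x, y) : hsum H H') <= k * nm ((T x, y) : hsum H1 H').
Proof.
move=> [c c0 hc]; exists (2 / c + 1) => [|x y Gxy]; first by rewrite addr_gt0// divr_gt0.
have h := hc _ _ Gxy; apply: le_trans (nm_hsum_le _) _.
set w : hsum H1 H' := (T x, y).
have h1 := nm_fst w; have h2 := nm_snd w; rewrite /= in h1 h2 *.
rewrite mulrDl mul1r; apply: lerD => //.
by rewrite mulrAC ler_pdivlMr// mulrC; apply: le_trans h _; lra.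
Qed.

(** Unit vectors violating every bound would have a cluster point $x$ with $(x,0)$ in
   [G] and $Tx=0$. *)
Lemma tb_bounded_below (T : bounded_op H H1) (G : set (hsum H H')) :
  subspace_set G -> closed G -> tbounded (dom_ball G) ->
  (forall x, G (x, 0) -> T x = 0 -> x = 0) -> bounded_below T G.
Proof.
move=> sG cG tG inj; apply: contrapT => nb.
have /choice[p hp] : forall n : nat, exists p : hsum H H',
    [/\ G p, nm p.1 = 1 & nm (T p.1) + nm p.2 < (n.+1%:R)^-1].
  move=> n; apply: contrapT => h; apply: nb; exists (n.+1%:R)^-1; first by rewrite invr_gt0.
  move=> x y Gxy; rewrite leNgt; apply/negP => hxy; apply: h.
  have xp : 0 < nm x.
    rewrite lt_neqAle nm_ge0 andbT eq_sym; apply: contraTneq hxy => ->.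
    by rewrite mulr0 -leNgt addr_ge0 ?nm_ge0.
  exists ((nm x)^-1%:C *: (x, y)); split.
  - exact: subspaceZ.
  - by rewrite nmZr ger0_norm ?invr_ge0 ?nm_ge0// mulVf ?gt_eqF.
  - rewrite /= bopZ !nmZr ger0_norm ?invr_ge0 ?nm_ge0// -mulrDr mulrC ltr_pdivrMr//.
have [|x hx] := @tb_cluster _ H _ (fun n => (p n).1) tG.
  move=> n; have [Gp p1 h] := hp n; exists (p n).2; first by rewrite -surjective_pairing.
  split; first by rewrite p1.
  apply: le_trans (_ : (n.+1%:R)^-1 <= _); last by rewrite invf_le1// ler1n.
  by apply/ltW/(le_lt_trans _ h); rewrite lerDr nm_ge0.
have near0 (e : R) : 0 < e -> exists n, nm (x - (p n).1) < e /\ (n.+1%:R)^-1 < e.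
  move=> e0; have [N hN] := inv_nat_lt e0; have [n Nn xn] := hx e N e0.
  by exists n; split=> //; exact: hN.
have Gx : G (x, 0).
  apply: closed_nm cG _ => e e0.
  have e20 : 0 < e / 2 by rewrite divr_gt0.
  have [n [xn ne]] := near0 _ e20; have [Gp _ h] := hp n; exists (p n) => //.
  apply: le_lt_trans (nm_hsum_le _) _; rewrite /= sub0r nmN [e]splitr ltrD//.
  by apply: le_lt_trans (lt_trans h ne); rewrite lerDr nm_ge0.
have Tx : T x = 0.
  apply: nm_small => e e0.
  have Mp : 0 < nm T + 1 by rewrite ltr_wpDl ?nm_ge0.
  have [n [xn ne]] := near0 _ (divr_gt0 e0 Mp); have [Gp _ h] := hp n.
  apply: le_trans (nm_ge _ (T (p n).1)) _.
  have h1 : nm (T x - T (p n).1) <= nm T * nm (x - (p n).1) by rewrite -bopB nm_op.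
  have h2 : nm T * nm (x - (p n).1) <= nm T * (e / (nm T + 1)).
    by rewrite ler_wpM2l ?nm_ge0 ?ltW.
  have h3 : nm T * (e / (nm T + 1)) + e / (nm T + 1) = e by field; rewrite gt_eqF.
  have h4 := nm_ge0 (p n).2.
  by move: ne h h1 h2 h3 h4; move: (n.+1%:R^-1) => *; lra.
have [n [xn _]] := near0 _ (@ltr01 R); have [_ p1 _] := hp n.
by move: xn; rewrite (inj x Gx Tx) sub0r nmN p1 ltxx.
Qed.

(** Modulo its kernel [A] itself is bounded below, and the injective [T] is bounded
   below on the kernel, which is finite dimensional. *)
Lemma closed_ran_bounded_below (T : bounded_op H H1) (A : regular H H') :
  closed (graph_ran (rgraph A)) -> finite_dim (graph_ker (rgraph A)) ->
  (forall x, T x = 0 -> x = 0) -> bounded_below T (rgraph A).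
Proof.
move=> cA fA inj.
have [C C0 hC] := ran_bounded_below cA.
pose G := [set p : hsum H H' | graph_ker (rgraph A) p.1 /\ p.2 = 0].
have [||||c c0 hc] := @tb_bounded_below T G; last first.
- pose M := nm T * C + c * C.
  have M0 : 0 <= M by rewrite addr_ge0 ?mulr_ge0 ?nm_ge0 ?(ltW c0).
  have Mp : 0 < M + 1 by rewrite ltr_wpDl.
  exists (c / (M + 1)); first exact: divr_gt0.
  move=> x y Axy; have [|x' Ax' x'y] := hC y; first by exists x.
  have k : graph_ker (rgraph A) (x - x').
    have := rgraphB Axy Ax'; congr (rgraph A _).
    by congr pair; rewrite /= subrr.
  have h1 := hc (x - x') 0 (conj k (erefl _)); rewrite nm0 addr0 bopB in h1.
  have h2 := nmB (T x) (T x'); have h3 := nm_op T x'; have h4 := nm_ge x x'.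
  rewrite mulrAC ler_pdivrMr//.
  have h5 : nm T * nm x' <= nm T * (C * nm y) by rewrite ler_wpM2l ?nm_ge0.
  have h6 : c * nm x' <= c * (C * nm y) by rewrite ler_wpM2l ?(ltW c0).
  have h7 : c * nm x <= c * nm x' + c * nm (x - x') by rewrite -mulrDr ler_wpM2l ?(ltW c0).
  have h8 : c * nm x <= nm (T x) + M * nm y by rewrite /M mulrDl -!mulrA; lra.
  have h9 : 0 <= M * nm (T x) by rewrite mulr_ge0 ?nm_ge0.
  have h10 := nm_ge0 y; clearbody M; apply: le_trans h8 _; lra.
- by move=> x [kx _]; exact: inj.
- apply: tb_sub (tb_finite_dim fA) => x [y [kx _] [x1 _]].
  by split.
- apply: nm_closed => -[x y] h; split=> /=.
    apply: (closed_nm (@graph_ker_closed _ _ _ A)) => e e0.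
    have [q [kq _] hq] := h e e0; exists q.1 => //.
    exact: le_lt_trans (nm_fst ((x, y) - q : hsum H H')) hq.
  apply: nm_small => e e0.
  have [q [_ q2] hq] := h e e0; have := nm_snd ((x, y) - q : hsum H H').
  by rewrite /= q2 subr0 => /le_trans; apply; exact: ltW.
- split=> [|a p q [kp p2] [kq q2]]; split=> //=.
  + exact: (graph_ker_sub A).1.
  + exact: (graph_ker_sub A).2.
  + by rewrite p2 q2 scaler0 addr0.
Qed.

End bounded_below.

(** * Precomposition with the inverse of an injective bounded operator *)

Section push.
Context {R : realType} {H H' : hilbertType R}.
Implicit Types (A B : regular H H') (T : bounded_op H H).

(** The graph of $AT^{-1}$. *)
Definition push_graph T (G : set (hsum H H')) : set (hsum H H') :=
  [set p | exists2 x, G (x, p.2) & p.1 = T x].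

(** Injectivity of the adjoint says that the range of [T] is dense. *)
Definition quasi_affine T T' := [/\ forall x y, '[T x, y] = '[x, T' y],
  forall x, T x = 0 -> x = 0 & forall x, T' x = 0 -> x = 0].

(** The image of the graph under $T\oplus 1$ is closed by the lower bound, and its
   domain is dense because [T'] is injective. *)
Lemma push_exists A T T' : quasi_affine T T' -> bounded_below T (rgraph A) ->
  exists B, rgraph B = push_graph T (rgraph A).
Proof.
move=> [adj inj inj'] bT; have [k k0 hk] := bounded_below_pair bT.
have lS : linear (fun p : hsum H H' => (T p.1, p.2) : hsum H H').
  by move=> a p q; rewrite bop_linear.
have [|S SE] := op_exists (M := nm T + 1) lS.
  move=> p; apply: le_trans (nm_hsum_le _) _; rewrite mulrDl mul1r; apply: lerD; last exact: (nm_snd p).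
  by apply: le_trans (nm_op _ _) _; rewrite ler_wpM2l ?nm_ge0//; exact: (nm_fst p).
have GE : push_graph T (rgraph A) = S @` rgraph A.
  apply/seteqP; split=> [p [x Ax px]|_ [p Ap <-]]; rewrite ?SE.
    by exists (x, p.2) => //; rewrite SE /= -px -surjective_pairing.
  by exists p.1 => //=; rewrite -surjective_pairing.
have sG : subspace_set (push_graph T (rgraph A)).
  by rewrite GE; apply: subspace_image; exact: rgraph_sub.
apply: regular_exists => //.
- rewrite GE; apply: (closed_image (rgraph_sub A) (@rgraph_closed _ _ _ A) (ltW k0)).
  by move=> [x y] Axy; rewrite SE; exact: hk.
- move=> y [x /= Ax /esym/inj x0]; rewrite x0 in Ax; exact: rgraph_snd_eq0 Ax.
- apply: ortho_dense => [|x hx].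
    split; first by exists 0; exact: sG.1.
    by move=> a x x' [y xy] [y' xy']; exists (a *: y + y'); exact: (sG.2 a _ _ xy xy').
  apply: inj'; apply: (@dom_ortho _ _ _ A) => q Aq.
  rewrite dotC -adj -dotC; apply: hx; exists q.2; exists q.1 => //=.
  by rewrite -surjective_pairing.
Qed.

Definition push T A : regular H H' :=
  xget A [set B | rgraph B = push_graph T (rgraph A)].

Lemma pushP T T' A : quasi_affine T T' -> bounded_below T (rgraph A) ->
  rgraph (push T A) = push_graph T (rgraph A).
Proof.
move=> qT bT; have [B BE] := push_exists qT bT.
exact: (@xgetPex _ A [set B | rgraph B = push_graph T (rgraph A)] (ex_intro _ B BE)).
Qed.

Lemma regular_inj A B : rgraph A = rgraph B -> A = B.
Proof.
case: A B => GA a1 a2 a3 a4 a5 [GB b1 b2 b3 b4 b5] /= E; subst GB.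
rewrite (Prop_irrelevance a1 b1) (Prop_irrelevance a2 b2) (Prop_irrelevance a3 b3).
by rewrite (Prop_irrelevance a4 b4) (Prop_irrelevance a5 b5).
Qed.

Lemma fredholm_push T T' A B : quasi_affine T T' ->
  rgraph B = push_graph T (rgraph A) -> fredholm A -> fredholm B.
Proof.
move=> [_ inj _] BE [cA [n [e [Ae eA]]] fA].
have rE : graph_ran (rgraph B) = graph_ran (rgraph A).
  rewrite BE; apply/seteqP; split=> y [x].
    by move=> [z /= Az _]; exists z.
  by move=> Ax; exists (T x); exists x.
split; rewrite ?rE//; exists n, (T \o e); split=> [i|x].
  by rewrite /graph_ker/= BE; exists (e i) => //=; exact: Ae.
rewrite /graph_ker/= BE => -[z /= /eA[c ->] ->]; exists c.
elim/big_ind2 : _ => [|x1 x2 y1 y2 <- <-|i _].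
- by rewrite bop0.
- by rewrite bopD.
- by rewrite bopZ.
Qed.

Lemma tb_op (K K' : hilbertType R) (T : bounded_op K K') (S : set K) :
  tbounded S -> tbounded (T @` S).
Proof.
move=> tS; apply: (tb_lip (f := id) (M := nm T)); last by rewrite image_id.
by move=> x y _ _; rewrite -bopB nm_op.
Qed.

Lemma tb_dom_ball (K K' : hilbertType R) (W : set (hsum K K')) (r : R) :
  subspace_set W -> tbounded (dom_ball W) ->
  tbounded [set x | exists2 y, W (x, y) & nm x <= r /\ nm y <= r].
Proof.
move=> sW tW; pose r1 := `|r| + 1; have r0 : 0 < r1 by rewrite ltr_wpDl.
have rr1 : r <= r1 by apply: le_trans (ler_norm r) _; rewrite lerDl.
apply: tb_sub (tb_op (r1%:C *: op1 K) tW) => x [y Wxy [xr yr]].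
exists (r1^-1%:C *: x).
  exists (r1^-1%:C *: y); first exact: (subspaceZ r1^-1%:C sW Wxy).
  rewrite !nmZr ger0_norm ?invr_ge0 ?(ltW r0)// ![_^-1 * _]mulrC !ler_pdivrMr// !mul1r.
  by split; [exact: le_trans xr _|exact: le_trans yr _].
by rewrite -[LHS]/(_ *: (_ *: x)) scalerA -rmorphM/= mulfV ?gt_eqF// scale1r.
Qed.

Lemma compact_bounded_below T A : compact_resolvents A ->
  (forall x, T x = 0 -> x = 0) -> bounded_below T (rgraph A).
Proof.
move=> /compact_resolventsP[tA _] inj.
apply: tb_bounded_below tA _; [exact: rgraph_sub|exact: rgraph_closed|].
by move=> x _; exact: inj.
Qed.

Lemma adj_sub A : subspace_set (graph_adj (rgraph A)).
Proof.
split=> [q _|a p q hp hq r Ar]; first by rewrite /= !dot0r.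
by rewrite /= !dotDr !dotZr (hp r Ar) (hq r Ar).
Qed.

Lemma push_adj T T' A B : quasi_affine T T' -> rgraph B = push_graph T (rgraph A) ->
  forall y z, graph_adj (rgraph B) (y, z) -> graph_adj (rgraph A) (y, T' z).
Proof.
move=> [adj _ _] BE y z h q Aq /=; rewrite -adj.
have /h /= -> : rgraph B (T q.1, q.2) by rewrite BE; exists q.1 => //=; rewrite -surjective_pairing.
by [].
Qed.

(** The lower bound on the graph of $A$ bounds the preimages under $T$.  On the side of
   the adjoint, $(y,z)\mapsto(y,T'z)$ maps into the graph of $A^*$. *)
Lemma compact_push T T' A B : quasi_affine T T' ->
  rgraph B = push_graph T (rgraph A) -> compact_resolvents A -> compact_resolvents B.
Proof.
move=> qT BE cA; have [_ inj _] := qT.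
have [c c0 hc] := compact_bounded_below cA inj.
move/compact_resolventsP : cA => [tA tA']; apply/compact_resolventsP; split.
  apply: tb_sub (tb_op T (tb_dom_ball (2 / c + 1) (rgraph_sub A) tA)) => x [y].
  rewrite BE => -[x0 /= Ax0 ->] [x1 y1]; exists x0 => //; exists y => //.
  have := hc _ _ Ax0 => h; split; last by apply: le_trans y1 _; rewrite lerDr divr_ge0 ?(ltW c0).
  apply: le_trans (_ : 2 / c <= _); last by rewrite lerDl.
  by rewrite ler_pdivlMr// mulrC; apply: le_trans h _; lra.
apply: tb_sub (tb_dom_ball (nm T' + 1) (adj_sub A) tA') => y [z Byz [y1 z1]].
exists (T' z); first exact: push_adj BE _ _ Byz.
split; first by apply: le_trans y1 _; rewrite lerDr nm_ge0.
apply: le_trans (nm_op _ _) _; apply: le_trans (_ : nm T' <= _); last by rewrite lerDl.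
by rewrite ler_piMr ?nm_ge0.
Qed.

(** The complement is spanned by the orthogonal components of representatives of the
   finitely many classes. *)
Lemma ran_ortho_finite_dim A : closed (graph_ran (rgraph A)) ->
  finite_codim (graph_ran (rgraph A)) ->
  finite_dim [set y | forall w, graph_ran (rgraph A) w -> '[y, w] = 0].
Proof.
move=> cA [n [e he]].
set W := graph_ran (rgraph A); have sW : subspace_set W by exact: graph_ran_sub.
pose P := orthoproj W.
exists n, (fun i => e i - P (e i)); split=> [i w Ww|y yW].
  exact: (orthoproj_dot sW cA).
have [c hcy] := he y; exists c.
have Py : P y = 0 by apply: (orthoproj_eq sW cA sW.1) => w; rewrite subr0; exact: yW.
have := orthoproj_id sW cA hcy; rewrite -/P bopB Py sub0r.
have -> : P (\sum_(i < n) c i *: e i) = \sum_(i < n) c i *: P (e i).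
  elim/big_ind2 : _ => [|x1 x2 y1 y2 <- <-|i _]; rewrite ?bop0 ?bopD ?bopZ//.
move=> E; have -> : \sum_(i < n) c i *: (e i - P (e i)) = \sum_(i < n) c i *: e i - \sum_(i < n) c i *: P (e i).
  by rewrite -sumrB; apply: eq_bigr => i _; rewrite scalerBr.
by rewrite E addrC subrK.
Qed.

(** A compact [T] makes the resolvents compact: off the finite dimensional kernel
   the values $Ax$ control $x$, so $x$ is bounded and $Tx$ stays in a compact set.  Dually,
   $y$ has a part in the range of $A$, controlled by $A^*y = T'z$, and a part in the
   finite dimensional complement. *)
Lemma fredholm_push_compact T T' A B : quasi_affine T T' ->
  compact_op T -> compact_op T' ->
  rgraph B = push_graph T (rgraph A) -> fredholm A -> compact_resolvents B.
Proof.
move=> qT /compact_opP cT /compact_opP cT' BE [cA fA fcA]; have [_ inj _] := qT.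
have ballr (T0 : bounded_op H H) (r : R) : 0 < r -> tbounded (T0 @` [set x | nm x <= 1]) ->
    tbounded (T0 @` [set x | nm x <= r]).
  move=> r0 t0; apply: tb_sub (tb_op (r%:C *: op1 H) t0) => _ [x /= xr <-].
  exists (T0 (r^-1%:C *: x)).
    exists (r^-1%:C *: x) => //=.
    by rewrite nmZr ger0_norm ?invr_ge0 ?(ltW r0)// mulrC ler_pdivrMr// mul1r.
  by rewrite -[LHS]/(_ *: T0 _) bopZ scalerA -rmorphM/= mulfV ?gt_eqF// scale1r.
have [c c0 hc] := closed_ran_bounded_below cA fA inj.
apply/compact_resolventsP; split.
  apply: tb_sub (ballr T (2 / c) (divr_gt0 (ltr0Sn _ _) c0) cT) => x [y].
  rewrite BE => -[x0 /= Ax0 ->] [x1 y1]; exists x0 => //=.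
  by rewrite ler_pdivlMr// mulrC; apply: le_trans (hc _ _ Ax0) _; lra.
have [C C0 hC] := adj_bounded_below cA.
pose E := [set p : hsum H' H | [/\ graph_adj (rgraph A) p, graph_ran (rgraph A) p.1
  & exists2 z, nm z <= 1 & p.2 = T' z]].
have tE : tbounded ((fun p : hsum H' H => p.1) @` E).
  apply: (tb_lip (f := fun p : hsum H' H => p.2) (M := C)).
    move=> [y1 x1] [y2 x2] [/= a1 r1 _] [/= a2 r2 _]; apply: hC.
      exact: (subspaceB (adj_sub A) a1 a2).
    exact: (subspaceB (graph_ran_sub A) r1 r2).
  apply: tb_sub cT' => _ [[y x] [/= _ _ [z z1 xz]] <-].
  by exists z.
have tF := tb_finite_dim (ran_ortho_finite_dim cA fcA).
apply: tb_sub (tb_minkowski tE tF) => y [z Byz [y1 z1]].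
have Ayz := push_adj qT BE Byz.
have sW := graph_ran_sub A; pose P := orthoproj (graph_ran (rgraph A)).
exists (P y), (y - P y); split; last by rewrite addrC subrK.
  exists (P y, T' z) => //; split=> /=; last by exists z.
    move=> q Aq /=; have /= <- := Ayz q Aq.
    apply/eqP; rewrite -subr_eq0 -dotBr -opprB dotNr oppr_eq0 dotC.
    rewrite (orthoproj_dot sW cA) ?rmorph0//.
    by exists q.1; rewrite -surjective_pairing.
  exact: orthoproj_in.
split; first by move=> w Ww; exact: (orthoproj_dot sW cA).
apply: le_trans y1; apply: sqr_le; first exact: nm_ge0.
by rewrite [leRHS](orthoproj_nm sW cA) lerDr sqr_ge0.
Qed.

End push.

(** * Continuity of precomposition in the graph topology *)

Section push_close.
Context {R : realType} {H H' : hilbertType R}.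
Implicit Types (A B : regular H H') (T : bounded_op H H).

Lemma graph_gap A B (d : R) : 0 <= d ->
  (forall p, rgraph A p -> exists2 q, rgraph B q & nm (p - q) <= d * nm p) ->
  (forall p, rgraph B p -> exists2 q, rgraph A q & nm (p - q) <= d * nm p) ->
  nm (graph_proj A - graph_proj B) <= 2 * d.
Proof. by apply: gap; do ?[exact: rgraph_sub|exact: rgraph_closed]. Qed.

Lemma graph_proj_dist A B p : rgraph A p ->
  nm (p - graph_proj B p) <= nm (graph_proj A - graph_proj B) * nm p.
Proof. by move=> Ap; rewrite -{1}(gproj_id Ap) -opBE nm_op. Qed.

(** The new graphs are the images of the old ones under $T\oplus 1$, and a bound
   from below of $T_0\oplus 1$ turns closeness of the maps into a small gap.  The
   difference $T-T_0$ is only measured on the graph of $A_0$, which for compact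
   resolvents makes strong closeness sufficient. *)
Lemma push_close A0 T0 B0 (M e : R) : rgraph B0 = push_graph T0 (rgraph A0) ->
  bounded_below T0 (rgraph A0) -> 0 <= M -> 0 < e ->
  exists2 d : R, 0 < d & forall A T B, rgraph B = push_graph T (rgraph A) ->
    nm T0 <= M -> nm T <= M -> nm (graph_proj A0 - graph_proj A) <= d ->
    (forall x y, rgraph A0 (x, y) -> nm ((T0 - T) x) <= d * nm ((x, y) : hsum H H')) ->
    nm (graph_proj B0 - graph_proj B) <= e.
Proof.
move=> B0E bT0 M0 e0; have [k k0 kP] := bounded_below_pair bT0.
pose L := k * (M + 2) + 1.
have L0 : 0 < L by rewrite ltr_wpDl// mulr_ge0 ?(ltW k0)// addr_ge0.
pose d := Num.min (2^-1 / L) (e / 4 / L).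
have d0 : 0 < d by rewrite lt_min !divr_gt0 ?invr_gt0.
have dL : d * L <= 2^-1 by rewrite -ler_pdivlMr// ge_min lexx.
have dLe : d * L <= e / 4 by rewrite -ler_pdivlMr// ge_min lexx orbT.
clearbody d; exists d => // A T B BE T0M TM AA T0T.
pose r := d * (M + 2).
have r0 : 0 <= r by rewrite mulr_ge0 ?(ltW d0)// addr_ge0.
have kr : k * r + d = d * L by rewrite /r /L; ring.
have close (a a' : hsum H H') n : rgraph A0 a -> nm a <= n -> nm (a - a') <= d * n ->
    nm (((T0 a.1, a.2) : hsum H H') - (T a'.1, a'.2)) <= r * n.
  move=> Aa an aa'; have := T0T a.1 a.2; rewrite -surjective_pairing => /(_ Aa) h1.
  have h2 : d * nm a <= d * n by rewrite ler_wpM2l ?(ltW d0).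
  have h3 : nm (T (a.1 - a'.1)) <= M * (d * n).
    apply: le_trans (nm_op1 _ TM) _; rewrite ler_wpM2l//.
    by apply: le_trans (nm_fst (a - a')) _.
  have h4 : nm (a.2 - a'.2) <= d * n by apply: le_trans (nm_snd (a - a')) _.
  apply: le_trans (nm_hsum_le _) _ => /=.
  have -> : T0 a.1 - T a'.1 = (T0 - T) a.1 + T (a.1 - a'.1) by rewrite opBE bopB addrA subrK.
  have h5 := nmD ((T0 - T) a.1) (T (a.1 - a'.1)).
  have -> : r * n = d * n + M * (d * n) + d * n by rewrite /r; ring.
  by move: h1 h2 h3 h4 h5; move: (d * n) (M * _) => *; lra.
clearbody r; apply: (@le_trans _ _ (2 * (r * (2 * k)))).
  apply: graph_gap => [|p|p]; first by rewrite mulr_ge0// mulr_ge0// ltW.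
  - rewrite B0E => -[x /= Ax px]; set a : hsum H H' := (x, p.2) in Ax.
    have aa' := le_trans (graph_proj_dist A Ax) (ler_wpM2r (nm_ge0 a) AA).
    exists (T (graph_proj A a).1, (graph_proj A a).2).
      rewrite BE; exists (graph_proj A a).1 => //=.
      by rewrite -surjective_pairing; exact: gproj_in.
    have pE : p = (T0 a.1, a.2) by rewrite [p]surjective_pairing px.
    rewrite {1}pE; apply: le_trans (close _ _ _ Ax (lexx _) aa') _.
    rewrite -mulrA ler_wpM2l//; apply: le_trans (kP _ _ Ax) _; rewrite -/a -pE -mulrA.
    by rewrite ler_peMl ?ler1n// mulr_ge0 ?nm_ge0 ?ltW.
  - rewrite BE => -[x /= Ax px]; set a : hsum H H' := (x, p.2) in Ax.
    have aa' : nm (graph_proj A0 a - a) <= d * nm a.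
      rewrite nm_sub; apply: le_trans (graph_proj_dist A0 Ax) _.
      by rewrite ler_wpM2r ?nm_ge0// nm_sub.
    set a' := graph_proj A0 a in aa'; have Aa' : rgraph A0 a' by exact: gproj_in.
    exists (T0 a'.1, a'.2).
      by rewrite B0E; exists a'.1 => //=; rewrite -surjective_pairing.
    have pE : p = (T a.1, a.2) by rewrite [p]surjective_pairing px.
    have h := close _ _ _ Aa' (gproj_le A0 a) aa'.
    rewrite -pE nm_sub in h; apply: (le_trans h); rewrite -mulrA ler_wpM2l//.
    have := kP a'.1 a'.2; rewrite -surjective_pairing => /(_ Aa') h1.
    have h2 := ler_wpM2l (ltW k0) (nm_ge ((T0 a'.1, a'.2) : hsum H H') p).
    have h3 := nm_ge a a'; have h4 := ler_wpM2r (nm_ge0 a) dL.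
    have h5 := ler_wpM2l (ltW k0) h; rewrite -kr mulrDl in h4; rewrite mulrDr (nm_sub _ p) in h2.
    rewrite mulrA in h5; rewrite nm_sub in aa'.
    by move: h1 h2 h3 h4 h5 aa'; move: (k * r * _) (d * nm a) => *; lra.
move: dLe kr (ltW d0); move: (d * L) => u; have -> : 2 * (r * (2 * k)) = 4 * (k * r) by ring.
by move: (k * r) => *; lra.
Qed.

End push_close.

Section continuity.
Context {R : realType} {H H' : hilbertType R}.

Lemma continuous_initialP (Y : choiceType) (V : normedModType R[i]) (w : Y -> V)
    (X : topologicalType) (f : X -> initial_topology w) : continuous f <->
  forall (x0 : X) (e : R), 0 < e -> \forall x \near x0, nm (w (f x0) - w (f x)) < e.
Proof.
split=> [cf x0 e e0|h].
  have : continuous (w \o f).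
    move=> x; apply: continuous_comp; first exact: cf.
    exact: (@initial_continuous _ _ w).
  by move=> /(_ x0) /cvg_nmP; apply.
by apply: continuous_comp_initial => x; apply/cvg_nmP => e e0; exact: h.
Qed.

Lemma continuous_graphP (X : topologicalType) (f : X -> graph_top H H') :
  continuous f <-> forall (x0 : X) (e : R), 0 < e ->
    \forall x \near x0, nm (graph_proj (f x0) - graph_proj (f x)) < e.
Proof. exact: (@continuous_initialP _ _ (@graph_proj R H H')). Qed.

Lemma continuous_rieszP (X : topologicalType) (f : X -> riesz_top H H') :
  continuous f <-> forall (x0 : X) (e : R), 0 < e ->
    \forall x \near x0, nm (riesz_map (f x0) - riesz_map (f x)) < e.
Proof. exact: (@continuous_initialP _ _ (@riesz_map R H H')). Qed.

Lemma push_continuous (X : topologicalType) (lam f : X -> graph_top H H')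
    (T : X -> bounded_op H H) (M : R) : continuous lam -> 0 <= M ->
  (forall x, nm (T x) <= M) ->
  (forall x, bounded_below (T x) (rgraph (lam x))) ->
  (forall x, rgraph (f x) = push_graph (T x) (rgraph (lam x))) ->
  (forall x0 (e : R), 0 < e -> \forall x \near x0, forall a b,
     rgraph (lam x0) (a, b) -> nm ((T x0 - T x) a) <= e * nm ((a, b) : hsum H H')) ->
  continuous f.
Proof.
move=> /continuous_graphP cl M0 TM bT fE hT; apply/continuous_graphP => x0 e e0.
have e20 : 0 < e / 2 by rewrite divr_gt0.
have [d d0 hd] := push_close (fE x0) (bT x0) M0 e20.
apply: filterS (filterI (cl x0 d d0) (hT x0 d d0)) => x [lx Tx].
apply: le_lt_trans (_ : e / 2 < e); last by lra.
by apply: hd (fE x) (TM x0) (TM x) (ltW lx) Tx.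
Qed.

(** Under a uniform bound pointwise convergence is uniform on totally bounded sets. *)
Lemma strong_uniform (X : topologicalType) (x0 : X) (T : X -> bounded_op H H) (M : R)
    (G : set (hsum H H')) : subspace_set G -> tbounded (dom_ball G) ->
  0 <= M -> (forall x, nm (T x) <= M) ->
  (forall a (e : R), 0 < e -> \forall x \near x0, nm (T x0 a - T x a) < e) ->
  forall e : R, 0 < e -> \forall x \near x0, forall a b, G (a, b) ->
    nm ((T x0 - T x) a) <= e * nm ((a, b) : hsum H H').
Proof.
move=> sG tG M0 TM hT e e0.
pose d := e / 2 / (2 * M + 1).
have M1 : 0 < 2 * M + 1 by rewrite ltr_wpDl// mulr_ge0.
have e20 : 0 < e / 2 by rewrite divr_gt0.
have d0 : 0 < d by rewrite divr_gt0.
have [s hs] := tG d d0.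
have : \forall x \near x0, forall y, y \in s -> nm (T x0 y - T x y) < e / 2.
  elim: {hs} s => [|y s IH]; first by apply: filterE => x y; rewrite in_nil.
  apply: filterS (filterI (hT y (e / 2) e20) IH) => x [hy hsx] z.
  by rewrite inE => /orP[/eqP ->|/hsx].
apply: filterS => x hx a b Gab; set n := nm ((a, b) : hsum H H').
have [n0|n0] := eqVneq n 0.
  rewrite n0 mulr0; have -> : a = 0 by apply: nm_le0; rewrite -n0; exact: (nm_fst ((a, b) : hsum H H')).
  by rewrite bop0 nm0.
have np : 0 < n by rewrite lt_neqAle eq_sym n0 nm_ge0.
have [|y ys ay] := hs (n^-1%:C *: a).
  exists (n^-1%:C *: b); first exact: (subspaceZ n^-1%:C sG Gab).
  rewrite !nmZr ger0_norm ?invr_ge0 ?(ltW np)// ![_^-1 * _]mulrC !ler_pdivrMr// !mul1r.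
  by split; [exact: (nm_fst ((a, b) : hsum H H'))|exact: (nm_snd ((a, b) : hsum H H'))].
have aE : (T x0 - T x) a = n%:C *: (T x0 - T x) (n^-1%:C *: a).
  by rewrite bopZ scalerA -rmorphM/= mulfV// scale1r.
rewrite aE nmZr ger0_norm ?(ltW np)// mulrC ler_pM2r//.
have -> : (T x0 - T x) (n^-1%:C *: a) = (T x0 - T x) (n^-1%:C *: a - y) + (T x0 y - T x y).
  by rewrite bopB subrK.
apply: le_trans (nmD _ _) _; rewrite [e]splitr; apply: lerD; last by apply/ltW/hx.
have TT : nm (T x0 - T x) <= 2 * M.
  by apply: le_trans (nmB _ _) _; have := TM x0; have := TM x; lra.
apply: le_trans (nm_op1 _ TT) _.
apply: le_trans (_ : (2 * M + 1) * d <= _); last by rewrite mulrC divfK// gt_eqF.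
apply: ler_pM; rewrite ?nm_ge0 ?mulr_ge0 ?lerDl//; exact: ltW.
Qed.

End continuity.

(** * Square roots of positive operators *)

Section positive_operators.
Context {R : realType} {H : hilbertType R}.
Implicit Types S T X : bounded_op H H.

Definition selfadj T := forall x y, '[T x, y] = '[x, T y].
Definition positive T := forall x, 0 <= '[T x, x].

(** Polarization: over the complex numbers an operator with a real quadratic form is
   self-adjoint. *)
Lemma positiveP T : positive T <-> selfadj T /\ forall x, 0 <= rdot (T x) x.
Proof.
split=> [pT|[sT rT] x]; last first.
  have : '[T x, x] = (rdot (T x) x)%:C.
    by rewrite /rdot RRe_real//; apply/CrealP; rewrite -dotC sT.
  by move=> ->; rewrite -[0]/(0%:C) lecR.
split=> [|x]; last first.
  by have := pT x; rewrite lecE/= => /andP[_].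
have im0 x : complex.Im '[T x, x] = 0.
  by have := pT x; rewrite lecE/= => /andP[/eqP ->].
have dx x : '[T x, x] = '[x, T x].
  rewrite [RHS]dotC; have := im0 x; case: '[T x, x] => a b /= ->.
  by apply/eqP; rewrite eq_complex/= oppr0 !eqxx.
move=> x y.
have h1 := dx (x + y); have h2 := dx (x + 'i%C *: y).
have i0 : ('i%C : R[i]) != 0 by rewrite eq_complex/= oner_eq0 andbF.
have ic : (('i%C : R[i])^*)%R = - 'i%C.
  by apply/eqP; rewrite eq_complex/= oppr0 !eqxx.
rewrite !bopD !dot_expand !dx in h1; rewrite !bopD !bopZ !dot_expand !dx ic in h2.
have e1 : '[T x, y] - '[x, T y] = '[y, T x] - '[T y, x].
  apply/eqP; rewrite -subr_eq0; apply/eqP; move: h1 => /eqP; rewrite -subr_eq0 => /eqP <-.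
  ring.
have e2 : 'i%C * ('[T x, y] - '[x, T y]) = - ('i%C * ('[y, T x] - '[T y, x])).
  apply/eqP; rewrite -subr_eq0; apply/eqP; move: h2 => /eqP; rewrite -subr_eq0 => /eqP h2.
  by rewrite -[RHS]oppr0 -h2; ring.
apply/eqP; rewrite -subr_eq0; apply/eqP.
have : 'i%C * (2 * ('[T x, y] - '[x, T y])) = 0.
  rewrite mulrDl !mul1r mulrDr; rewrite {1}e2 -e1 addNr//.
move=> /eqP; rewrite !mulf_eq0 (negPf i0)/= pnatr_eq0/= => /eqP ->//.
Qed.

(** The Cauchy--Schwarz argument for a degenerate form. *)
Lemma positive_ker T x : positive T -> rdot (T x) x = 0 -> T x = 0.
Proof.
move=> /positiveP[sT rT] h; apply: nm_eq0; apply/eqP; rewrite -sqrf_eq0 -rdot_nm; apply/eqP.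
apply: (@linear_coef_eq0 R _ (rdot (T (T x)) (T x))); first exact: rT.
move=> t; have := rT (x + t%:C *: T x).
rewrite bopD bopZ !rdotE h add0r.
have -> : rdot (T (T x)) x = rdot (T x) (T x) by rewrite /rdot sT.
by move: (rdot _ (T x)) (rdot (T (T x)) _) => a b; lra.
Qed.

(** With $a=Sx-S'x$, commutation gives $Sa=-S'a$; by positivity both sides vanish, and
   then so does $\|a\|^2$. *)
Lemma sqrt_unique S S' : positive S -> positive S' ->
  (forall x, S (S x) = S' (S' x)) -> (forall x, S (S' x) = S' (S x)) -> S = S'.
Proof.
move=> pS pS' SS com; apply: bop_inj => x.
have [sS rS] := (positiveP S).1 pS; have [sS' rS'] := (positiveP S').1 pS'.
set a := S x - S' x.
have Sa : S a = - S' a.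
  by rewrite /a !bopB SS com opprB.
have h : rdot (S a) a = 0.
  apply/eqP; rewrite eq_le rS andbT Sa rdotNl oppr_le0; exact: rS'.
have Sa0 := positive_ker pS h.
have S'a0 : S' a = 0 by apply/eqP; rewrite -oppr_eq0 -Sa Sa0.
apply/eqP; rewrite -subr_eq0 -/a; apply/eqP/nm_eq0/eqP; rewrite -sqrf_eq0 -rdot_nm; apply/eqP.
rewrite {1}/a rdotBl /rdot sS sS' Sa0 S'a0 !dot0r; exact: subrr.
Qed.

End positive_operators.

(** The iteration $Y_{n+1} = (X + Y_n^2)/2$ converges in norm to $1-\sqrt{1-X}$
   for $\|X\|\le 1$, dominated by the same scalar iteration with $X = 1$; hence
   uniformly in $X$, so that the square root is norm continuous. *)
Section square_root.
Context {R : realType} {H : hilbertType R}.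
Implicit Types X Y S T V : bounded_op H H.

Fixpoint sqrt_iter X n : bounded_op H H :=
  if n is m.+1 then (2^-1 : R)%:C *: (X + bop_comp (sqrt_iter X m) (sqrt_iter X m)) else 0.

Fixpoint sqrt_major n : R :=
  if n is m.+1 then 2^-1 * (1 + sqrt_major m ^+ 2) else 0.

Lemma sqrt_iterE X n x :
  sqrt_iter X n.+1 x = (2^-1 : R)%:C *: (X x + sqrt_iter X n (sqrt_iter X n x)).
Proof. by []. Qed.

(** The defect $w=1-y$ follows $w\mapsto w-w^2/2$, which stays below $2/(n+2)$. *)
Lemma sqrt_major_bounds n : [/\ 0 <= sqrt_major n, sqrt_major n <= 1 &
  (1 - sqrt_major n) * (n%:R + 2) <= 2].
Proof.
elim: n => [|n [y0 y1 yn]] /=; first by split; lra.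
have y2 : sqrt_major n ^+ 2 <= 1 by rewrite expr_le1.
have y20 := sqr_ge0 (sqrt_major n); split; [lra|lra|rewrite -[n.+1%:R]natr1].
have n0 : 0 <= n%:R :> R by [].
move: n0 y0 y1 yn {y2 y20}; move: (n%:R) (sqrt_major n) => m y m0 y0 y1 h.
have h1 : 0 <= (2 - (1 - y) * (m + 2)) * (1 + y) by rewrite mulr_ge0//; lra.
have h2 := sqr_ge0 (1 - y).
have -> : (1 - 2^-1 * (1 + y ^+ 2)) * (m + 1 + 2) =
  2 - 2^-1 * ((2 - (1 - y) * (m + 2)) * (1 + y)) - 2^-1 * (1 - y) ^+ 2 by field.
lra.
Qed.

Lemma sqrt_major_ge0 n : 0 <= sqrt_major n. Proof. by have [] := sqrt_major_bounds n. Qed.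
Lemma sqrt_major_le1 n : sqrt_major n <= 1. Proof. by have [] := sqrt_major_bounds n. Qed.

Lemma nm_sqrt_iter X n : nm X <= 1 -> nm (sqrt_iter X n) <= sqrt_major n.
Proof.
move=> X1; elim: n => [|n IH] /=; first by rewrite nm0.
rewrite nmZr ger0_norm ?invr_ge0// ler_wpM2l ?invr_ge0//.
apply: le_trans (nmD _ _) _; apply: lerD => //.
apply: le_trans (nm_comp _ _) _; rewrite expr2.
by apply: ler_pM; rewrite ?nm_ge0.
Qed.

Lemma iter_sqr_diff (Y Y' : bounded_op H H) : bop_comp Y Y - bop_comp Y' Y' =
  bop_comp Y (Y - Y') + bop_comp (Y - Y') Y'.
Proof.
apply: bop_inj => x; rewrite opBE opDE -[bop_comp Y (Y - Y') x]/(Y (Y x - Y' x)).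
rewrite -[bop_comp (Y - Y') Y' x]/(Y (Y' x) - Y' (Y' x)) bopB addrA subrK.
by [].
Qed.

Lemma nm_sqr_diff (Y Y' : bounded_op H H) (r r' d : R) : nm Y <= r -> nm Y' <= r' ->
  nm (Y - Y') <= d -> nm (bop_comp Y Y - bop_comp Y' Y') <= (r + r') * d.
Proof.
move=> Yr Yr' d0; rewrite iter_sqr_diff mulrDl; apply: le_trans (nmD _ _) _.
apply: lerD; apply: le_trans (nm_comp _ _) _; first by apply: ler_pM; rewrite ?nm_ge0.
by rewrite mulrC; apply: ler_pM; rewrite ?nm_ge0.
Qed.

Lemma nm_sqrt_iter_step X n : nm X <= 1 ->
  nm (sqrt_iter X n.+1 - sqrt_iter X n) <= sqrt_major n.+1 - sqrt_major n.
Proof.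
move=> X1; elim: n => [|n IH]; first by rewrite !subr0; exact: nm_sqrt_iter.
have -> : sqrt_iter X n.+2 - sqrt_iter X n.+1 = (2^-1 : R)%:C *:
    (bop_comp (sqrt_iter X n.+1) (sqrt_iter X n.+1) - bop_comp (sqrt_iter X n) (sqrt_iter X n)).
  by rewrite -scalerBr opprD addrACA subrr add0r.
have h := nm_sqr_diff (nm_sqrt_iter n.+1 X1) (nm_sqrt_iter n X1) IH.
rewrite nmZr ger0_norm ?invr_ge0//.
apply: le_trans (ler_wpM2l _ h) _; first by rewrite invr_ge0.
have e2 : sqrt_major n.+2 = 2^-1 * (1 + sqrt_major n.+1 ^+ 2) by [].
have e1 : sqrt_major n.+1 = 2^-1 * (1 + sqrt_major n ^+ 2) by [].
rewrite e2; move: e1; move: (sqrt_major n.+1) (sqrt_major n) => y z e1.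
have -> : 2^-1 * (1 + y ^+ 2) - y = 2^-1 * ((y + z) * (y - z)) + (2^-1 * (1 + z ^+ 2) - y) by ring.
by rewrite -e1 subrr addr0.
Qed.

Lemma sqrt_iter_cauchy X m n : nm X <= 1 -> (n <= m)%N ->
  nm (sqrt_iter X m - sqrt_iter X n) <= 2 / n.+1%:R.
Proof.
move=> X1 nm_; apply: le_trans (_ : sqrt_major m - sqrt_major n <= _); last first.
  have [_ h1 h2] := sqrt_major_bounds n; have h3 := sqrt_major_le1 m.
  rewrite ler_pdivlMr// -[n.+1%:R]natr1; apply: le_trans h2.
  apply: le_trans (_ : (1 - sqrt_major n) * (n%:R + 1) <= _).
    by rewrite ler_wpM2r ?addr_ge0// lerB.
  by rewrite ler_wpM2l ?subr_ge0// lerD2l; lra.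
elim: m nm_ => [|m IH]; first by rewrite leqn0 => /eqP ->; rewrite !subrr nm0.
rewrite leq_eqVlt => /orP[/eqP ->|]; first by rewrite !subrr nm0.
rewrite ltnS => /IH {}IH; apply: le_trans (nm_tri (sqrt_iter X m) _ _) _.
by apply: le_trans (lerD (nm_sqrt_iter_step m X1) IH) _; rewrite addrA subrK.
Qed.

Lemma div_nat_lt (c e : R) : 0 <= c -> 0 < e -> exists N : nat, forall n, (N <= n)%N ->
  c / n.+1%:R < e.
Proof.
move=> c0 e0; have c1 : 0 < c + 1 by rewrite ltr_wpDl.
have [N hN] := inv_nat_lt (divr_gt0 e0 c1); exists N => n /hN.
rewrite ltr_pdivlMr//; apply: le_lt_trans; rewrite mulrC ler_wpM2l ?invr_ge0// lerDl//.
Qed.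

Definition sqrt_lim X : bounded_op H H :=
  get [set Y | forall n, nm (Y - sqrt_iter X n) <= 2 / n.+1%:R].

(** This is $\sqrt{1-X}$. *)
Definition sqrt1m X : bounded_op H H := op1 H - sqrt_lim X.

Section fix_X.
Variable X : bounded_op H H.
Hypothesis X1 : nm X <= 1.

Lemma sqrt_limP n : nm (sqrt_lim X - sqrt_iter X n) <= 2 / n.+1%:R.
Proof.
have [|m k|Y hY] := @op_seq_lim _ H H (sqrt_iter X) (fun n => 2 / n.+1%:R).
- by move=> e e0; exact: div_nat_lt.
- by move=> km; exact: sqrt_iter_cauchy.
exact: (getPex (ex_intro [set Y | forall n, nm (Y - sqrt_iter X n) <= 2 / n.+1%:R] Y hY)).
Qed.

Lemma nm_sqrt_lim : nm (sqrt_lim X) <= 1.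
Proof.
apply/ler_addgt0Pr => e e0; have [N hN] := div_nat_lt (ler0n R 2) e0.
apply: le_trans (nm_ge _ (sqrt_iter X N)) _; apply: lerD.
  by apply: le_trans (nm_sqrt_iter N X1) _; exact: sqrt_major_le1.
by apply: le_trans (sqrt_limP N) _; apply/ltW/hN.
Qed.

Lemma sqrt_lim_eq x :
  sqrt_lim X x = (2^-1 : R)%:C *: (X x + sqrt_lim X (sqrt_lim X x)).
Proof.
suff E : sqrt_lim X = (2^-1 : R)%:C *: (X + bop_comp (sqrt_lim X) (sqrt_lim X)) by rewrite [in LHS]E.
apply: nm_close => e e0.
have e20 : 0 < e / 2 by rewrite divr_gt0.
have [N hN] := div_nat_lt (ler0n R 2) e20.
apply: le_trans (nm_tri (sqrt_iter X N.+1) _ _) _; rewrite [e]splitr; apply: lerD.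
  by apply: le_trans (sqrt_limP _) _; apply/ltW/hN.
rewrite /= -scalerBr opprD addrACA subrr add0r nmZr ger0_norm ?invr_ge0//.
have hd : nm (sqrt_iter X N - sqrt_lim X) <= 2 / N.+1%:R by rewrite nm_sub sqrt_limP.
have h := nm_sqr_diff (nm_sqrt_iter N X1) nm_sqrt_lim hd.
have := sqrt_major_le1 N; have := hN N (leqnn _); have := sqrt_major_ge0 N => y0 hh y1.
have h0 : 0 <= 2 / N.+1%:R :> R by rewrite divr_ge0.
move: h h0 hh; set k := 2 / N.+1%:R => h h0 hh.
have : (sqrt_major N + 1) * k <= 2 * k by rewrite ler_wpM2r//; lra.
by lra.
Qed.

Lemma sqrt1m_sqr x : sqrt1m X (sqrt1m X x) = x - X x.
Proof.
rewrite /sqrt1m !opBE !op1E bopB.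
have := sqrt_lim_eq x; move: (sqrt_lim X (sqrt_lim X x)) => u; move: (sqrt_lim X x) => w E.
have -> : u = w + w - X x.
  rewrite {1 2}E; apply: dot_inj => z.
  by rewrite !dot_expand fmorphV/= rmorph_nat; field.
by apply: dot_inj => z; rewrite !dot_expand; ring.
Qed.

Lemma sqrt_iter_comm V n : (forall x, V (X x) = X (V x)) ->
  forall x, V (sqrt_iter X n x) = sqrt_iter X n (V x).
Proof.
move=> VX; elim: n => [|n IH] x; first by rewrite !op0E bop0.
by rewrite !sqrt_iterE bopZ bopD VX !IH.
Qed.

Lemma op_small (K : hilbertType R) (v : K) :
  (exists2 c : R, 0 <= c & forall n, nm v <= c / (n : nat).+1%:R) -> v = 0.
Proof.
move=> [c c0 h]; apply: nm_small => e e0.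
by have [N hN] := div_nat_lt c0 e0; apply: le_trans (h N) _; apply/ltW/hN.
Qed.

Lemma sqrt1m_comm V : (forall x, V (X x) = X (V x)) ->
  forall x, V (sqrt1m X x) = sqrt1m X (V x).
Proof.
move=> VX x; rewrite /sqrt1m !opBE !op1E bopB; congr (_ - _).
apply/eqP; rewrite -subr_eq0; apply/eqP/op_small.
exists (nm V * nm x * 2 + 2 * nm (V x)); first by rewrite addr_ge0 ?mulr_ge0 ?nm_ge0.
move=> n; have -> : V (sqrt_lim X x) - sqrt_lim X (V x) =
   V ((sqrt_lim X - sqrt_iter X n) x) - (sqrt_lim X - sqrt_iter X n) (V x).
  rewrite !opBE bopB (sqrt_iter_comm n VX).
  by rewrite opprB addrA subrK.
apply: le_trans (nmB _ _) _.
have h1 := nm_op1 x (sqrt_limP n); have h2 := nm_op1 (V x) (sqrt_limP n).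
have h3 := nm_op V ((sqrt_lim X - sqrt_iter X n) x).
have h4 : nm V * nm ((sqrt_lim X - sqrt_iter X n) x) <= nm V * (2 / n.+1%:R * nm x).
  by rewrite ler_wpM2l ?nm_ge0.
have -> : (nm V * nm x * 2 + 2 * nm (V x)) / n.+1%:R = nm V * (2 / n.+1%:R * nm x) + 2 / n.+1%:R * nm (V x).
  by move: (_.+1%:R^-1) => k; ring.
by apply: lerD => //; exact: le_trans h3 h4.
Qed.

Lemma sqrt_iter_selfadj n : selfadj X -> selfadj (sqrt_iter X n).
Proof.
move=> sX; elim: n => [|n IH] x y; first by rewrite !op0E dot0l dot0r.
by rewrite !sqrt_iterE !dot_expand sX !IH.
Qed.

Lemma sqrt1m_positive : selfadj X -> positive (sqrt1m X).
Proof.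
move=> sX; apply/positiveP.
have sY : selfadj (sqrt_lim X).
  move=> x y; apply/eqP; rewrite -subr_eq0; apply/eqP/cm_small => e e0.
  have c0 : 0 <= 4 * (nm x * nm y) by rewrite !mulr_ge0 ?nm_ge0.
  have [N hN] := div_nat_lt c0 e0; apply: le_trans (ltW (hN N (leqnn _))).
  have -> : '[sqrt_lim X x, y] - '[x, sqrt_lim X y] =
     '[(sqrt_lim X - sqrt_iter X N) x, y] - '[x, (sqrt_lim X - sqrt_iter X N) y].
    by rewrite !opBE !dot_expand (sqrt_iter_selfadj N sX); ring.
  apply: le_trans (cmD _ _) _; rewrite cmN.
  have h1 := cm_dot ((sqrt_lim X - sqrt_iter X N) x) y.
  have h2 := cm_dot x ((sqrt_lim X - sqrt_iter X N) y).
  have h3 := ler_wpM2r (nm_ge0 y) (nm_op1 x (sqrt_limP N)).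
  have h4 := ler_wpM2l (nm_ge0 x) (nm_op1 y (sqrt_limP N)).
  have -> : 4 * (nm x * nm y) / N.+1%:R = 2 / N.+1%:R * nm x * nm y + nm x * (2 / N.+1%:R * nm y).
    by move: (_.+1%:R^-1) => k; ring.
  by apply: lerD; [exact: le_trans h1 h3|exact: le_trans h2 h4].
split=> [x y|x]; first by rewrite /sqrt1m !opBE !op1E dotBl dotBr sY.
rewrite /sqrt1m opBE op1E rdotBl subr_ge0; apply: le_trans (rdot_le _ _) _.
by rewrite rdot_nm expr2 ler_wpM2r ?nm_ge0//; apply: le_trans (nm_op1 x nm_sqrt_lim) _; rewrite mul1r.
Qed.

End fix_X.

Lemma sqrt_iter_lip X X' n : nm X <= 1 -> nm X' <= 1 ->
  nm (sqrt_iter X n - sqrt_iter X' n) <= n%:R * nm (X - X').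
Proof.
move=> X1 X1'; elim: n => [|n IH]; first by rewrite subrr nm0 mul0r.
have -> : sqrt_iter X n.+1 - sqrt_iter X' n.+1 = (2^-1 : R)%:C *: ((X - X') +
    (bop_comp (sqrt_iter X n) (sqrt_iter X n) - bop_comp (sqrt_iter X' n) (sqrt_iter X' n))).
  by rewrite /= -scalerBr opprD addrACA.
rewrite nmZr ger0_norm ?invr_ge0//.
have h := nm_sqr_diff (nm_sqrt_iter n X1) (nm_sqrt_iter n X1') IH.
have h1 := nmD (X - X') (bop_comp (sqrt_iter X n) (sqrt_iter X n) - bop_comp (sqrt_iter X' n) (sqrt_iter X' n)).
have h2 : (sqrt_major n + sqrt_major n) * (n%:R * nm (X - X')) <= 2 * (n%:R * nm (X - X')).
  by rewrite ler_wpM2r ?mulr_ge0 ?nm_ge0//; have := sqrt_major_le1 n; lra.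
have h3 : n.+1%:R * nm (X - X') = n%:R * nm (X - X') + nm (X - X') by rewrite -natr1 mulrDl mul1r.
have h4 := nm_ge0 (X - X'); rewrite h3; lra.
Qed.

(** Both square roots are within $2/(n+1)$ of their $n$-th iterates, which are
   Lipschitz in $X$ with constant $n$. *)
Lemma sqrt1m_close X X' n : nm X <= 1 -> nm X' <= 1 ->
  nm (sqrt1m X - sqrt1m X') <= 4 / n.+1%:R + n%:R * nm (X - X').
Proof.
move=> X1 X1'.
have -> : sqrt1m X - sqrt1m X' = sqrt_lim X' - sqrt_lim X.
  by rewrite /sqrt1m opprB addrC addrA subrK.
apply: le_trans (nm_tri (sqrt_iter X' n) _ _) _.
have h1 := sqrt_limP X1' n; have h2 := sqrt_limP X1 n.
have h3 := nm_tri (sqrt_iter X n) (sqrt_iter X' n) (sqrt_lim X).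
have h4 := sqrt_iter_lip n X1 X1'.
rewrite (nm_sub (sqrt_iter X' n) (sqrt_iter X n)) (nm_sub (sqrt_iter X n) (sqrt_lim X)) in h3.
have -> : 4 / n.+1%:R = 2 / n.+1%:R + 2 / n.+1%:R :> R by rewrite -mulrDl; congr (_ / _); ring.
by move: h1 h2 h3 h4; move: (2 / n.+1%:R) (n%:R * _) => *; lra.
Qed.

(** A positive square root of $1-X$ commutes with $X$, hence with [sqrt1m X]. *)
Lemma sqrt1m_unique X S : nm X <= 1 -> selfadj X -> positive S ->
  (forall x, S (S x) = x - X x) -> S = sqrt1m X.
Proof.
move=> X1 sX pS SS; apply: sqrt_unique pS (sqrt1m_positive X1 sX) _ _ => x.
  by rewrite SS (sqrt1m_sqr X1).
apply: (sqrt1m_comm X1) => y.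
have XE z : X z = z - S (S z) by rewrite SS subKr.
by rewrite !XE bopB.
Qed.

Lemma bop_sqrtP X T : nm X <= 1 -> selfadj X -> (forall x, T x = x - X x) ->
  bop_sqrt T = sqrt1m X.
Proof.
move=> X1 sX TX; have [p2 s2] := getPex (ex_intro [set S : bounded_op H H |
    (forall x, 0 <= '[S x, x]) /\ forall x, S (S x) = T x] (sqrt1m X)
    (conj (sqrt1m_positive X1 sX) (fun x => etrans (sqrt1m_sqr X1 x) (esym (TX x))))).
by apply: sqrt1m_unique => // x; rewrite -TX; exact: s2.
Qed.

End square_root.

(** * The Riesz map *)

Section isometries.
Context {R : realType}.
Implicit Types H K : hilbertType R.

Lemma isometry_dot H K (V : bounded_op H K) : (forall z, nm (V z) = nm z) ->
  forall x y, '[V x, V y] = '[x, y].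
Proof.
move=> Vn x y.
have r u w : rdot (V u) (V w) = rdot u w.
  have := Vn (u + w); rewrite bopD => /(congr1 (fun r => r ^+ 2)).
  by rewrite !nm_sqrD !Vn => h; lra.
have h1 := r x y; have h2 := r x ('i%C *: y); move: h1 h2.
rewrite bopZ /rdot !dotZr; case: '[V x, V y] => a b; case: '[x, y] => c d /=.
rewrite !mul0r !sub0r !mulN1r !opprK => -> ->//.
Qed.

Lemma isometry_closed H K (V : bounded_op H K) : (forall z, nm (V z) = nm z) ->
  closed (range V).
Proof.
move=> Vn; apply: (closed_image (@subspaceT _ H) closedT ler01) => x _.
by rewrite mul1r Vn.
Qed.

End isometries.

Section polar.
Context {R : realType} {H H' : hilbertType R}.
Implicit Types (A B : regular H H') (s : bounded_op H H) (a : bounded_op H H').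

(** [s] and [a] model $(1+A^*A)^{-1/2}$ and $\chi(A)=A(1+A^*A)^{-1/2}$, which together
   form an isometry from [H] onto the graph of $A$. *)
Definition bounded_pair s a := [/\ positive s, forall x, s x = 0 -> x = 0 &
  forall z, nm (s z) ^+ 2 + nm (a z) ^+ 2 = nm z ^+ 2].

Definition pair_graph s a : set (hsum H H') := [set p | exists z, p = (s z, a z)].

Lemma pair_op s a : exists V : bounded_op H (hsum H H'), forall z, V z = (s z, a z).
Proof.
have lf : linear (fun z => (s z, a z) : hsum H H').
  by move=> b x y; rewrite !bop_linear.
have [|V VE] := op_exists (M := nm s + nm a) lf; last by exists V.
by move=> x; rewrite mulrDl; apply: nm_pair_le; exact: nm_op.
Qed.

Lemma pair_isometry s a z : bounded_pair s a -> nm ((s z, a z) : hsum H H') = nm z.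
Proof.
move=> [_ _ n]; apply/eqP; rewrite -(@eqrXn2 _ 2%N) ?nm_ge0//.
by rewrite nm_hsum n.
Qed.

Lemma pair_dot s a x y : bounded_pair s a -> '[s x, s y] + '[a x, a y] = '[x, y].
Proof.
move=> sa; have [V VE] := pair_op s a.
have Vn z : nm (V z) = nm z by rewrite VE; exact: pair_isometry.
by rewrite -(isometry_dot Vn x y) !VE.
Qed.

Lemma positive_dense s : positive s -> (forall x, s x = 0 -> x = 0) -> dense (range s).
Proof.
move=> ps inj; have [ss _] := (positiveP s).1 ps; apply: ortho_dense.
  by apply: subspace_image; exact: subspaceT.
move=> x h; apply: inj; apply: dot_inj => z; rewrite dot0l ss; apply: h.
by exists z.
Qed.

Lemma resolvent_sym A : selfadj (resolvent A).
Proof.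
move=> x y; rewrite !resolventE.
have := orthoproj_sym (rgraph_sub A) (@rgraph_closed _ _ _ A) (x, 0) (y, 0).
by rewrite !hsum_dotP /= dot0r dot0l !addr0.
Qed.

(** The resolvent is written as $1-X$ with $\|X\|\le 1$, the form to which the square
   root construction applies. *)
Definition res_compl A : bounded_op H H := op1 H - resolvent A.

Lemma resolvent_compl A x : resolvent A x = x - res_compl A x.
Proof. by rewrite /res_compl opBE op1E subKr. Qed.

Lemma nm_res_compl A : nm (res_compl A) <= 1.
Proof.
apply: nm_op_le => // x; rewrite mul1r /res_compl opBE op1E resolventE.
apply: le_trans (nm_fst (((x, 0) : hsum H H') - graph_proj A (x, 0))) _.
apply: sqr_le; first exact: nm_ge0.
by rewrite -(nm_inl (H' := H') x) (gproj_nm A (x, 0)) lerDr sqr_ge0.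
Qed.

Lemma res_compl_sym A : selfadj (res_compl A).
Proof. by move=> x y; rewrite /res_compl !opBE !op1E dotBl dotBr resolvent_sym. Qed.

Lemma resolvent_inj A x : resolvent A x = 0 -> x = 0.
Proof.
rewrite resolventE => h; apply: (@dom_ortho _ _ _ A) => q Aq.
have P0 : graph_proj A (x, 0) = 0.
  have := gproj_in A (x, 0); rewrite [graph_proj A _]surjective_pairing h.
  by move=> /rgraph_snd_eq0 ->.
have := gproj_dot (x, 0) Aq; rewrite P0 subr0 hsum_dotP/= dot0l addr0//.
Qed.

Definition res_sqrt A := bop_sqrt (resolvent A).

Lemma res_sqrtE A : res_sqrt A = sqrt1m (res_compl A).
Proof. exact: bop_sqrtP (nm_res_compl A) (res_compl_sym A) (resolvent_compl A). Qed.

Lemma res_sqrt_sqr A x : res_sqrt A (res_sqrt A x) = resolvent A x.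
Proof. by rewrite res_sqrtE (sqrt1m_sqr (nm_res_compl A)) -resolvent_compl. Qed.

Lemma res_sqrt_pos A : positive (res_sqrt A).
Proof. by rewrite res_sqrtE; apply: sqrt1m_positive; [exact: nm_res_compl|exact: res_compl_sym]. Qed.

Lemma res_sqrt_inj A x : res_sqrt A x = 0 -> x = 0.
Proof. by move=> h; apply: (@resolvent_inj A); rewrite -res_sqrt_sqr h bop0. Qed.

(** For $z = (1+A^*A)^{-1/2}w$ the point is the projection of $(w,0)$ onto the graph,
   which has the norm of $z$.  Such $z$ are dense and the graph is closed. *)
Lemma riesz_exists A z : exists2 y, rgraph A (res_sqrt A z, y) &
  nm (res_sqrt A z) ^+ 2 + nm y ^+ 2 = nm z ^+ 2.
Proof.
have [ss _] := (positiveP _).1 (res_sqrt_pos A).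
set s := res_sqrt A in ss *.
pose q w := graph_proj A (w, 0).
have qn w : nm (q w) = nm (s w).
  apply/eqP; rewrite -(@eqrXn2 _ 2%N) ?nm_ge0//; apply/eqP.
  rewrite /q gproj_nm_dot /rdot hsum_dotP/= dot0r addr0 -resolventE -res_sqrt_sqr ss.
  by rewrite -rdot_nm.
have qB w w' : q w - q w' = q (w - w').
  by rewrite /q -bopB; congr (graph_proj A _); congr pair; rewrite /= subrr.
have q1 w : (q w).1 = s (s w) by rewrite res_sqrt_sqr resolventE.
have /dense_nm sd := positive_dense (res_sqrt_pos A) (@res_sqrt_inj A).
have /choice[w hw] : forall n : nat, exists w, nm (z - s w) < (n.+1%:R)^-1.
  move=> n; have [|_ [w _ <-] h] := sd z (n.+1%:R)^-1; first by rewrite invr_gt0.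
  by exists w.
have [|l hl] := @cauchy_seq_lim _ _ (fun n => q (w n)).
  move=> e e0; have e20 : 0 < e / 2 by rewrite divr_gt0.
  have [N hN] := inv_nat_lt e20; exists N => m n Nm Nn.
  rewrite qB qn bopB; apply: le_lt_trans (nm_tri z _ _) _; rewrite [e]splitr.
  apply: ltrD; last by apply: lt_trans (hw n) (hN n Nn).
  by rewrite nm_sub; apply: lt_trans (hw m) (hN m Nm).
have approx (e : R) : 0 < e -> exists n, nm (z - s (w n)) < e /\ nm (l - q (w n)) < e.
  move=> e0; have [N hN] := inv_nat_lt e0; have [M hM] := hl _ e0; exists (maxn N M); split.
    exact: lt_trans (hw _) (hN _ (leq_maxl _ _)).
  exact: hM (leq_maxr _ _).
have Al : rgraph A l.
  apply: (closed_nm (@rgraph_closed _ _ _ A)) => e e0.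
  by have [n [_ h]] := approx e e0; exists (q (w n)) => //; exact: gproj_in.
have sn w' : nm (s w') <= nm w'.
  by rewrite -qn -(nm_inl (H' := H') w'); exact: gproj_le.
have l1 : l.1 = s z.
  apply: nm_close => e e0; have [n [h1 h2]] := approx _ (divr_gt0 e0 (ltr0Sn R 1)).
  apply: le_trans (nm_tri (q (w n)).1 _ _) _; rewrite [e]splitr; apply: lerD.
    exact: le_trans (nm_fst (l - q (w n))) (ltW h2).
  by rewrite q1 -bopB; apply: le_trans (sn _) _; rewrite nm_sub ltW.
have ln : nm l = nm z.
  apply/eqP; rewrite eq_le; apply/andP; split; apply/ler_addgt0Pr => e e0;
    have [n [h1 h2]] := approx _ (divr_gt0 e0 (ltr0Sn R 1)).
  - have h3 := nm_ge l (q (w n)); have h4 := nm_ge (s (w n)) z.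
    by rewrite qn in h3; rewrite (nm_sub _ z) in h4; lra.
  - have h3 := nm_ge (q (w n)) l; have h4 := nm_ge z (s (w n)).
    by rewrite qn (nm_sub _ l) in h3; lra.
exists l.2; first by rewrite -l1 -surjective_pairing.
by rewrite -l1 -nm_hsum ln.
Qed.

Lemma riesz_mapP A z : rgraph A (res_sqrt A z, riesz_map A z).
Proof.
have /choice[f hf] : forall z, exists y, rgraph A (res_sqrt A z, y) /\
    nm (res_sqrt A z) ^+ 2 + nm y ^+ 2 = nm z ^+ 2.
  by move=> x; have [y] := riesz_exists A x; exists y.
have lf : linear f.
  move=> b x y; have [h _] := hf (b *: x + y); apply: (rgraph_fun h).
  have := rgraphD b (hf x).1 (hf y).1; rewrite bop_linear; congr (rgraph A _).
have [|a aE] := op_exists (M := 1) lf.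
  move=> x; rewrite mul1r; apply: sqr_le; first exact: nm_ge0.
  by rewrite -(hf x).2 lerDr sqr_ge0.
rewrite /riesz_map (@bop_ofE _ _ _ _ a); first by rewrite aE; exact: (hf z).1.
apply/seteqP; split=> -[x y]; rewrite /op_graph/= aE.
  by move=> <-; exists (res_sqrt A x); split=> //=; exact: (hf x).1.
move=> [w [/= <- Awy]]; exact: rgraph_fun (hf x).1 Awy.
Qed.

(** A point of the graph orthogonal to the image of the isometry is orthogonal to the
   projections of all $(w,0)$ onto the graph, hence to all $(w,0)$, and vanishes. *)
Lemma polar A : bounded_pair (res_sqrt A) (riesz_map A) /\
  rgraph A = pair_graph (res_sqrt A) (riesz_map A).
Proof.
have sa : bounded_pair (res_sqrt A) (riesz_map A).
  split; [exact: res_sqrt_pos|exact: res_sqrt_inj|move=> z].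
  have [y h1 <-] := riesz_exists A z.
  by rewrite (rgraph_fun (riesz_mapP A z) h1).
split=> //; apply/seteqP; split=> p; last first.
  by move=> [z ->]; exact: riesz_mapP.
move=> Ap; have [V VE] := pair_op (res_sqrt A) (riesz_map A).
have Vn z : nm (V z) = nm z by rewrite VE pair_isometry.
have sV : subspace_set (range V) by apply: subspace_image; exact: subspaceT.
have [v [z _ Vz] pv] := projection_closed p sV (isometry_closed Vn).
exists z; rewrite -VE Vz; apply/eqP; rewrite -subr_eq0; apply/eqP.
have Av : rgraph A v by rewrite -Vz VE; exact: riesz_mapP.
have Ad := rgraphB Ap Av; set d := p - v in pv Ad *.
have d1 : d.1 = 0.
  apply: dot_inj => w; rewrite dot0l.
  have := pv (graph_proj A (w, 0)) _.
  have E : '[d, graph_proj A (w, 0)] = '[d, (w, 0) : hsum H H'].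
    have := gproj_dot (w, 0) Ad; rewrite dotBl => /subr0_eq E.
    by rewrite dotC -E -dotC.
  rewrite E hsum_dotP/= dot0r addr0; apply.
  exists (res_sqrt A w) => //; rewrite VE res_sqrt_sqr.
  have h := riesz_mapP A (res_sqrt A w); rewrite res_sqrt_sqr in h.
  have h2 := gproj_in A (w, 0); rewrite [X in rgraph A X]surjective_pairing -resolventE in h2.
  by rewrite (rgraph_fun h h2) resolventE -surjective_pairing.
have : d.2 = 0 by apply: (@rgraph_snd_eq0 _ _ _ A); rewrite -d1 -surjective_pairing.
by move=> d2; rewrite [d]surjective_pairing d1 d2.
Qed.

Lemma pair_regular s a : bounded_pair s a -> exists B, rgraph B = pair_graph s a.
Proof.
move=> sa; have [ps inj n] := sa; have [V VE] := pair_op s a.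
have Vn z : nm (V z) = nm z by rewrite VE pair_isometry.
have GE : pair_graph s a = range V.
  by apply/seteqP; split=> [p [z ->]|_ [z _ <-]]; exists z => //; rewrite VE.
apply: regular_exists.
- by rewrite GE; apply: subspace_image; exact: subspaceT.
- by rewrite GE; exact: isometry_closed.
- by move=> y [z [/esym/inj -> ->]]; rewrite bop0.
have -> : graph_dom (pair_graph s a) = range s; last exact: positive_dense.
apply/seteqP; split=> [x [y [z [-> _]]]|_ [z _ <-]]; first by exists z.
by exists (a z), z.
Qed.

(** $(s^2x,asx)$ is the projection of $(x,0)$ onto the graph, so $s^2$ is the
   resolvent and $s$ its positive square root. *)
Lemma pair_riesz s a B : bounded_pair s a -> rgraph B = pair_graph s a ->
  res_sqrt B = s /\ riesz_map B = a.
Proof.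
move=> sa BE; have [ps inj n] := sa; have [ss _] := (positiveP s).1 ps.
have rE x : s (s x) = resolvent B x.
  rewrite resolventE (gproj_eq (q := (s (s x), a (s x)))) ?BE//; first by exists (s x).
  move=> _ [z ->]; rewrite hsum_dotP/= sub0r dotNl dotBl.
  rewrite -addrA -opprD (pair_dot _ _ sa) -ss.
  exact: subrr.
have sE : res_sqrt B = s.
  rewrite res_sqrtE; apply/esym/(sqrt1m_unique (nm_res_compl B) (res_compl_sym B) ps) => x.
  by rewrite rE resolvent_compl.
split=> //; rewrite /riesz_map -/(res_sqrt B) sE; apply: bop_ofE.
apply/seteqP; split=> -[x y]; rewrite /op_graph/=.
  by move=> <-; exists (s x); split=> //=; rewrite BE; exists x.
move=> [w [/= <-]]; rewrite BE => -[z [sxz ->]]; suff -> : x = z by [].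
by apply/eqP; rewrite -subr_eq0; apply/eqP/inj; rewrite bopB sxz subrr.
Qed.

(** $\chi(A)^*\chi(A)=1-(1+A^*A)^{-1}$ recovers the resolvent and its square root. *)
Lemma riesz_map_inj A B : riesz_map A = riesz_map B -> A = B.
Proof.
move=> AB; apply: regular_inj.
have [pA ->] := polar A; have [pB ->] := polar B; rewrite -AB.
suff -> : res_sqrt A = res_sqrt B by [].
rewrite AB in pA; rewrite [RHS]res_sqrtE.
apply: (sqrt1m_unique (nm_res_compl B) (res_compl_sym B) (res_sqrt_pos A)) => x.
rewrite -resolvent_compl res_sqrt_sqr; apply: dot_inj => y.
have hA := pair_dot x y pA; have hB := pair_dot x y pB.
have [sA _] := (positiveP _).1 (res_sqrt_pos A).
have [sB _] := (positiveP _).1 (res_sqrt_pos B).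
rewrite -!res_sqrt_sqr sA sB.
by apply: (addIr '[riesz_map B x, riesz_map B y]); rewrite hA hB.
Qed.

(** $\chi(Au) = \chi(A)u$, since $u^{-1}(1+A^*A)^{-1/2}u$ is the companion of
   $\chi(A)u$. *)
Lemma riesz_map_mulu A (u : unitary H) :
  riesz_map (A \*u u) = bop_comp (riesz_map A) u.
Proof.
have [sa AE] := polar A; have [ps inj n] := sa.
set s := res_sqrt A in sa AE ps inj n *; set a := riesz_map A in sa AE n *.
pose s' := bop_comp (unitary_inv_op u) (bop_comp s u).
suff [_ ->] : res_sqrt (A \*u u) = s' /\ riesz_map (A \*u u) = bop_comp a u by [].
apply: pair_riesz.
  split=> [x|x|z].
  - by rewrite /= -(unitary_dot u) unitary_invK; exact: ps.
  - move=> /= h; apply: (@unitary_inj _ _ u); rewrite bop0; apply: inj.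
    by rewrite -[s _](unitary_invK u) h bop0.
  - have -> : nm (s' z) = nm (s (u z)) by rewrite /nm unitary_inv_norm.
    by rewrite [bop_comp a u z]/= n /nm unitary_normE.
apply/seteqP; split=> -[x y]; rewrite muluE AE => -[z [ux ->]].
  by exists (unitary_inv_fun u z); rewrite /= unitary_invK -ux unitaryK.
by exists (u z); rewrite -[RHS]/(s (u z), a (u z)) ux /= unitary_invK.
Qed.

(** Close Riesz maps have close resolvents $1-\chi(A)^*\chi(A)$, whose square roots are
   close; so the isometries onto the graphs are close. *)
Lemma riesz_graph_close A (e : R) : 0 < e -> exists2 d : R, 0 < d & forall B,
  nm (riesz_map A - riesz_map B) <= d -> nm (graph_proj A - graph_proj B) <= e.
Proof.
move=> e0; have e80 : 0 < e / 8 by rewrite divr_gt0.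
have [N hN] := @div_nat_lt R 4 (e / 8) (ler0n R 4) e80.
have hN' := hN N (leqnn _).
pose d := Num.min (e / 8) (e / 8 / (2 * N.+1%:R)).
have N0 : 0 < 2 * N.+1%:R :> R by rewrite mulr_gt0.
have d0 : 0 < d by rewrite lt_min e80 divr_gt0.
have de : d <= e / 8 by rewrite ge_min lexx.
have dN : d * (2 * N.+1%:R) <= e / 8 by rewrite -ler_pdivlMr// ge_min lexx orbT.
clearbody d; exists d => // B AB.
have [pA AE] := polar A; have [pB BE] := polar B.
set a := riesz_map A in AB pA AE; set b := riesz_map B in AB pB BE.
set sA := res_sqrt A in pA AE; set sB := res_sqrt B in pB BE.
have na (K : regular H H') x : nm (riesz_map K x) <= nm x.
  have [[_ _ n] _] := polar K; apply: sqr_le; first exact: nm_ge0.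
  by rewrite -n lerDr sqr_ge0.
have res_compl_dot (K : regular H H') x y : '[res_compl K x, y] = '[riesz_map K x, riesz_map K y].
  have [pK _] := polar K; have := pair_dot x y pK.
  have [sK _] := (positiveP _).1 (res_sqrt_pos K).
  rewrite -sK res_sqrt_sqr resolvent_compl dotBl => h.
  have : '[riesz_map K x, riesz_map K y] - '[res_compl K x, y] = 0.
    by apply: (addrI '[x, y]); rewrite addr0 addrCA addrC h.
  by move/subr0_eq.
have nc : nm (res_compl A - res_compl B) <= 2 * d.
  apply: nm_op_le => [|x]; first by rewrite mulr_ge0// ltW.
  set w := (res_compl A - res_compl B) x.
  have [->|w0] := eqVneq (nm w) 0; first by rewrite mulr_ge0 ?nm_ge0// mulr_ge0// ltW.
  have wp : 0 < nm w by rewrite lt_neqAle eq_sym w0 nm_ge0.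
  rewrite -(ler_pM2r wp) -expr2 -rdot_nm.
  have -> : rdot w w = rdot ((a - b) x) (a w) + rdot (b x) ((a - b) w).
    have wE : '[w, w] = '[a x, a w] - '[b x, b w] by rewrite -!res_compl_dot -dotBl.
    rewrite /rdot wE -[(a - b) x]/(a x - b x) -[(a - b) w]/(a w - b w).
    by rewrite dotBl dotBr !raddfB/=; ring.
  have h1 := rdot_le ((a - b) x) (a w); have h2 := rdot_le (b x) ((a - b) w).
  have h3 := nm_op1 x AB; have h4 := nm_op1 w AB.
  have h5 := ler_pM (nm_ge0 _) (nm_ge0 _) h3 (na A w).
  have h6 := ler_pM (nm_ge0 _) (nm_ge0 _) (na B x) h4.
  by rewrite -/a -/b in h5 h6; move: h1 h2 h5 h6; rewrite -/w; lra.
have ns : nm (sA - sB) <= e / 4.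
  rewrite /sA /sB !res_sqrtE; apply: le_trans (sqrt1m_close N (nm_res_compl A) (nm_res_compl B)) _.
  have : N%:R * nm (res_compl A - res_compl B) <= N.+1%:R * (2 * d).
    by apply: ler_pM; rewrite ?nm_ge0// ler_nat.
  by move: hN' dN; move: (4 / N.+1%:R) => k4; move: (N%:R * _) (N.+1%:R) => *; lra.
have close z : nm (((sA z, a z) : hsum H H') - (sB z, b z)) <= (e / 2) * nm z.
  have -> : ((sA z, a z) : hsum H H') - (sB z, b z) = ((sA - sB) z, (a - b) z) by [].
  apply: le_trans (nm_pair_le (nm_op1 z ns) (nm_op1 z AB)) _.
  rewrite -mulrDl ler_wpM2r ?nm_ge0//; lra.
apply: (@le_trans _ _ (2 * (e / 2))); last by lra.
apply: graph_gap; first by rewrite divr_ge0// ltW.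
- move=> p; rewrite AE BE => -[z ->]; exists (sB z, b z); first by exists z.
  by rewrite (pair_isometry z pA).
- move=> p; rewrite AE BE => -[z ->]; exists (sA z, a z); first by exists z.
  by rewrite (pair_isometry z pB) nm_sub.
Qed.

(** $t\chi(A)$ has the injective companion $\sqrt{(1-t^2)+t^2(1+A^*A)^{-1}}$. *)
Lemma scaled_exists A (t : R) : 0 <= t <= 1 ->
  exists B, riesz_map B = t%:C *: riesz_map A.
Proof.
move=> /andP[t0 t1]; have [[ps inj n] AE] := polar A.
have t21 : t ^+ 2 <= 1 by rewrite expr_le1.
pose X := (t ^+ 2)%:C *: res_compl A.
have X1 : nm X <= 1.
  rewrite nmZr ger0_norm ?sqr_ge0//; apply: mulr_ile1 => //; [exact: sqr_ge0|exact: nm_ge0|].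
  exact: nm_res_compl.
have sX : selfadj X.
  by move=> x y; rewrite -[X x]/(_ *: res_compl A x) -[X y]/(_ *: res_compl A y) dotZl dotZrR res_compl_sym.
have pS := sqrt1m_positive X1 sX; have [sS _] := (positiveP _).1 pS.
have nS z : nm (sqrt1m X z) ^+ 2 + nm ((t%:C *: riesz_map A) z) ^+ 2 = nm z ^+ 2.
  rewrite -[(_ *: riesz_map A) z]/(t%:C *: riesz_map A z) nmZr exprMn real_normK ?num_real//.
  rewrite -!rdot_nm {1}/rdot -sS (sqrt1m_sqr X1) -[X z]/(_ *: res_compl A z) -/(rdot _ _) rdotBl rdotZl.
  have : rdot (res_compl A z) z = nm (riesz_map A z) ^+ 2.
    rewrite -[res_compl A z](subKr z) -resolvent_compl rdotBl rdot_nm -n -res_sqrt_sqr.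
    have [sA _] := (positiveP _).1 (res_sqrt_pos A).
    by rewrite /rdot sA -/(rdot _ _) rdot_nm; ring.
  by move=> ->; rewrite !rdot_nm; ring.
have iS x : sqrt1m X x = 0 -> x = 0.
  move=> h; have h2 : x - X x = 0 by rewrite -(sqrt1m_sqr X1) h bop0.
  have := nS x; rewrite h nm0 expr0n add0r -[(_ *: riesz_map A) x]/(t%:C *: riesz_map A x) nmZr exprMn real_normK ?num_real// => hn.
  apply: inj; apply: nm_eq0; apply/eqP; rewrite -sqrf_eq0 eq_le sqr_ge0 andbT.
  have := n x; have := sqr_ge0 (nm (riesz_map A x)).
  have : t ^+ 2 * nm (riesz_map A x) ^+ 2 <= nm (riesz_map A x) ^+ 2.
    by rewrite ler_piMl ?sqr_ge0.
  by rewrite hn; lra.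
have [B BE] := pair_regular (And3 pS iS nS).
by exists B; have [_] := pair_riesz (And3 pS iS nS) BE.
Qed.

End polar.

(** * The unitary group is path connected in the norm topology *)

Section unitary_path.
Context {R : realType} {H : hilbertType R}.
Implicit Types (T V : bounded_op H H) (u z : unitary H).

Lemma unitary_of T : (forall x, nm (T x) = nm x) -> (forall y, exists x, T x = y) ->
  exists u : unitary H, forall x, u x = T x.
Proof. by move=> Tn Ts; exists (Unitary (isometry_dot Tn) Ts). Qed.

Lemma nm_unitary u x : nm (u x) = nm x.
Proof. by rewrite /nm unitary_normE. Qed.

Lemma unitary_inv_dot u x y : '[unitary_inv_op u x, y] = '[x, u y].
Proof. by rewrite -(unitary_dot u) unitary_invK. Qed.

(** The range is closed by the lower bound and dense by injectivity of the adjoint. *)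
Lemma coercive_surjective T T' : (forall x y, '[T x, y] = '[x, T' y]) ->
  (forall x, nm x <= nm (T x)) -> (forall x, T' x = 0 -> x = 0) ->
  forall y, exists x, T x = y.
Proof.
move=> adj Tn inj y.
have sT : subspace_set (range T) by apply: subspace_image; exact: subspaceT.
have cT : closed (range T).
  by apply: (closed_image (@subspaceT _ H) closedT ler01) => x _; rewrite mul1r.
have [_ [x _ <-] yx] := projection_closed y sT cT; exists x.
apply/esym/subr0_eq/inj/dot_inj => w; rewrite dot0l dotC -adj -dotC.
by apply: yx; exists w.
Qed.

(** For $(a,b)=(1+t,1-t)$ and $(a,b)=(1-t,1+t)$ these are the numerator and the
   denominator of the Cayley transform of $t$ times the inverse Cayley transform of
   [V].  For $a+b=1$ they join [V] to $1$. *)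
Definition affine_op (a b : R) V : bounded_op H H := a%:C *: V + b%:C *: op1 H.

Lemma affine_opE a b V x : affine_op a b V x = a%:C *: V x + b%:C *: x.
Proof. by []. Qed.

Lemma nm_affine_op_sqr a b V x : (forall x, nm (V x) = nm x) ->
  nm (affine_op a b V x) ^+ 2 = (a ^+ 2 + b ^+ 2) * nm x ^+ 2 + 2 * a * b * rdot (V x) x.
Proof.
move=> Vn; rewrite affine_opE nm_sqrD rdotZl rdotZr !nmZr !exprMn !real_normK ?num_real// Vn; ring.
Qed.

Section accretive.
Variable z : unitary H.
Hypothesis z_acc : forall x, 0 <= rdot (z x) x.
Variable t : R.
Hypothesis t01 : 0 <= t <= 1.
Local Notation z' := (unitary_inv_op z).

Lemma inv_accretive x : 0 <= rdot (z' x) x.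
Proof. by rewrite /rdot unitary_inv_dot -/(rdot _ _) rdotC. Qed.

Lemma nm_unitary_inv_op x : nm (z' x) = nm x.
Proof. by rewrite /nm unitary_inv_norm. Qed.

Lemma cayley_den_ge V x : (forall x, nm (V x) = nm x) -> (forall x, 0 <= rdot (V x) x) ->
  nm x <= nm (affine_op (1 - t) (1 + t) V x).
Proof.
move=> Vn Va; apply: sqr_le; first exact: nm_ge0.
case/andP: t01 => t0 t1; rewrite nm_affine_op_sqr//.
have h1 : 0 <= (1 - t) * (1 + t) * rdot (V x) x by rewrite !mulr_ge0//; lra.
have h2 := sqr_ge0 (nm x); have h3 : 0 <= t ^+ 2 * nm x ^+ 2 by rewrite mulr_ge0 ?sqr_ge0.
by move: h1 h2 h3; move: (nm x ^+ 2) (rdot _ _) => p q; nra.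
Qed.

Lemma affine_op_adj a b x y : '[affine_op a b z x, y] = '[x, affine_op a b z' y].
Proof.
rewrite !affine_opE !dotDl !dotDr !dotZl !dotZrR; congr (_ * _ + _).
by rewrite [RHS]dotC unitary_inv_dot -dotC.
Qed.

Lemma cayley_den_surj y : exists x, affine_op (1 - t) (1 + t) z x = y.
Proof.
apply: (coercive_surjective (affine_op_adj _ _)) => x.
  by apply: cayley_den_ge => // w; exact: nm_unitary.
move=> h; apply: nm_le0; rewrite -[X in _ <= X](nm0 H) -h.
by apply: cayley_den_ge => w; [exact: nm_unitary_inv_op|exact: inv_accretive].
Qed.

Lemma cayley_den_inv_surj y : exists x, affine_op (1 - t) (1 + t) z' x = y.
Proof.
apply: (@coercive_surjective _ (affine_op (1 - t) (1 + t) z)) => [x w|x|x].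
- by rewrite dotC -affine_op_adj -dotC.
- by apply: cayley_den_ge => w; [exact: nm_unitary_inv_op|exact: inv_accretive].
move=> h; apply: nm_le0; rewrite -[X in _ <= X](nm0 H) -h.
by apply: cayley_den_ge => // w; exact: nm_unitary.
Qed.

(** Numerator and denominator have the same norm at each vector, and both are
   invertible. *)
Lemma cayley_quotient : exists g : unitary H, forall x,
  g (affine_op (1 - t) (1 + t) z x) = affine_op (1 + t) (1 - t) z x.
Proof.
have [f hf] := choice cayley_den_surj.
have inj x x' : affine_op (1 - t) (1 + t) z x = affine_op (1 - t) (1 + t) z x' -> x = x'.
  move=> h; apply/eqP; rewrite -subr_eq0; apply/eqP/nm_le0.
  apply: le_trans (cayley_den_ge _ (nm_unitary z) z_acc) _.
  by rewrite bopB h subrr nm0.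
have MN x : nm (affine_op (1 + t) (1 - t) z x) = nm (affine_op (1 - t) (1 + t) z x).
  apply/eqP; rewrite -(@eqrXn2 _ 2%N) ?nm_ge0//; apply/eqP.
  by rewrite !nm_affine_op_sqr ?nm_unitary//; [ring|move=> w; exact: nm_unitary..].
have lf : linear (fun y => affine_op (1 + t) (1 - t) z (f y)).
  move=> a x y; rewrite -bop_linear; congr (affine_op _ _ _ _); apply: inj.
  by rewrite bop_linear !hf.
have [|G GE] := op_exists (M := 1) lf.
  by move=> y; rewrite MN hf mul1r.
have [||g gE] := @unitary_of G.
- by move=> y; rewrite GE MN hf.
- move=> y; have [x hx] := cayley_den_inv_surj (z' y).
  exists (affine_op (1 - t) (1 + t) z x); rewrite GE.
  have -> : f (affine_op (1 - t) (1 + t) z x) = x by apply: inj; rewrite hf.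
  rewrite -[RHS](unitary_invK z) -[unitary_inv_fun z y]hx !affine_opE bopD !bopZ.
  by rewrite -[z (z' x)]/(z (unitary_inv_fun z x)) unitary_invK addrC.
by exists g => x; rewrite gE GE; congr (affine_op _ _ _ _); apply: inj; rewrite hf.
Qed.

End accretive.

(** The Lipschitz bound holds since the denominator does not decrease norms. *)
Lemma accretive_path z : (forall x, 0 <= rdot (z x) x) -> exists g : R -> unitary H,
  [/\ forall x, g 0 x = x, forall x, g 1 x = z x &
   forall s t, 0 <= s <= 1 -> 0 <= t <= 1 ->
     nm ((g s : bounded_op H H) - (g t : bounded_op H H)) <= 4 * `|s - t|].
Proof.
move=> za.
have /choice[g hg] : forall t : R, exists g : unitary H, 0 <= t <= 1 -> forall x,
    g (affine_op (1 - t) (1 + t) z x) = affine_op (1 + t) (1 - t) z x.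
  move=> t; have [t01|t01] := boolP (0 <= t <= 1); last by exists z.
  by have [g hg] := cayley_quotient za t01; exists g.
exists g; split=> [x|x|s t s01 t01].
- have [|y <-] := @cayley_den_surj z za 0 _ x; first by rewrite lexx ler01.
  by rewrite hg ?lexx ?ler01// subr0 addr0.
- have [|y <-] := @cayley_den_surj z za 1 _ x; first by rewrite lexx ler01.
  rewrite hg ?lexx ?ler01// subrr !affine_opE.
  by rewrite !rmorph0 !scale0r add0r addr0 bopZ.
apply: nm_op_le => [|y]; first by rewrite mulr_ge0.
have [x <-] := cayley_den_surj za t01 y.
set y' := affine_op (1 - t) (1 + t) z x.
have xy : nm x <= nm y' by apply: cayley_den_ge => // w; exact: nm_unitary.
have E : affine_op (1 - t) (1 + t) z x = affine_op (1 - s) (1 + s) z x + (s - t)%:C *: (z x - x).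
  by apply: dot_inj => w; rewrite !affine_opE !dot_expand !rmorphB/= !rmorphD/= rmorph1; ring.
have -> : ((g s : bounded_op H H) - (g t : bounded_op H H)) y' =
   (s - t)%:C *: (z x - x) + g s ((s - t)%:C *: (z x - x)).
  rewrite opBE {2}/y' hg// /y' E bopD hg//.
  by apply: dot_inj => w; rewrite !affine_opE !dot_expand !rmorphB/= !rmorphD/= rmorph1; ring.
apply: le_trans (nmD _ _) _; rewrite nm_unitary nmZr.
have h := nmB (z x) x; rewrite nm_unitary in h.
have h2 : `|s - t| * nm (z x - x) <= `|s - t| * (2 * nm y').
  by rewrite ler_wpM2l//; lra.
lra.
Qed.

(** Let $y$ be the imaginary part of $u$ and $P$ the projection onto the kernel of
   $|y| - y$, on which $y\ge 0$, while $y\le 0$ on the complement; here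
   $|y| = \sqrt{1-x^2}$ for the real part $x$.  As $P$ commutes with $u$, both
   $w = i(2P-1)$ and $z = uw^{-1}$ have a nonnegative real part. *)
Lemma unitary_factor u : exists z w : unitary H,
  [/\ forall x, 0 <= rdot (z x) x, forall x, 0 <= rdot (w x) x &
      forall x, u x = z (w x)].
Proof.
pose u' := unitary_inv_op u.
have uu' x : u (u' x) = x by exact: unitary_invK.
have u'u x : u' (u x) = x by exact: unitaryK.
have nu' x : nm (u' x) = nm x by rewrite /nm unitary_inv_norm.
pose re x := (2^-1 : R)%:C *: (u x + u' x).
have [reo reE] : exists T : bounded_op H H, T =1 re.
  by exists ((2^-1 : R)%:C *: ((u : bounded_op H H) + u')).
pose im x := (- ('i%C / 2%:R)) *: (u x - u' x).
have [imo imE] : exists T : bounded_op H H, T =1 im.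
  by exists ((- ('i%C / 2%:R)) *: ((u : bounded_op H H) - u')).
have half2 : (2^-1 : R)%:C = 2^-1 :> R[i] by rewrite fmorphV rmorph_nat.
have ii : 'i%C * 'i%C = -1 :> R[i] by rewrite -expr2 sqr_i.
have iconj : (('i%C : R[i])^*)%R = - 'i%C.
  by apply/eqP; rewrite eq_complex/= oppr0 !eqxx.
have conj_i2 : ((- ('i%C / 2%:R) : R[i])^*)%R = 'i%C / 2%:R.
  by rewrite rmorphN rmorphM/= iconj fmorphV rmorph_nat mulNr opprK.
have u'dot x y : '[u' x, y] = '[x, u y] by exact: unitary_inv_dot.
have udot x y : '[u x, y] = '[x, u' y] by rewrite dotC -u'dot -dotC.
pose X := bop_comp reo reo.
have XE x : X x = reo (reo x) by [].
have nre : nm reo <= 1.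
  apply: nm_op_le => // x; rewrite reE nmZr ger0_norm ?invr_ge0// mul1r.
  by have := nmD (u x) (u' x); rewrite nm_unitary nu'; lra.
have X1 : nm X <= 1.
  by apply: le_trans (nm_comp _ _) _; rewrite mulr_ile1 ?nm_ge0.
have res x y : '[reo x, y] = '[x, reo y].
  by rewrite !reE /re dotZl dotZrR dotDl dotDr udot u'dot addrC.
have sX : selfadj X by move=> x y; rewrite !XE !res.
pose a := sqrt1m X.
have pa : positive a by exact: sqrt1m_positive.
have [sa ra] := (positiveP a).1 pa.
have ims x y : '[imo x, y] = '[x, imo y].
  by rewrite !imE /im dotZl dotZr dotBl dotBr udot u'dot conj_i2; ring.
have reu x : u (reo x) = reo (u x) by rewrite !reE /re bopZ bopD uu' u'u.
have reu' x : u' (reo x) = reo (u' x) by rewrite !reE /re bopZ bopD uu' u'u.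
have imu x : u (imo x) = imo (u x) by rewrite !imE /im bopZ bopB uu' u'u.
have imu' x : u' (imo x) = imo (u' x) by rewrite !imE /im bopZ bopB uu' u'u.
have reim x : imo (reo x) = reo (imo x).
  by rewrite imE /im reu reu' -bopB -bopZ [in RHS]imE.
have a2 x : a (a x) = imo (imo x).
  rewrite /a (sqrt1m_sqr X1) XE !reE !imE /re /im !bopZ !bopD !bopN uu' u'u.
  apply: dot_inj => w; rewrite !dot_expand half2.
  move: '[x, w] '[u (u x), w] '[u' (u' x), w] => p q r.
  have -> : - ('i%C / 2%:R) * (- ('i%C / 2%:R) * (q - p) - - ('i%C / 2%:R) * (p - r)) =
    ('i%C * 'i%C) * ((q - p - p + r) / 4%:R) :> R[i] by field.
  by rewrite ii; field.
have aim x : imo (a x) = a (imo x).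
  by apply: (sqrt1m_comm X1) => w; rewrite !XE !reim.
have au x : u (a x) = a (u x).
  by apply: (sqrt1m_comm X1) => w; rewrite !XE !reu.
have au' x : u' (a x) = a (u' x).
  by apply: (sqrt1m_comm X1) => w; rewrite !XE !reu'.
clearbody a.
pose W := [set x | a x = imo x].
have sW : subspace_set W.
  split=> [|b x y]; first by rewrite /W/= (bop0 a) (bop0 imo).
  by rewrite /W/= (bop_linear a) (bop_linear imo) => -> ->.
have cW : closed W.
  apply: nm_closed => x hx; apply/eqP; rewrite -subr_eq0 -opBE; apply/eqP.
  apply: op_continuous_eq0 => e e0; have [q Wq xq] := hx e e0; exists q => //.
  by rewrite opBE Wq subrr.
pose P := orthoproj W.
have PW x : W (P x) by exact: orthoproj_in.
have Pd x w : W w -> '[x - P x, w] = 0 by exact: orthoproj_dot.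
have uW w : W w -> W (u w) by rewrite /W/= -au -imu => ->.
have u'W w : W w -> W (u' w) by rewrite /W/= -au' -imu' => ->.
(* the sign of the imaginary part on [W] and on its complement *)
have imW w : W w -> 0 <= rdot (imo w) w by rewrite /W/= => <-; exact: ra.
have imQ x : rdot (imo (x - P x)) (x - P x) <= 0.
  set q := x - P x.
  suff : a q + imo q = 0 by move/eqP; rewrite addr_eq0 => /eqP E; rewrite -oppr_ge0 -rdotNl -E ra.
  apply: dot_inj => h; rewrite dot0l dotDl sa ims -dotDr; apply: Pd.
  by rewrite /W/= !bopD a2 -aim addrC.
have imr x : rdot (imo x) x = rdot ((- 'i%C) *: u x) x.
  rewrite imE /im /rdot !dotZl dotBl u'dot (dotC x (u x)).
  have -> (q : R[i]) : - ('i%C / 2%:R) * q = (2^-1 : R)%:C * (- 'i%C * q).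
    by rewrite half2; field.
  by rewrite Re_mulr; case: '[u x, x] => c d /=; field.
pose S : bounded_op H H := (2 : R)%:C *: (P : bounded_op H H) - op1 H.
have SE x : S x = (2 : R)%:C *: P x - x by [].
have PP x : P (P x) = P x by apply: orthoproj_id.
have SS x : S (S x) = x.
  rewrite !SE bopB bopZ PP; apply: dot_inj => w; rewrite !dot_expand rmorph_nat; ring.
have nS x : nm (S x) = nm x.
  apply/eqP; rewrite -(@eqrXn2 _ 2%N) ?nm_ge0// -!rdot_nm !SE !rdotE.
  have E : rdot (P x) (P x) = rdot (P x) x.
    by rewrite rdot_nm; apply: orthoproj_nm_dot.
  by apply/eqP; rewrite E (rdotC x (P x)); ring.
have i1 : cm ('i%C : R[i]) = 1.
  by rewrite /cm normc_def/= expr0n/= expr1n add0r sqrtr1.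
have iN1 : cm (- 'i%C : R[i]) = 1 by rewrite cmN.
have [w wE] : exists w : unitary H, forall x, w x = 'i%C *: S x.
  have [||w hw] := @unitary_of ('i%C *: S); last by exists w => x; rewrite hw.
  - by move=> x; rewrite -[('i%C *: S) x]/('i%C *: S x) nmZ i1 mul1r.
  - move=> y; exists (- 'i%C *: S y).
    by rewrite -[('i%C *: S) _]/('i%C *: S _) bopZ SS scalerA mulrN ii opprK scale1r.
have [z zE] : exists z : unitary H, forall x, z x = - 'i%C *: u (S x).
  have [||z hz] := @unitary_of (- 'i%C *: bop_comp u S); last by exists z => x; rewrite hz.
  - by move=> x; rewrite -[(_ *: bop_comp u S) x]/(- 'i%C *: u (S x)) nmZ iN1 mul1r nm_unitary.
  - move=> y; exists ('i%C *: S (u' y)).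
    rewrite -[(_ *: bop_comp u S) _]/(- 'i%C *: u (S _)) !bopZ SS uu' scalerA mulNr ii.
    by rewrite opprK scale1r.
exists z, w; split=> [x|x|x].
- have xE : x = P x + (x - P x) by rewrite addrC subrK.
  have Sx : S x = P x - (x - P x).
    by rewrite SE; apply: dot_inj => y; rewrite !dot_expand rmorph_nat; ring.
  have uP : W (u (P x)) by exact: uW.
  have uQ y : W y -> '[u (x - P x), y] = 0 by move=> Wy; rewrite udot; apply: Pd; exact: u'W.
  have -> : rdot (z x) x = rdot (imo (P x)) (P x) - rdot (imo (x - P x)) (x - P x).
    have key p q : '[u p, q] = 0 -> '[u q, p] = 0 ->
        rdot (- 'i%C *: u (p - q)) (p + q) = rdot (- 'i%C *: u p) p - rdot (- 'i%C *: u q) q.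
      move=> pq qp; rewrite bopB /rdot !dotZl dotBl !dotDr pq qp.
      by rewrite add0r addr0 mulrBr raddfB.
    have -> : rdot (z x) x = rdot (z x) (P x + (x - P x)) by rewrite -xE.
    rewrite !imr zE Sx key//; last exact: uQ.
    by rewrite dotC Pd ?rmorph0.
  by rewrite subr_ge0; apply: le_trans (imQ x) (imW _ _).
- have -> : rdot (w x) x = 0; last by [].
  rewrite wE /rdot dotZl SE dotBl dotZl.
  have -> : '[P x, x] = (nm (P x) ^+ 2)%:C.
    by have := orthoproj_sym sW cW (P x) x; rewrite -/P PP dot_nm.
  rewrite dot_nm -rmorphM -rmorphB/=.
  by rewrite mul0r mulr0 subrr.
by rewrite zE wE bopZ SS bopZ scalerA mulNr ii opprK scale1r.
Qed.

Lemma unitary_connected u : exists2 g : R -> unitary H,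
  (forall x, g 0 x = u x) /\ (forall x, g 1 x = x) &
  forall s t, 0 <= s <= 1 -> 0 <= t <= 1 ->
     nm ((g s : bounded_op H H) - (g t : bounded_op H H)) <= 8 * `|s - t|.
Proof.
have [z [w [za wa uE]]] := unitary_factor u.
have [g [g0 g1 gL]] := accretive_path za; have [k [k0 k1 kL]] := accretive_path wa.
have /choice[h hh] : forall t, exists h : unitary H, forall x, h x = g (1 - t) (k (1 - t) x).
  move=> t; have [||h hh] := @unitary_of (bop_comp (g (1 - t)) (k (1 - t))); last by exists h.
  - by move=> x; rewrite -[bop_comp _ _ x]/(g _ (k _ x)) !nm_unitary.
  - move=> y; have [x xy] := unitary_surj (g (1 - t)) y; have [x' x'x] := unitary_surj (k (1 - t)) x.
    by exists x'; rewrite -[bop_comp _ _ _]/(g _ (k _ x')) x'x.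
exists h; first by split=> x; rewrite hh ?subr0 ?subrr ?g0 ?g1 ?k0 ?k1.
move=> s t s01 t01; apply: nm_op_le => [|x]; first by rewrite mulr_ge0.
have s01' : 0 <= 1 - s <= 1 by case/andP: s01 => *; apply/andP; split; lra.
have t01' : 0 <= 1 - t <= 1 by case/andP: t01 => *; apply/andP; split; lra.
have := gL _ _ s01' t01'; have := kL _ _ s01' t01'.
have -> : (1 - s) - (1 - t) = t - s by ring.
rewrite distrC => h1 h2.
have -> : ((h s : bounded_op H H) - (h t : bounded_op H H)) x =
   ((g (1 - s) : bounded_op H H) - (g (1 - t) : bounded_op H H)) (k (1 - s) x) +
   g (1 - t) (((k (1 - s) : bounded_op H H) - (k (1 - t) : bounded_op H H)) x).
  by rewrite !opBE !hh bopB addrA subrK.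
apply: le_trans (nmD _ _) _; rewrite nm_unitary.
have := nm_op1 (k (1 - s) x) h2; have := nm_op1 x h1; rewrite nm_unitary => h3 h4.
by move: h3 h4; move: (nm _) (nm _) => *; lra.
Qed.

End unitary_path.

(** * Orthonormal bases *)

Section orthonormal_basis.
Context {R : realType} {H : hilbertType R}.

Definition orthonormal_set (E : set H) :=
  forall x y, E x -> E y -> '[x, y] = (x == y)%:R.

Lemma orthonormal_dist (E : set H) x y : orthonormal_set E -> E x -> E y ->
  x != y -> nm (x - y) ^+ 2 = 2.
Proof.
move=> oE Ex Ey xy; rewrite nm_sqrB -!rdot_nm /rdot !oE// !eqxx (negPf xy)/=; ring.
Qed.

(** A maximal orthonormal set is total.  It is countable because its points are
   $\sqrt 2$ apart, and infinite because the space is not finite dimensional. *)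
Lemma orthonormal_basis : separable H -> infinite_dim H -> exists e : nat -> H,
  (forall m n, '[e m, e n] = (m == n)%:R) /\
  (forall x, (forall n, '[x, e n] = 0) -> x = 0).
Proof.
move=> [D [cD dD]] infH.
have [|E [oE maxE]] := @Zorn_bigcup _ orthonormal_set.
  move=> F FP totF x y [X FX Xx] [Y FY Yy].
  have [XY|YX] := totF _ _ FX FY; first by apply: (FP Y FY) => //; exact: XY.
  by apply: (FP X FX) => //; exact: YX.
have total x : (forall w, E w -> '[x, w] = 0) -> x = 0.
  move=> xE; apply: contrapT => /eqP x0.
  have xp : 0 < nm x.
    by rewrite lt_neqAle nm_ge0 andbT eq_sym; apply: contra_neq x0 => /nm_eq0.
  pose g := (nm x)^-1%:C *: x.
  have gE w : E w -> '[g, w] = 0 by move=> Ew; rewrite dotZl xE// mulr0.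
  have g1 : '[g, g] = 1.
    by rewrite dot_nm nmZr ger0_norm ?invr_ge0 ?nm_ge0// mulVf ?gt_eqF// expr1n.
  have nEg : ~ E g by move=> Eg; have := gE g Eg; rewrite g1 => /eqP; rewrite oner_eq0.
  apply: (maxE (E `|` [set g])).
    split; first by move=> w Ew; left.
    by move=> h; apply: nEg; apply: h; right.
  have ne w : E w -> (g == w) = false by move=> Ew; apply/eqP => gw; apply: nEg; rewrite gw.
  move=> a b [Ea|/= ->] [Eb|/= ->].
  - exact: oE.
  - by rewrite dotC gE// rmorph0 eq_sym ne.
  - by rewrite gE// ne.
  - by rewrite g1 eqxx.
have cE : countable E.
  have [g ginj] := countable_injP _ cD.
  have /choice[f hf] : forall x, exists d, D d /\ nm (x - d) < 2^-1.
    move=> x; have /dense_nm dD' := dD.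
    by have [|d Dd xd] := dD' x 2^-1; [rewrite invr_gt0|exists d].
  apply/countable_injP; exists (g \o f) => x y /set_mem Ex /set_mem Ey /= gxy.
  have fxy : f x = f y by apply: ginj gxy; apply/mem_set; apply: (hf _).1.
  clear gxy; apply/eqP; apply: contraPT isT => xy.
  have := orthonormal_dist oE Ex Ey xy.
  have h1 := (hf x).2; have h2 := (hf y).2; rewrite -fxy nm_sub in h2.
  have h3 := nm_tri (f x) x y; have h4 := nm_ge0 (x - y) => h5.
  have : nm (x - y) ^+ 2 < 1 by rewrite expr_lt1//; lra.
  by rewrite h5 ltNge ler1n.
have iE : infinite_set E.
  move=> /finite_seqP[s sE]; apply: infH.
  pose t := undup s.
  have tE v : v \in t -> E v by rewrite mem_undup sE.
  exists (size t), (fun i => t`_i); split=> // x _.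
  exists (fun i => '[x, t`_i]); apply/eqP; rewrite -subr_eq0; apply/eqP/total => w Ew.
  have wt : w \in t by rewrite mem_undup; move: Ew; rewrite sE.
  have -> : \sum_(i < size t) '[x, t`_i] *: t`_i = \sum_(v <- t) '[x, v] *: v.
    by rewrite (big_nth 0) big_mkord.
  rewrite dotBl dot_suml (bigD1_seq w) ?undup_uniq//= (oE w w Ew Ew) eqxx mulr1.
  rewrite big_seq_cond big1 ?addr0 ?subrr// => v /andP[vt vw].
  by rewrite (oE v w (tE v vt) Ew) (negPf vw) mulr0.
have /card_esym/card_set_bijP[e [eE einj esurj]] := eq_card_nat cE iE.
exists e; split=> [m n|x h].
  rewrite oE; try exact: eE.
  by congr (nat_of_bool _)%:R; apply/eqP/eqP => [|->//]; apply: einj; exact: mem_set.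
by apply: total => w /esurj[n _ <-]; exact: h.
Qed.

End orthonormal_basis.

(** * Rapidly converging sums of rank one operators *)

Section series.
Context {R : realType} {H : hilbertType R}.
Implicit Types (w : nat -> R) (p q : nat -> H).

Definition fast_decay w := forall n, 0 <= w n <= geo n.+1.

Lemma rank1_exists (r : R) (p q : H) : exists T : bounded_op H H,
  forall x, T x = (r%:C * '[x, p]) *: q.
Proof.
have lf : linear (fun x : H => (r%:C * '[x, p]) *: q).
  by move=> a x y; rewrite dotDl dotZl scalerA mulrDr scalerDl mulrCA.
have [|T TE] := op_exists (M := `|r| * nm p * nm q) lf; last by exists T.
move=> x; rewrite nmZ cmM cm_real.
apply: le_trans (_ : `|r| * (nm x * nm p) * nm q <= _).
  by rewrite ler_wpM2r ?nm_ge0// ler_wpM2l// cm_dot.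
by rewrite le_eqVlt; apply/orP; left; apply/eqP; ring.
Qed.

Definition rank1 (r : R) (p q : H) : bounded_op H H :=
  get [set T : bounded_op H H | forall x, T x = (r%:C * '[x, p]) *: q].

Lemma rank1E (r : R) (p q x : H) : rank1 r p q x = (r%:C * '[x, p]) *: q.
Proof.
have [T TE] := rank1_exists r p q.
exact: (getPex (ex_intro [set T : bounded_op H H | forall x, T x = (r%:C * '[x, p]) *: q] T TE)).
Qed.

Definition series_part w p q N : bounded_op H H := \sum_(n < N) rank1 (w n) (p n) (q n).

Lemma series_partS w p q N : series_part w p q N.+1 = series_part w p q N + rank1 (w N) (p N) (q N).
Proof. by rewrite /series_part big_ord_recr. Qed.

Lemma series_partE w p q N x :
  series_part w p q N x = \sum_(n < N) ((w n)%:C * '[x, p n]) *: q n.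
Proof.
elim: N => [|N IH]; first by rewrite /series_part !big_ord0 op0E.
by rewrite series_partS opDE IH big_ord_recr/= rank1E.
Qed.

Definition rank1_series w p q : bounded_op H H :=
  get [set S | forall n, nm (S - series_part w p q n) <= geo n / 3].

Section fix_series.
Variables (w : nat -> R) (p q : nat -> H).
Hypotheses (fw : fast_decay w) (p1 : forall n, nm (p n) <= 1) (q1 : forall n, nm (q n) <= 1).

Lemma nm_rank1 n : nm (rank1 (w n) (p n) (q n)) <= geo n.+1.
Proof.
apply: nm_op_le => [|x]; first exact: geo_ge0.
rewrite rank1E nmZ cmM cm_real ger0_norm; last by have /andP[] := fw n.
have h1 : cm '[x, p n] * nm (q n) <= nm x.
  apply: le_trans (_ : cm '[x, p n] <= _); first by rewrite ler_piMr ?cm_ge0.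
  by apply: le_trans (cm_dot _ _) _; rewrite ler_piMr ?nm_ge0.
rewrite -mulrA; apply: ler_pM => //; first by have /andP[] := fw n.
  by rewrite mulr_ge0 ?cm_ge0 ?nm_ge0.
by have /andP[] := fw n.
Qed.

Lemma seriesP n : nm (rank1_series w p q - series_part w p q n) <= geo n / 3.
Proof.
have step m k : (k <= m)%N -> nm (series_part w p q m - series_part w p q k) <= (geo k - geo m) / 3.
  elim: m => [|m IH]; first by rewrite leqn0 => /eqP ->; rewrite !subrr nm0 mul0r.
  rewrite leq_eqVlt => /orP[/eqP ->|]; first by rewrite !subrr nm0 mul0r.
  rewrite ltnS => /IH {}IH; rewrite series_partS addrAC; apply: le_trans (nmD _ _) _.
  have := nm_rank1 m; rewrite geoS; lra.
have [|m k km|S hS] := @op_seq_lim _ H H (series_part w p q) (fun n => geo n / 3).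
- move=> e e0; have e30 : 0 < e * 3 by rewrite mulr_gt0.
  by have [N hN] := geo_lt e30; exists N => k /hN; rewrite ltr_pdivrMr.
- by apply: le_trans (step m k km) _; rewrite ler_pM2r ?invr_gt0// lerBlDr lerDl geo_ge0.
exact: (getPex (ex_intro [set S | forall n, nm (S - series_part w p q n) <= geo n / 3] S hS)).
Qed.

Lemma nm_series : nm (rank1_series w p q) <= 3^-1.
Proof.
have := seriesP 0; rewrite /series_part big_ord0 subr0 /geo expr0 => h.
by apply: le_trans h _; rewrite mul1r.
Qed.

Lemma geo_lim0 (a : R[i]) (c : R) : 0 <= c ->
  (exists N0 : nat, forall n, (N0 <= n)%N -> cm a <= geo n * c) -> a = 0.
Proof.
move=> c0 [N0 h]; apply: cm_small => e e0.
have c1 : 0 < c + 1 by rewrite ltr_wpDl.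
have [N hN] := geo_lt (divr_gt0 e0 c1).
apply: le_trans (h _ (leq_maxl N0 N)) _.
have := hN _ (leq_maxr N0 N); rewrite ltr_pdivlMr// => /ltW; apply: le_trans.
by rewrite ler_wpM2l ?geo_ge0// lerDl.
Qed.

Lemma series_coord x y n0 : (forall n, n != n0 -> '[q n, y] = 0) ->
  '[rank1_series w p q x, y] = (w n0)%:C * '[x, p n0] * '[q n0, y].
Proof.
move=> qy; apply/eqP; rewrite -subr_eq0; apply/eqP/(@geo_lim0 _ (nm x * nm y / 3)).
  by rewrite divr_ge0// mulr_ge0 ?nm_ge0.
exists n0.+1 => N n0N.
have E : '[series_part w p q N x, y] = (w n0)%:C * '[x, p n0] * '[q n0, y].
  elim: N n0N => // N IH; rewrite ltnS series_partS opDE rank1E dotDl dotZl leq_eqVlt => /orP[/eqP E|n0N].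
    rewrite -E; suff -> : '[series_part w p q n0 x, y] = 0 by rewrite add0r.
    have lt0 k : (k <= n0)%N -> '[series_part w p q k x, y] = 0.
      elim: k => [|k IHk] kn; first by rewrite /series_part big_ord0 op0E dot0l.
      have kn0 : k != n0 by rewrite ltn_eqF.
      by rewrite series_partS opDE rank1E dotDl dotZl IHk ?(ltnW kn)// (qy k kn0) mulr0 addr0.
    exact: lt0.
  have Nn0 : N != n0 by rewrite gtn_eqF.
  by rewrite IH// (qy N Nn0) mulr0 addr0.
rewrite -E -dotBl -opBE; apply: le_trans (cm_dot _ _) _.
apply: le_trans (ler_wpM2r (nm_ge0 y) (nm_op1 x (seriesP N))) _.
by rewrite le_eqVlt; apply/orP; left; apply/eqP; ring.
Qed.

Lemma series_compact : compact_op (rank1_series w p q).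
Proof.
apply/compact_opP; apply: tb_approx => e e0.
have [N hN] := geo_lt e0; have {}hN := hN N (leqnn _).
exists [set \sum_(i <- index_enum 'I_N) c i *: q i | c in [set c : 'I_N -> R[i] | forall i, cm (c i) <= 1]].
  exact: tb_lincomb.
move=> _ [x /= x1 <-]; exists (series_part w p q N x).
  exists (fun n : 'I_N => (w n)%:C * '[x, p n]); last by rewrite series_partE.
  move=> n; rewrite cmM cm_real; have /andP[w0 wn] := fw n; rewrite ger0_norm//.
  apply: mulr_ile1 => //; first exact: cm_ge0.
    apply: le_trans wn (le_trans (geo_le _) _); rewrite invf_le1 ?ler1n//.
  by apply: le_trans (cm_dot _ _) _; rewrite mulr_ile1 ?nm_ge0.
rewrite -opBE; apply: le_lt_trans (nm_op1 x (seriesP N)) _.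
apply: le_lt_trans hN; apply: le_trans (_ : geo N / 3 * 1 <= _).
  by rewrite ler_wpM2l ?divr_ge0 ?geo_ge0.
by rewrite mulr1 ler_pdivrMr// ler_peMr ?geo_ge0// ler1n.
Qed.

End fix_series.

Lemma series_adj w p q : fast_decay w -> (forall n, nm (p n) <= 1) -> (forall n, nm (q n) <= 1) ->
  forall x y, '[rank1_series w p q x, y] = '[x, rank1_series w q p y].
Proof.
move=> fw p1 q1 x y; apply/eqP; rewrite -subr_eq0; apply/eqP/(@geo_lim0 _ (nm x * nm y)).
  by rewrite mulr_ge0 ?nm_ge0.
exists 0%N => N _.
have E : '[series_part w p q N x, y] = '[x, series_part w q p N y].
  elim: N => [|N IH]; first by rewrite /series_part !big_ord0 !op0E dot0l dot0r.
  rewrite !series_partS !opDE !rank1E dotDl dotDr IH dotZl dotZr; congr (_ + _).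
  by rewrite rmorphM/= conjC_real -dotC; ring.
have -> : '[rank1_series w p q x, y] - '[x, rank1_series w q p y] =
   '[(rank1_series w p q - series_part w p q N) x, y] - '[x, (rank1_series w q p - series_part w q p N) y].
  by rewrite !opBE dotBl dotBr E; ring.
apply: le_trans (cmD _ _) _; rewrite cmN.
have h1 := le_trans (cm_dot _ _) (ler_wpM2r (nm_ge0 y) (nm_op1 x (seriesP fw p1 q1 N))).
have h2 := le_trans (cm_dot _ _) (ler_wpM2l (nm_ge0 x) (nm_op1 y (seriesP fw q1 p1 N))).
apply: le_trans (lerD h1 h2) _.
have : 0 <= geo N * (nm x * nm y) by rewrite !mulr_ge0 ?geo_ge0 ?nm_ge0.
have -> : geo N / 3 * nm x * nm y + nm x * (geo N / 3 * nm y) = 2 / 3 * (geo N * (nm x * nm y)) by field.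
lra.
Qed.

Lemma series_positive w p : fast_decay w -> (forall n, nm (p n) <= 1) -> positive (rank1_series w p p).
Proof.
move=> fw p1; apply/positiveP; split; first exact: series_adj.
move=> x; apply/ler_addgt0Pr => e e0.
have x0 : 0 < nm x ^+ 2 + 1 by rewrite ltr_wpDl ?sqr_ge0.
have [N hN] := geo_lt (divr_gt0 e0 x0); have {}hN := hN N (leqnn _).
have h1 : 0 <= rdot (series_part w p p N x) x.
  elim: {hN} N => [|N IH]; first by rewrite /series_part big_ord0 op0E rdot0l.
  rewrite series_partS opDE rank1E rdotDl addr_ge0// /rdot dotZl -mulrA Re_mulr.
  rewrite mulr_ge0//; first by have /andP[] := fw N.
  by rewrite (dotC (p N)) -normCK cmE -rmorphXn/= sqr_ge0.
have h2 := rdot_ge ((rank1_series w p p - series_part w p p N) x) x.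
have h3 := ler_wpM2r (nm_ge0 x) (nm_op1 x (seriesP fw p1 p1 N)).
have h4 : rdot (rank1_series w p p x) x = rdot (series_part w p p N x) x + rdot ((rank1_series w p p - series_part w p p N) x) x.
  by rewrite -rdotDl opBE addrC subrK.
have h5 : geo N / 3 * nm x * nm x <= e.
  move: hN; rewrite ltr_pdivlMr// => /ltW; apply: le_trans.
  have := @geo_ge0 R N; have := sqr_ge0 (nm x) => a b.
  have : 0 <= geo N * nm x ^+ 2 by rewrite mulr_ge0.
  have -> : geo N / 3 * nm x * nm x = geo N * nm x ^+ 2 / 3 by ring.
  by rewrite mulrDr mulr1; lra.
lra.
Qed.

End series.

(** * Two positive injective operators with disjoint ranges *)

Section disjoint_ranges.
Context {R : realType} {H : hilbertType R}.

Lemma log2_fiber m N : exists2 n, (N <= n)%N & logn 2 n = m.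
Proof.
exists (2 ^ m * (2 * N).+1)%N.
  apply: (@leq_trans (2 * N).+1); first by rewrite (leq_trans _ (leqnSn _))// leq_pmull.
  by rewrite leq_pmull// expn_gt0.
rewrite lognM ?expn_gt0// pfactorK// [logn _ _.+1]logn_coprime ?addn0//.
by rewrite coprime2n /= oddM.
Qed.

(** In an orthonormal basis let $K$ be diagonal with rapidly decreasing entries and
   let $B = 1 + G$, where $G$ sends the $m$-th basis vector to a vector whose
   coordinates along the infinite set of indices of $2$-adic valuation $m$
   decrease more slowly.  Then $Bz$ for $z$ in the range of $K$ has such slow
   coordinates unless $z = 0$, so that $K$ and $BKB^*$ have disjoint ranges. *)
Lemma disjoint_ranges : separable H -> infinite_dim H -> exists K Y : bounded_op H H,
  [/\ positive K /\ positive Y, compact_op K,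
      forall x, K x = 0 -> x = 0, forall x, Y x = 0 -> x = 0 &
      forall a b, K a = Y b -> b = 0].
Proof.
move=> sepH infH; have [e [eo tot]] := orthonormal_basis sepH infH.
have e1 n : nm (e n) <= 1.
  apply: sqr_le => //; rewrite expr1n -rdot_nm /rdot eo eqxx//.
pose k n : R := geo n.+1 ^+ 2.
have geo1 n : geo n <= 1 :> R.
  by apply: le_trans (geo_le _) _; rewrite invf_le1// ler1n.
have fk : fast_decay k.
  move=> n; rewrite sqr_ge0/= /k expr2 ler_piMl ?geo_ge0//.
have fg : fast_decay (fun n => geo n.+1 : R) by move=> n; rewrite geo_ge0 lexx.
pose K := rank1_series k e e.
have Ke x n : '[K x, e n] = (k n)%:C * '[x, e n].
  rewrite (series_coord fk e1 e1 x (n0 := n)) ?eo ?eqxx ?mulr1// => m mn.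
  by rewrite eo (negPf mn).
have k0 n : 0 < k n by rewrite exprn_gt0// geo_gt0.
have Kinj x : K x = 0 -> x = 0.
  move=> Kx; apply: tot => n; have := Ke x n; rewrite Kx dot0l => /esym/eqP.
  rewrite mulf_eq0 => /orP[|/eqP//]; by rewrite eq_complex/= gt_eqF.
have pK : positive K by exact: series_positive.
pose row m n := if logn 2 n == m then e n else 0.
have row1 m n : nm (row m n) <= 1 by rewrite /row; case: ifP; rewrite ?nm0.
pose g m := rank1_series (fun n => geo n.+1) (fun=> e 0%N) (row m) (e 0%N).
have ge m c : '[g m, e c] = if logn 2 c == m then (geo c.+1)%:C else 0.
  rewrite (series_coord fg (fun=> e1 0%N) (row1 m) (e 0%N) (n0 := c)) ?eo ?eqxx ?mulr1.
    by rewrite /row; case: ifP; rewrite ?eo ?eqxx ?mulr1// dot0l mulr0.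
  move=> n nc; rewrite /row; case: ifP => _; last by rewrite dot0l.
  by rewrite eo (negPf nc).
have g1 m : nm (g m) <= 1.
  apply: le_trans (nm_op1 _ (nm_series fg (fun=> e1 0%N) (row1 m))) _.
  have := e1 0%N; have := nm_ge0 (e 0%N); lra.
pose G := rank1_series (fun n => geo n.+1) e g.
pose G' := rank1_series (fun n => geo n.+1) g e.
have GG' x y : '[G x, y] = '[x, G' y] by exact: series_adj.
pose B := op1 H + G; pose B' := op1 H + G'.
have BB' x y : '[B x, y] = '[x, B' y] by rewrite !opDE !op1E dotDl dotDr GG'.
have B'inj y : B' y = 0 -> y = 0.
  rewrite /B' opDE op1E => /eqP; rewrite addr_eq0 => /eqP yE.
  apply: nm_le0; have h := nm_op1 y (nm_series fg g1 e1); rewrite -/G' in h.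
  have : nm y = nm (G' y) by rewrite {1}yE nmN.
  have := nm_ge0 y; lra.
pose Y := bop_comp B (bop_comp K B').
have YE x : Y x = B (K (B' x)) by [].
have pY : positive Y by move=> x; rewrite YE BB'; exact: pK.
have disj a b : K a = Y b -> b = 0.
  move=> ab; apply: B'inj; apply: Kinj; set z := K (B' b).
  apply: tot => m; pose C := nm a + nm (B' b).
  have C0 : 0 <= C by rewrite addr_ge0 ?nm_ge0.
  suff : (geo m.+1 : R)%:C * '[z, e m] = 0.
    by move/eqP; rewrite mulf_eq0 => /orP[|/eqP//]; rewrite eq_complex/= gt_eqF ?geo_gt0.
  apply: cm_small => r r0.
  have C1 : 0 < C + 1 by rewrite ltr_wpDl.
  have [N hN] := geo_lt (divr_gt0 r0 C1); have [c Nc cm_] := log2_fiber m N.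
  have gc0 := @geo_gt0 R c.+1.
  have E : (geo m.+1)%:C * '[z, e m] * (geo c.+1)%:C = (k c)%:C * ('[a, e c] - '[B' b, e c]).
    have : '[K a, e c] = '[z, e c] + '[G z, e c] by rewrite ab YE -/z /B opDE op1E dotDl.
    rewrite Ke {1}/z Ke (series_coord fg e1 g1 z (n0 := m)); last first.
      by move=> n nm_; rewrite ge cm_ eq_sym (negPf nm_).
    rewrite ge cm_ eqxx mulrBr => ->; ring.
  have h1 : cm ((geo m.+1 : R)%:C * '[z, e m]) * geo c.+1 <= k c * C.
    rewrite -[geo c.+1]ger0_norm ?geo_ge0// -cm_real -cmM E cmM cm_real ger0_norm ?(ltW (k0 c))//.
    rewrite ler_wpM2l ?(ltW (k0 c))//; apply: le_trans (cmD _ _) _; rewrite cmN.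
    by apply: lerD; apply: le_trans (cm_dot _ _) _; rewrite ler_piMr ?nm_ge0.
  have h2 : cm ((geo m.+1 : R)%:C * '[z, e m]) <= geo c.+1 * C.
    by rewrite -(ler_pM2r gc0); apply: le_trans h1 _; rewrite /k expr2 mulrAC.
  apply: le_trans h2 _; apply: le_trans (_ : geo c.+1 * (C + 1) <= _).
    by rewrite ler_wpM2l ?geo_ge0// lerDl.
  have := hN c.+1 (leqW Nc); rewrite ltr_pdivlMr//; exact: ltW.
exists K, Y; split=> //.
- exact: series_compact.
- by move=> x Yx; apply: (disj 0); rewrite bop0 Yx.
Qed.

End disjoint_ranges.

(** * Homotopies *)

Section homotopy.
Context {R : realType}.
Implicit Types X Y Z : topologicalType.

Lemma near_fst X Y (p : X * Y) (Q : X -> Prop) : (\forall x \near p.1, Q x) ->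
  \forall q \near p, Q q.1.
Proof. by move=> hQ; apply: (@cvg_fst _ _ (nbhs p.1) (nbhs p.2)). Qed.

Lemma near_snd X Y (p : X * Y) (Q : Y -> Prop) : (\forall y \near p.2, Q y) ->
  \forall q \near p, Q q.2.
Proof. by move=> hQ; apply: (@cvg_snd _ _ (nbhs p.1) (nbhs p.2)). Qed.

Lemma continuous_fst X Y : continuous (fst : X * Y -> X).
Proof. move=> p U hU; exact: near_fst hU. Qed.

Lemma continuous_snd X Y : continuous (snd : X * Y -> Y).
Proof. move=> p U hU; exact: near_snd hU. Qed.

Lemma continuous_fun_comp X Y Z (f : X -> Y) (g : Y -> Z) : continuous f -> continuous g ->
  continuous (fun x => g (f x)).
Proof. by move=> cf cg x; apply: continuous_comp; [exact: cf|exact: cg]. Qed.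

Lemma continuous_pair X Y Z (f : X -> Y) (g : X -> Z) : continuous f -> continuous g ->
  continuous (fun x => (f x, g x)).
Proof. move=> cf cg x; exact: (cvg_pair (cf x) (cg x)). Qed.

Lemma continuous_add X (f g : X -> R) : continuous f -> continuous g ->
  continuous (fun x => f x + g x).
Proof. by move=> cf cg x; exact: (cvgD (cf x) (cg x)). Qed.

Lemma continuous_mul X (f g : X -> R) : continuous f -> continuous g ->
  continuous (fun x => f x * g x).
Proof. by move=> cf cg x; exact: (cvgM (cf x) (cg x)). Qed.

Lemma continuous_time X (c : R -> R) : continuous c ->
  continuous (fun p : X * R => (p.1, c p.2)).
Proof.
move=> cc; apply: (@continuous_pair _ _ _ (fst : X * R -> X) (fun p : X * R => c p.2)).
  exact: continuous_fst.
exact: (@continuous_fun_comp _ _ _ (snd : X * R -> R) c (@continuous_snd X R) cc).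
Qed.

Definition clamp (t : R) : R := Num.max 0 (Num.min 1 t).

Lemma clamp01 t : 0 <= clamp t <= 1.
Proof. by rewrite le_max lexx/= ge_max ler01 ge_min lexx. Qed.

Lemma clamp_id t : 0 <= t <= 1 -> clamp t = t.
Proof. by move=> /andP[t0 t1]; rewrite /clamp min_r// max_r. Qed.

Lemma clamp_le0 t : t <= 0 -> clamp t = 0.
Proof. by move=> t0; rewrite /clamp max_l// ge_min t0 orbT. Qed.

Lemma clamp_ge1 t : 1 <= t -> clamp t = 1.
Proof. by move=> t1; rewrite /clamp min_l// max_r. Qed.

Lemma clampP t : [\/ t <= 0 /\ clamp t = 0, (0 <= t /\ t <= 1) /\ clamp t = t
  | 1 <= t /\ clamp t = 1].
Proof.
have [t0|/ltW t0] := leP t 0; first by constructor 1; rewrite clamp_le0.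
have [t1|/ltW t1] := leP t 1; first by constructor 2; rewrite clamp_id ?t0.
by constructor 3; rewrite clamp_ge1.
Qed.

Lemma clamp_lip s t : `|clamp s - clamp t| <= `|s - t|.
Proof.
rewrite ler_norml; have := ler_norm (s - t); have := ler_norm (t - s).
rewrite (distrC t); move: `|_| => r h1 h2.
case: (clampP s) => -[h3 ->]; case: (clampP t) => -[h4 ->]; apply/andP; split; lra.
Qed.

Lemma continuous_realP X (f : X -> R) : continuous f <->
  forall x0 (e : R), 0 < e -> \forall x \near x0, `|f x0 - f x| < e.
Proof.
split=> [cf x0 e e0|h x0]; first by move: (cf x0) => /cvgrPdist_lt; exact.
by apply/cvgrPdist_lt => e e0; exact: h.
Qed.

Lemma clamp_continuous X (f : X -> R) : continuous f -> continuous (clamp \o f).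
Proof.
move=> /continuous_realP cf; apply/continuous_realP => x0 e e0.
apply: filterS (cf x0 e e0) => x; apply: le_lt_trans; exact: clamp_lip.
Qed.

(** Clamping the time extends a homotopy to all real times, and continuity no longer
   refers to a subspace. *)
Lemma homotopicP X Y (f g : X -> Y) : homotopic R f g <->
  exists h : X * R -> Y, [/\ continuous h, forall x, h (x, 0) = f x & forall x, h (x, 1) = g x].
Proof.
split=> -[h [ch h0 h1]]; last first.
  by exists h; split=> //; exact: continuous_subspaceT.
exists (fun p => h (p.1, clamp p.2)); split=> [p|x|x]; last 2 first.
- by rewrite clamp_id ?lexx ?ler01// h0.
- by rewrite clamp_id ?lexx ?ler01// h1.
move/subspace_continuousP : ch => /(_ (p.1, clamp p.2)) ch.
have inA q : ([set: X] `*` `[0, 1]%classic) (q.1, clamp q.2).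
  by split=> //=; rewrite in_itv/= clamp01.
have {}ch := ch (inA p); move=> U /ch; rewrite /= /within/= => hU.
have cc : (fun q : X * R => (q.1, clamp q.2)) @ p --> (p.1, clamp p.2).
  exact: (continuous_time (clamp_continuous (fun x => cvg_id))).
have hq : \forall q \near p, ([set: X] `*` `[0, 1]%classic) (q.1, clamp q.2) ->
  U (h (q.1, clamp q.2)) by exact: cc _ hU.
by apply: (@filterS _ (nbhs p) _ _ _ _ hq) => q /= hUq; apply: hUq; exact: inA.
Qed.

Lemma homotopic_sym X Y (f g : X -> Y) : homotopic R f g -> homotopic R g f.
Proof.
move=> /homotopicP[h [ch h0 h1]]; apply/homotopicP; exists (fun p => h (p.1, 1 - p.2)).
split=> [|x|x]; rewrite ?subr0 ?subrr//.
have ct : continuous (fun t : R => 1 - t).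
  by move=> t; apply: cvgB; [exact: cvg_cst|exact: cvg_id].
exact: continuous_fun_comp (continuous_time ct) ch.
Qed.

Lemma homotopic_trans X Y (f g k : X -> Y) :
  homotopic R f g -> homotopic R g k -> homotopic R f k.
Proof.
move=> /homotopicP[h1 [c1 h10 h11]] /homotopicP[h2 [c2 h20 h21]]; apply/homotopicP.
pose k1 p := h1 (p.1, clamp (2 * p.2 + 0)); pose k2 p := h2 (p.1, clamp (2 * p.2 - 1)).
have lin (b : R) : continuous (fun t : R => clamp (2 * t + b)).
  apply: clamp_continuous; apply: continuous_add; last exact: cst_continuous.
  by apply: continuous_mul; [exact: cst_continuous|move=> t; exact: cvg_id].
have ck1 : continuous k1 by exact: continuous_fun_comp (continuous_time (lin 0)) c1.
have ck2 : continuous k2 by exact: continuous_fun_comp (continuous_time (lin (-1))) c2.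
exists (fun p => if p.2 <= 2^-1 then k1 p else k2 p); split=> [p|x|x]; last 2 first.
- by rewrite /= invr_ge0 ler0n /k1/= mulr0 addr0 clamp_id ?lexx ?ler01// h10.
- have -> : (1 <= 2^-1 :> R) = false by apply/negbTE; rewrite -ltNge; lra.
  by rewrite /k2/= mulr1 (_ : 2 - 1 = 1) ?clamp_id ?lexx ?ler01//; ring.
move=> U hU.
suff : \forall q \near p, U (if q.2 <= 2^-1 then k1 q else k2 q) by [].
move: hU; rewrite /=; have [plt|pgt|peq] := ltgtP p.2 2^-1 => hU.
- have n1 : \forall q \near p, U (k1 q) := ck1 p U hU.
  have n2 : \forall q \near p, q.2 < 2^-1 := near_snd (lt_nbhsl plt).
  by apply: filterS (filterI n1 n2) => q [? ql]; rewrite (ltW ql).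
- have n1 : \forall q \near p, U (k2 q) := ck2 p U hU.
  have n2 : \forall q \near p, 2^-1 < q.2 := near_snd (lt_nbhsr pgt).
  by apply: filterS (filterI n1 n2) => q [? ql]; rewrite leNgt ql.
- have k12 : k1 p = k2 p.
    by rewrite /k1 /k2 peq mulfV ?pnatr_eq0// subrr addr0 !clamp_id ?lexx ?ler01// h11 h20.
  have hU2 : nbhs (k2 p) U by rewrite -k12.
  have n1 : \forall q \near p, U (k1 q) := ck1 p U hU.
  have n2 : \forall q \near p, U (k2 q) := ck2 p U hU2.
  by apply: filterS (filterI n1 n2) => q [? ?]; case: ifP.
Qed.

Lemma homotopic_compl X Y Z (f g : X -> Y) (k : Y -> Z) : continuous k ->
  homotopic R f g -> homotopic R (k \o f) (k \o g).
Proof.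
move=> ck /homotopicP[h [ch h0 h1]]; apply/homotopicP; exists (k \o h).
by split=> [|x|x]; [exact: continuous_fun_comp ch ck|rewrite /= h0|rewrite /= h1].
Qed.

End homotopy.

(** * The homotopies in the Riesz topology *)

Section riesz_homotopy.
Context {R : realType} {H H' : hilbertType R}.
Implicit Types (P : set (regular H H')) (A : regular H H').

Definition mk_sub P X (f : X -> regular H H') (fP : forall x, P (f x)) : X -> set_type P :=
  fun x => SigSub (mem_set (fP x)).

Lemma nm_riesz_map A : nm (riesz_map A) <= 1.
Proof.
apply: nm_op_le => // x; rewrite mul1r; have [[_ _ n] _] := polar A.
by apply: sqr_le; rewrite ?nm_ge0// -n lerDr sqr_ge0.
Qed.

Lemma continuous_riesz_sub P (X : topologicalType) (f : X -> riesz_sub P) :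
  continuous f <-> continuous (fun x => set_val (f x) : riesz_top H H').
Proof.
split=> [cf x|cf].
  apply: (@continuous_comp _ (riesz_sub P) _ f); first exact: cf.
  exact: (@initial_continuous _ (riesz_top H H') (set_val : riesz_sub P -> riesz_top H H')).
exact: (@continuous_comp_initial (set_type P) X (riesz_top H H') set_val f cf).
Qed.

Lemma continuous_graph_sub P (X : topologicalType) (f : X -> graph_sub P) :
  continuous f <-> continuous (fun x => set_val (f x) : graph_top H H').
Proof.
split=> [cf x|cf].
  apply: (@continuous_comp _ (graph_sub P) _ f); first exact: cf.
  exact: (@initial_continuous _ (graph_top H H') (set_val : graph_sub P -> graph_top H H')).
exact: (@continuous_comp_initial (set_type P) X (graph_top H H') set_val f cf).
Qed.

Lemma riesz_to_graph_continuous P : continuous (@riesz_to_graph R H H' P).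
Proof.
apply/continuous_graph_sub; apply/continuous_graphP => A0 e e0.
have e20 : 0 < e / 2 by rewrite divr_gt0.
have [d d0 hd] := riesz_graph_close (set_val A0) e20.
have : continuous (fun x : riesz_sub P => set_val x : riesz_top H H').
  by apply/(@continuous_riesz_sub P _ id) => x; exact: cvg_id.
move=> /continuous_rieszP/(_ A0 d d0); apply: filterS => A /ltW/hd h.
apply: le_lt_trans h _; lra.
Qed.

Lemma mulu_dist A B (u w : unitary H) : nm (riesz_map (A \*u u) - riesz_map (B \*u w)) <=
  nm (riesz_map A - riesz_map B) + nm ((u : bounded_op H H) - (w : bounded_op H H)).
Proof.
rewrite !riesz_map_mulu; apply: nm_op_le => [|x]; first by rewrite addr_ge0 ?nm_ge0.
have -> : (bop_comp (riesz_map A) u - bop_comp (riesz_map B) w) x =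
   (riesz_map A - riesz_map B) (u x) + riesz_map B (((u : bounded_op H H) - (w : bounded_op H H)) x).
  by rewrite !opBE bopB addrA subrK.
apply: le_trans (nmD _ _) _; rewrite mulrDl; apply: lerD.
  by apply: le_trans (nm_op _ _) _; rewrite nm_unitary.
by apply: le_trans (nm_op1 _ (nm_riesz_map B)) _; rewrite mul1r nm_op.
Qed.

Variable v : regular H H' -> unitary H.
Hypothesis v_riesz_norm : continuous (v : riesz_top H H' -> unitary_norm_top H).

Lemma v_norm_near (A0 : riesz_top H H') (e : R) : 0 < e -> \forall A \near A0,
  nm ((v A0 : bounded_op H H) - (v A : bounded_op H H)) < e.
Proof. exact: ((@continuous_initialP _ _ _ (@unitary_op R H) (riesz_top H H') v).1 v_riesz_norm A0). Qed.

(** $A v(A)$ is joined to $A v(0)$ along $A v(\chi^{-1}(t\chi(A)))$, and $v(0)$ to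
   $1$ in the unitary group. *)
Lemma riesz_homotopy P (f : riesz_sub P -> riesz_sub P) :
  (forall A u, P A -> P (A \*u u)) ->
  (forall A : riesz_sub P, set_val (f A) = Phi v (set_val A)) -> homotopic R f idfun.
Proof.
move=> Pu fE.
have /choice[c hc] : forall p : regular H H' * R, exists B, riesz_map B = (clamp p.2)%:C *: riesz_map p.1.
  by move=> p; apply: scaled_exists; exact: clamp01.
have c1 A : c (A, 1) = A by apply: riesz_map_inj; rewrite hc/= clamp_id ?lexx ?ler01// scale1r.
have c0 A B : c (A, 0) = c (B, 0) by apply: riesz_map_inj; rewrite !hc/= clamp_id ?lexx ?ler01// !scale0r.
have cc : continuous (c : riesz_top H H' * R -> riesz_top H H').
  apply/continuous_rieszP => -[A0 t0] e e0.
  have e20 : 0 < e / 2 by rewrite divr_gt0.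
  have /continuous_rieszP ci := (fun x : riesz_top H H' => cvg_id : id @ x --> x).
  have n1 := @near_fst (riesz_top H H') R (A0, t0) _ (ci A0 _ e20).
  have /continuous_realP ct := @clamp_continuous R R id (fun x => cvg_id).
  have n2 := @near_snd (riesz_top H H') R (A0, t0) _ (ct t0 _ e20).
  apply: filterS (filterI n1 n2) => -[A t] /= [hA ht]; rewrite !hc/=.
  have -> : (clamp t0)%:C *: riesz_map A0 - (clamp t)%:C *: riesz_map A =
     (clamp t0 - clamp t)%:C *: riesz_map A0 + (clamp t)%:C *: (riesz_map A0 - riesz_map A).
    by rewrite rmorphB/= scalerBl scalerBr addrA subrK.
  apply: le_lt_trans (nmD _ _) _; rewrite !nmZr [e]splitr; apply: ltr_leD.
    by apply: le_lt_trans ht; rewrite ler_piMr// nm_riesz_map.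
  apply: le_trans (ltW hA); have /andP[a b] := clamp01 t.
  by rewrite ger0_norm// ler_piMl ?nm_ge0.
have mulu_eq A (u w : unitary H) : u =1 w -> A \*u u = A \*u w.
  move=> uw; apply: riesz_map_inj; rewrite !riesz_map_mulu.
  by apply: bop_inj => x /=; rewrite uw.
have mulu1 A (u : unitary H) : (forall x, u x = x) -> A \*u u = A.
  move=> u1; apply: riesz_map_inj; rewrite riesz_map_mulu.
  by apply: bop_inj => x /=; rewrite u1.
(* any operator serves as the base point, since [c] forgets it at time 0 *)
have [Z _] : exists Z : regular H H', True.
  have [|Z _] := @pair_regular R H H' (op1 H) 0; last by exists Z.
  split=> [x|x|x]; rewrite ?op1E ?op0E ?dot_nm//.
    by rewrite -[0]/(0%:C) lecR sqr_ge0.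
  by rewrite nm0 expr0n addr0.
pose u0 := v (c (Z, 0)).
have [g [g0 g1] gL] := unitary_connected u0.
have kP (A : riesz_sub P) : P (set_val A \*u u0) by apply: Pu; exact: set_valP.
apply: (@homotopic_trans R (riesz_sub P) (riesz_sub P) f (mk_sub kP) idfun).
  apply: homotopic_sym; apply/homotopicP.
  have hP (p : riesz_sub P * R) : P (set_val p.1 \*u v (c (set_val p.1, p.2))).
    by apply: Pu; exact: set_valP.
  exists (mk_sub hP : riesz_sub P * R -> riesz_sub P); split=> [|A|A]; last 2 first.
  - by apply: val_inj => /=; rewrite /u0 (c0 Z (set_val A)).
  - by apply: val_inj; rewrite -[RHS]/(set_val (f A)) fE /= c1.
  apply/continuous_riesz_sub; apply/continuous_rieszP => p0 e e0.
  have e20 : 0 < e / 2 by rewrite divr_gt0.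
  pose vc (p : riesz_sub P * R) := (set_val p.1 : riesz_top H H', p.2).
  have cv : continuous vc.
    apply: continuous_pair; last exact: continuous_snd.
    by apply/continuous_riesz_sub; exact: continuous_fst.
  have /continuous_rieszP c2 : continuous (fun p : riesz_sub P * R => set_val p.1 : riesz_top H H').
    by apply/continuous_riesz_sub; exact: continuous_fst.
  have cvc : continuous (fun p => c (vc p) : riesz_top H H') by apply: continuous_fun_comp cv cc.
  have n1 := c2 p0 _ e20.
  have n2 : \forall p \near p0, nm ((v (c (vc p0)) : bounded_op H H) - (v (c (vc p)) : bounded_op H H)) < e / 2.
    exact: (cvc p0 _ (v_norm_near (c (vc p0)) e20)).
  apply: filterS (filterI n1 n2) => p [h1 h2] /=.
  by apply: le_lt_trans (mulu_dist _ _ _ _) _; rewrite [e]splitr ltrD.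
apply/homotopicP.
have hP (p : riesz_sub P * R) : P (set_val p.1 \*u g (clamp p.2)).
  by apply: Pu; exact: set_valP.
exists (mk_sub hP : riesz_sub P * R -> riesz_sub P); split=> [|A|A]; last 2 first.
- by apply: val_inj => /=; rewrite clamp_id ?lexx ?ler01//; apply: mulu_eq.
- by apply: val_inj => /=; rewrite clamp_id ?lexx ?ler01// mulu1.
apply/continuous_riesz_sub; apply/continuous_rieszP => p0 e e0.
have e20 : 0 < e / 2 by rewrite divr_gt0.
have e80 : 0 < e / 2 / 8 by rewrite divr_gt0.
have /continuous_rieszP c2 : continuous (fun p : riesz_sub P * R => set_val p.1 : riesz_top H H').
  by apply/continuous_riesz_sub; exact: continuous_fst.
have /continuous_realP c3 := clamp_continuous (@continuous_snd (riesz_sub P) R).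
apply: filterS (filterI (c2 p0 _ e20) (c3 p0 _ e80)) => p [/= h1 h2].
apply: le_lt_trans (mulu_dist _ _ _ _) _; rewrite [e]splitr; apply: ltrD => //.
apply: le_lt_trans (gL _ _ (clamp01 _) (clamp01 _)) _.
by rewrite mulrC -ltr_pdivlMr.
Qed.

End riesz_homotopy.

(** * The homotopies in the graph topology *)

Section graph_homotopy.
Context {R : realType} {H H' : hilbertType R}.
Implicit Types (P : set (regular H H')) (A B : regular H H') (b t : R).

Lemma real_scale_continuous (X : topologicalType) (c : X -> R) (g : X -> H) :
  continuous c -> continuous g -> continuous (fun x => (c x)%:C *: g x).
Proof.
move=> cc cg x; apply: (@cvgZ _ _ _ _ _ (fun x => (c x)%:C)); last exact: cg.
apply/cvgrPdist_lt => e /ltC_real[r r0 ->].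
have /continuous_realP/(_ x r r0) := cc; apply: filterS => y h.
by rewrite -rmorphB/= cmE cm_real ltcR.
Qed.

Lemma affine_op_positive b (K : bounded_op H H) : positive K -> 0 <= b <= 1 ->
  positive (affine_op b (1 - b) K).
Proof.
move=> /positiveP[sK rK] /andP[b0 b1]; apply/positiveP; split=> [x y|x].
  by rewrite !affine_opE dotDl dotDr !dotZl !dotZrR sK.
rewrite affine_opE rdotDl !rdotZl rdot_nm addr_ge0// mulr_ge0 ?sqr_ge0 ?rK//; lra.
Qed.

Lemma affine_op_inj b (K : bounded_op H H) x : positive K -> (forall x, K x = 0 -> x = 0) ->
  0 <= b <= 1 -> affine_op b (1 - b) K x = 0 -> x = 0.
Proof.
move=> /positiveP[sK rK] inj /andP[b0 b1] h.
have [b1'|b1'] := eqVneq b 1.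
  by apply: inj; move: h; rewrite affine_opE b1' subrr rmorph0 scale0r addr0 rmorph1 scale1r.
have b2 : 0 < 1 - b by rewrite subr_gt0 lt_neqAle b1' b1.
have : rdot (affine_op b (1 - b) K x) x = 0 by rewrite h rdot0l.
rewrite affine_opE rdotDl !rdotZl rdot_nm => E.
have h1 : 0 <= b * rdot (K x) x by rewrite mulr_ge0.
have h2 : (1 - b) * nm x ^+ 2 <= 0 by lra.
apply: nm_eq0; apply/eqP; rewrite -sqrf_eq0 eq_le sqr_ge0 andbT.
by rewrite -(pmulr_rle0 _ b2).
Qed.

Lemma nm_affine_op b (K : bounded_op H H) : 0 <= b <= 1 -> nm (affine_op b (1 - b) K) <= nm K + 1.
Proof.
move=> /andP[b0 b1]; apply: nm_op_le => [|x]; first by rewrite addr_ge0 ?nm_ge0.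
rewrite affine_opE; apply: le_trans (nmD _ _) _; rewrite !nmZr mulrDl mul1r ger0_norm// ger0_norm ?subr_ge0//.
have h := nm_op K x; have h0 := nm_ge0 (K x); have h1 := nm_ge0 x.
apply: lerD; first by apply: le_trans h; rewrite ler_piMl.
by rewrite ler_piMl//; lra.
Qed.

Lemma mulu_push A (u : unitary H) :
  rgraph (A \*u u) = push_graph (unitary_inv_op u) (rgraph A).
Proof.
apply/seteqP; split=> -[x y]; rewrite muluE.
  by move=> h; exists (u x); rewrite //= unitaryK.
by move=> [z /= Az ->]; rewrite unitary_invK.
Qed.

Lemma push_id A (T : bounded_op H H) : (forall x, T x = x) ->
  push_graph T (rgraph A) = rgraph A.
Proof.
move=> T1; apply/seteqP; split=> -[x y]; first by move=> [z /= Az ->]; rewrite T1.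
by move=> Axy; exists x; rewrite /= ?T1.
Qed.

Lemma push_ext A (S T : bounded_op H H) : S =1 T ->
  push_graph S (rgraph A) = push_graph T (rgraph A).
Proof. by move=> /bop_inj ->. Qed.

Section strong.
Variables (K Y : bounded_op H H).
Hypotheses (pK : positive K) (pY : positive Y) (Kinj : forall x, K x = 0 -> x = 0)
  (Yinj : forall x, Y x = 0 -> x = 0) (KY : forall x y : H, K x = Y y -> y = 0).

Implicit Types (a c d : R) (W : bounded_op H H) (x y : H).

Definition path_op (a b c d : R) (W : bounded_op H H) : bounded_op H H :=
  a%:C *: bop_comp (affine_op b (1 - b) K) (bop_comp W (affine_op b (1 - b) K)) +
  c%:C *: affine_op d (1 - d) Y.

Lemma path_opE a b c d W x : path_op a b c d W x =
  a%:C *: affine_op b (1 - b) K (W (affine_op b (1 - b) K x)) + c%:C *: affine_op d (1 - d) Y x.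
Proof. by []. Qed.

(** While $a$ and $c$ are both positive, $b=d=1$ and the two summands have disjoint
   ranges, so no cancellation can occur, whatever the injective operator [W] is. *)
Lemma path_op_inj a b c d W x : (forall x, W x = 0 -> x = 0) ->
  0 <= a -> 0 <= c -> 0 < a + c -> 0 <= b <= 1 -> 0 <= d <= 1 ->
  [\/ a = 0, c = 0 | b = 1 /\ d = 1] -> path_op a b c d W x = 0 -> x = 0.
Proof.
move=> Winj a0 c0 ac b01 d01 reg; rewrite path_opE.
have r0 (r : R) : (r%:C == 0 :> R[i]) = (r == 0) by rewrite eq_complex/= eqxx andbT.
have iK := @affine_op_inj b K _ pK Kinj b01; have iY := @affine_op_inj d Y _ pY Yinj d01.
have [az|az] := eqVneq a 0.
  rewrite az rmorph0 scale0r add0r => /eqP; rewrite scaler_eq0 r0 => /orP[|/eqP/iY//].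
  by move=> /eqP c00; move: ac; rewrite az c00 addr0 ltxx.
have [cz|cz] := eqVneq c 0.
  rewrite cz rmorph0 scale0r addr0 => /eqP; rewrite scaler_eq0 r0 (negPf az)/=.
  by move=> /eqP/iK/Winj/iK.
case: reg => [/eqP|/eqP|[-> ->]]; rewrite ?(negPf az) ?(negPf cz)//.
have c1 V z : affine_op 1 (1 - 1) V z = V z.
  by rewrite affine_opE subrr rmorph0 rmorph1 scale0r addr0 scale1r.
rewrite !c1 => h.
have : K (a%:C *: W (K x)) = Y (- (c%:C *: x)).
  by rewrite bopN !bopZ; apply/eqP; rewrite -addr_eq0 h.
move=> /KY /eqP; rewrite oppr_eq0 scaler_eq0 r0 (negPf cz)/= => /eqP//.
Qed.

Lemma path_op_adj a b c d W W' : (forall x y, '[W x, y] = '[x, W' y]) ->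
  0 <= b <= 1 -> 0 <= d <= 1 ->
  forall x y, '[path_op a b c d W x, y] = '[x, path_op a b c d W' y].
Proof.
move=> WW' b01 d01 x y.
have [sK _] := (positiveP _).1 (affine_op_positive pK b01).
have [sY _] := (positiveP _).1 (affine_op_positive pY d01).
by rewrite !path_opE dotDl dotDr !dotZl !dotZrR sK WW' sK sY.
Qed.

(** First $b$ grows to $1$, which leads from [W] to $KWK$; then $(a,c)$ moves from
   $(1,0)$ to $(0,1)$, which leads to $Y$; then $d$ falls to $0$, which leads to $1$. *)
Definition strong_path t : bounded_op H H -> bounded_op H H :=
  path_op (1 - clamp (3 * t - 1)) (clamp (3 * t)) (clamp (3 * t - 1)) (1 - clamp (3 * t - 2)).

Lemma strong_path_regime t :
  [\/ 1 - clamp (3 * t - 1) = 0, clamp (3 * t - 1) = 0 |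
      clamp (3 * t) = 1 /\ 1 - clamp (3 * t - 2) = 1].
Proof.
case: (clampP (3 * t - 1)) => -[h ->]; first by constructor 2.
  by constructor 3; rewrite clamp_ge1 ?(@clamp_le0 _ (3 * t - 2)) ?subr0//; lra.
by constructor 1; rewrite subrr.
Qed.

Lemma strong_path_quasi t (u : unitary H) :
  quasi_affine (strong_path t (unitary_inv_op u)) (strong_path t u).
Proof.
have c1 := clamp01 (3 * t - 1); have c2 := clamp01 (3 * t); have c3 := clamp01 (3 * t - 2).
have c3' : 0 <= 1 - clamp (3 * t - 2) <= 1 by case/andP: c3 => *; apply/andP; split; lra.
case/andP: (c1) => c10 c11.
have inj W : (forall x, W x = 0 -> x = 0) -> forall x, strong_path t W x = 0 -> x = 0.
  move=> Winj x; apply: path_op_inj => //; last exact: strong_path_regime.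
    by rewrite subr_ge0.
  by rewrite subrK.
split; first exact: path_op_adj (unitary_inv_dot u) c2 c3'.
- apply: inj => x ux; apply: nm_eq0; rewrite -[LHS](nm_unitary_inv_op u x).
  by rewrite ux nm0.
- by apply: inj => x ux; apply: nm_eq0; rewrite -(nm_unitary u) ux nm0.
Qed.

Lemma nm_strong_path t W : nm W <= 1 ->
  nm (strong_path t W) <= (nm K + 1) ^+ 2 + (nm Y + 1).
Proof.
move=> W1; have c1 := clamp01 (3 * t - 1); have c2 := clamp01 (3 * t); have c3 := clamp01 (3 * t - 2).
have c3' : 0 <= 1 - clamp (3 * t - 2) <= 1 by case/andP: c3 => *; apply/andP; split; lra.
case/andP: (c1) => c10 c11.
have nK := nm_affine_op K c2; have nY := nm_affine_op Y c3'.
apply: le_trans (nmD _ _) _; rewrite !nmZr; apply: lerD; last first.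
  by rewrite ger0_norm//; apply: le_trans nY; rewrite ler_piMl ?nm_ge0.
rewrite ger0_norm ?subr_ge0//; apply: le_trans (_ : nm (bop_comp (affine_op (clamp (3 * t)) (1 - clamp (3 * t)) K) (bop_comp W (affine_op (clamp (3 * t)) (1 - clamp (3 * t)) K))) <= _).
  by rewrite ler_piMl ?nm_ge0//; lra.
apply: le_trans (nm_comp _ _) _; rewrite expr2; apply: ler_pM; rewrite ?nm_ge0//.
apply: le_trans (nm_comp _ _) _; apply: le_trans nK; by rewrite ler_piMl ?nm_ge0.
Qed.

Lemma nm_unitary_inv (u : unitary H) : nm (unitary_inv_op u) <= 1.
Proof. by apply: nm_op_le => // x; rewrite mul1r nm_unitary_inv_op. Qed.

Lemma strong_path0 W x : strong_path 0 W x = W x.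
Proof.
have e1 : clamp (3 * 0 - 1) = 0 :> R by rewrite clamp_le0//; lra.
have e2 : clamp (3 * 0) = 0 :> R by rewrite clamp_le0//; lra.
have c0 V y : affine_op 0 (1 - 0) V y = y.
  by rewrite affine_opE rmorph0 scale0r add0r subr0 rmorph1 scale1r.
by rewrite /strong_path e1 e2 path_opE !c0 subr0 rmorph0 scale0r addr0 rmorph1 scale1r.
Qed.

Lemma strong_path1 W x : strong_path 1 W x = x.
Proof.
have e1 : clamp (3 * 1 - 1) = 1 :> R by rewrite clamp_ge1//; lra.
have e2 : clamp (3 * 1 - 2) = 1 :> R by rewrite clamp_ge1//; lra.
rewrite /strong_path e1 e2 path_opE subrr rmorph0 scale0r add0r rmorph1 scale1r.
by rewrite affine_opE rmorph0 scale0r add0r subr0 rmorph1 scale1r.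
Qed.

Variable v : regular H H' -> unitary H.
Hypothesis v_graph_strong : continuous (v : graph_top H H' -> unitary_strong_top H).

Lemma v_strong x : continuous (fun A : graph_top H H' => v A x).
Proof.
move=> A; have c : continuous ((fun u : unitary_strong_top H => (u : H -> H) : {ptws H -> H}) \o (v : graph_top H H' -> unitary_strong_top H)).
  move=> B; apply: continuous_comp; first exact: v_graph_strong.
  exact: (@initial_continuous _ _ (fun u : unitary H => (u : H -> H) : {ptws H -> H})).
have FF := fmap_filter (fun B : graph_top H H' => v B : H -> H) (nbhs_filter A).
exact ((pointwise_cvgP (v A : H -> H) FF).1 (c A) x).
Qed.

(** With $z = v(A_0)^{-1}x$ one has
   $\|v(A_0)^{-1}x - v(A)^{-1}x\| = \|v(A)z - v(A_0)z\|$. *)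
Lemma v_inv_strong x : continuous (fun A : graph_top H H' => unitary_inv_op (v A) x).
Proof.
move=> A0; set z := unitary_inv_op (v A0) x.
have F1 := fmap_filter (fun A : graph_top H H' => unitary_inv_op (v A) x) (nbhs_filter A0).
have F2 := fmap_filter (fun A : graph_top H H' => v A z) (nbhs_filter A0).
apply/(cvg_nmP F1) => e e0; have h := (cvg_nmP F2 _).1 (@v_strong z A0) e e0.
have vz : v A0 z = x by exact: unitary_invK.
apply: (@filterS _ _ (nbhs_filter A0) _ _ _ h) => A; rewrite vz.
by rewrite /= nm_sub -[nm (unitary_inv_fun _ _ - _)](nm_unitary (v A)) bopB unitary_invK.
Qed.

(** Only one factor of each product varies in the strong topology; the others vary in
   norm. *)
Lemma strong_path_continuous (X : topologicalType) (lam : X -> graph_top H H') x :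
  continuous lam ->
  continuous (fun p : X * R => strong_path p.2 (unitary_inv_op (v (lam p.1))) x).
Proof.
move=> cl.
have lin (r : R) : continuous (fun p : X * R => 3 * p.2 + r).
  apply: continuous_add; last exact: cst_continuous.
  by apply: continuous_mul; [exact: cst_continuous|exact: continuous_snd].
have cb : continuous (fun p : X * R => clamp (3 * p.2)).
  by apply: clamp_continuous; apply: continuous_mul; [exact: cst_continuous|exact: continuous_snd].
have ca : continuous (fun p : X * R => clamp (3 * p.2 - 1)) := clamp_continuous (lin (-1)).
have cd : continuous (fun p : X * R => clamp (3 * p.2 - 2)) := clamp_continuous (lin (-2)).
have c1 (f : X * R -> R) : continuous f -> continuous (fun p => 1 - f p).
  by move=> cf p; apply: cvgB; [exact: cvg_cst|exact: cf].
have cD (f g : X * R -> H) : continuous f -> continuous g -> continuous (fun p => f p + g p).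
  by move=> cf cg p; exact: (cvgD (cf p) (cg p)).
have cW y : continuous (fun p : X * R => unitary_inv_op (v (lam p.1)) y).
  apply: (@continuous_fun_comp _ _ _ (fun p : X * R => lam p.1) (fun A => unitary_inv_op (v A) y)).
    exact: (@continuous_fun_comp _ _ _ (fst : X * R -> X) lam (@continuous_fst X R) cl).
  exact: v_inv_strong.
have cop (V : bounded_op H H) (f : X * R -> H) : continuous f -> continuous (fun p => V (f p)).
  by move=> cf; exact: (continuous_fun_comp cf (@bop_continuous _ _ _ V)).
have ccay (V : bounded_op H H) (b : X * R -> R) (f : X * R -> H) : continuous b -> continuous f ->
    continuous (fun p => affine_op (b p) (1 - b p) V (f p)).
  move=> cb' cf; apply: (cD).
    by apply: real_scale_continuous => //; exact: cop.
  by apply: real_scale_continuous => //; exact: (c1).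
apply: (cD); last first.
  apply: real_scale_continuous => //; apply: (@ccay Y (fun p => 1 - clamp (3 * p.2 - 2)) (fun=> x)).
    exact: (c1).
  exact: cst_continuous.
apply: real_scale_continuous; first exact: (c1).
apply: (ccay) => //.
have -> : (fun p : X * R => unitary_inv_op (v (lam p.1)) (affine_op (clamp (3 * p.2)) (1 - clamp (3 * p.2)) K x)) =
  (fun p : X * R => (clamp (3 * p.2))%:C *: unitary_inv_op (v (lam p.1)) (K x) +
     (1 - clamp (3 * p.2))%:C *: unitary_inv_op (v (lam p.1)) x).
  by apply/funext => p; rewrite affine_opE bopD !bopZ.
by apply: (cD); apply: real_scale_continuous => //; exact: (c1).
Qed.

(** On operators with compact resolvents $A v(A)$ is joined to $A$ by replacing
   $v(A)^{-1}$ by a strongly continuous path of injective operators. *)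
Lemma compact_homotopy (X : topologicalType) (lam : X -> graph_top H H') P
    (f g : X -> graph_sub P) : continuous lam ->
  (forall x : X, compact_resolvents (lam x)) ->
  (forall (x : X) T T' B, quasi_affine T T' -> rgraph B = push_graph T (rgraph (lam x)) -> P B) ->
  (forall x : X, set_val (f x) = Phi v (lam x)) -> (forall x : X, set_val (g x) = lam x) ->
  homotopic R f g.
Proof.
move=> cl cK Ppush fE gE.
pose T (p : X * R) := strong_path p.2 (unitary_inv_op (v (lam p.1))).
have qT p : quasi_affine (T p) (strong_path p.2 (v (lam p.1))) by exact: strong_path_quasi.
have bT p : bounded_below (T p) (rgraph (lam p.1)).
  by apply: compact_bounded_below => // x; have [_ h _] := qT p; exact: h.
have pE p := pushP (qT p) (bT p).
have hP p : P (push (T p) (lam p.1)) by apply: Ppush (qT p) (pE p).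
apply/homotopicP; exists (mk_sub hP : X * R -> graph_sub P); split=> [|x|x]; last 2 first.
- apply: val_inj; rewrite -[RHS]/(set_val (f x)) fE /=; apply: regular_inj.
  rewrite pE mulu_push; apply: push_ext => y; exact: strong_path0.
- apply: val_inj; rewrite -[RHS]/(set_val (g x)) gE /=; apply: regular_inj.
  rewrite pE; apply: push_id => y; exact: strong_path1.
apply/continuous_graph_sub.
have M0 : 0 <= (nm K + 1) ^+ 2 + (nm Y + 1) by rewrite !addr_ge0 ?sqr_ge0 ?nm_ge0.
have Tb p : nm (T p) <= (nm K + 1) ^+ 2 + (nm Y + 1).
  exact: nm_strong_path (nm_unitary_inv _).
have cl1 : continuous (fun p : X * R => lam p.1).
  exact: (@continuous_fun_comp _ _ _ (fst : X * R -> X) lam (@continuous_fst X R) cl).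
apply: (@push_continuous R H H' _ (fun p : X * R => lam p.1) _ T _ cl1 M0 Tb bT) => // p0 e e0.
have [tA _] := (compact_resolventsP (lam p0.1)).1 (cK p0.1).
apply: strong_uniform (rgraph_sub (lam p0.1)) tA M0 Tb _ _ e0 => a e' e'0.
have FF := fmap_filter (fun p : X * R => strong_path p.2 (unitary_inv_op (v (lam p.1))) a) (nbhs_filter p0).
have h := (cvg_nmP FF _).1 (@strong_path_continuous X lam a cl p0) e' e'0.
exact: (@filterS _ _ (nbhs_filter p0) _ _ _ h).
Qed.

End strong.

(** In the graph topology every Fredholm operator is joined to one with compact
   resolvents by shrinking the variable with a compact injective operator. *)
Lemma fredholm_homotopy (K : bounded_op H H) : positive K -> compact_op K ->
  (forall x, K x = 0 -> x = 0) ->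
  exists L : graph_sub (@fredholm R H H') -> graph_sub (@fredholm R H H'),
  [/\ continuous L, homotopic R idfun L & forall A : graph_sub (@fredholm R H H'), compact_resolvents (set_val (L A))].
Proof.
move=> pK cK Kinj.
pose P := @fredholm R H H'.
pose T (p : graph_sub P * R) := affine_op (clamp p.2) (1 - clamp p.2) K.
have qT p : quasi_affine (T p) (T p).
  have [sT _] := (positiveP _).1 (affine_op_positive pK (clamp01 p.2)).
  by split=> //; move=> x; exact: affine_op_inj (clamp01 p.2).
have fA (p : graph_sub P * R) : fredholm (set_val p.1) by exact: set_valP.
have bT p : bounded_below (T p) (rgraph (set_val p.1)).
  have [cA kA _] := fA p; apply: closed_ran_bounded_below => // x.
  by have [_ h _] := qT p; exact: h.
have pE p := pushP (qT p) (bT p).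
have hP p : P (push (T p) (set_val p.1)) by exact: fredholm_push (qT p) (pE p) (fA p).
pose h : graph_sub P * R -> graph_sub P := mk_sub hP.
have cv : continuous (fun p : graph_sub P * R => set_val p.1 : graph_top H H').
  by apply/continuous_graph_sub; exact: continuous_fst.
have ch : continuous h.
  apply/continuous_graph_sub.
  have M0 : 0 <= nm K + 1 by rewrite addr_ge0 ?nm_ge0.
  have Tb p : nm (T p) <= nm K + 1 by apply: nm_affine_op; exact: clamp01.
  apply: (push_continuous cv M0 Tb bT) => // p0 e e0.
  have M1 : 0 < nm K + 1 by rewrite ltr_wpDl ?nm_ge0.
  have /continuous_realP/(_ p0 _ (divr_gt0 e0 M1)) := clamp_continuous (@continuous_snd (graph_sub P) R).
  apply: filterS => p; rewrite /= ltr_pdivlMr// => hp a b _.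
  suff : nm ((T p0 - T p) a) <= e * nm ((a, b) : hsum H H') by [].
  have -> : (T p0 - T p) a = (clamp p0.2 - clamp p.2)%:C *: (K a - a).
    rewrite opBE !affine_opE; apply: dot_inj => z.
    by rewrite !dot_expand !rmorphB/= rmorph1; ring.
  rewrite nmZr; apply: le_trans (_ : `|clamp p0.2 - clamp p.2| * ((nm K + 1) * nm a) <= _).
    rewrite ler_wpM2l//; apply: le_trans (nmB _ _) _; rewrite mulrDl mul1r lerD2r; exact: nm_op.
  rewrite mulrA; apply: ler_pM; rewrite ?nm_ge0 ?mulr_ge0 ?(ltW M1)//; first exact: ltW.
  exact: (nm_fst ((a, b) : hsum H H')).
exists (fun A : graph_sub P => h (A, 1)); split.
- apply: (@continuous_fun_comp _ _ _ (fun A : graph_sub P => (A, 1 : R)) h) => //.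
  by apply: continuous_pair; [move=> x; exact: cvg_id|exact: cst_continuous].
- apply/homotopicP; exists h; split=> // A.
  apply: val_inj => /=; apply: regular_inj; rewrite pE; apply: push_id => x.
  rewrite -[T _ x]/(affine_op (clamp 0) (1 - clamp 0) K x) clamp_id ?lexx ?ler01// affine_opE rmorph0 scale0r add0r subr0 rmorph1.
  by rewrite scale1r.
- move=> A; have TK : T (A, 1) = K.
    apply: bop_inj => x; rewrite -[T _ x]/(affine_op (clamp 1) (1 - clamp 1) K x) clamp_id ?lexx ?ler01// affine_opE rmorph1 scale1r.
    by rewrite subrr rmorph0 scale0r addr0.
  have cT : compact_op (T (A, 1)) by rewrite TK.
  exact (fredholm_push_compact (qT (A, 1)) cT cT (pE (A, 1)) (fA (A, 1))).
Qed.

End graph_homotopy.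

Theorem theorem2 (R : realType) (H H' : hilbertType R)
  (sepH : separable H) (sepH' : separable H')
  (infH : infinite_dim H) (infH' : infinite_dim H')
  (v : regular H H' -> unitary H)
  (v_riesz_norm : continuous (v : riesz_top H H' -> unitary_norm_top H))
  (v_graph_strong : continuous (v : graph_top H H' -> unitary_strong_top H))
  (Phi_graph_riesz : continuous (Phi v : graph_top H H' -> riesz_top H H')) :
  homotopy_inverse R
    (graph_to_riesz (@Phi_compact_resolvents R H H' v))
    (riesz_to_graph (P := compact_resolvents)) /\
  homotopy_inverse R
    (graph_to_riesz (@Phi_fredholm R H H' v))
    (riesz_to_graph (P := fredholm)).
Proof.
have [K [Y [[pK pY] cK Kinj Yinj KY]]] := disjoint_ranges sepH infH.
have cval P : continuous (fun A : graph_sub P => set_val A : graph_top H H').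
  by apply/(@continuous_graph_sub _ _ _ P _ id) => x; exact: cvg_id.
have cphi P (fP : forall A, P A -> P (Phi v A)) : continuous (graph_to_riesz fP).
  apply/continuous_riesz_sub.
  exact: (@continuous_fun_comp _ _ _ (fun A : graph_sub P => set_val A : graph_top H H')
    (Phi v : graph_top H H' -> riesz_top H H') (cval P)).
have cid P : continuous (@riesz_to_graph R H H' P) by exact: riesz_to_graph_continuous.
pose CR := graph_sub (@compact_resolvents R H H'); pose FR := graph_sub (@fredholm R H H').
have graph_path := compact_homotopy pK pY Kinj Yinj KY v_graph_strong.
split; (split; [exact: cphi|exact: cid| |]).
- apply: (graph_path CR (fun A => set_val A) _ _ _ (cval _) (fun A => set_valP A)) => //.
  by move=> A T T' B qT BE; exact (compact_push qT BE (set_valP A)).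
- by apply: (riesz_homotopy v_riesz_norm) => // A u; exact: compact_resolvents_mulu.
- have [L [cL idL LK]] := @fredholm_homotopy R H H' K pK cK Kinj.
  (* [G] is homotopic to [G \o L] by its continuity, and [G \o L] to [L] because [L]
     takes values with compact resolvents *)
  set G : FR -> FR := _ \o _.
  have cG : continuous G := continuous_fun_comp (cphi _ _) (cid _).
  apply: (@homotopic_trans R FR FR G (G \o L) idfun); first exact: homotopic_compl cG idL.
  apply: (@homotopic_trans R FR FR _ L) (homotopic_sym idL).
  apply: (graph_path FR (fun A => set_val (L A))) => //.
    exact: (@continuous_fun_comp _ _ _ L (fun A : FR => set_val A : graph_top H H') cL (cval _)).
  by move=> A T T' B qT BE; exact (fredholm_push qT BE (set_valP (L A))).
- by apply: (riesz_homotopy v_riesz_norm) => // A u; exact: fredholm_mulu.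
Qed.
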